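(* Let $f\in\mathcal{S}(\mathbb{R}^2;E^2(2))$ be an elastic $2$-tensor field satisfying $\int_{\mathbb{R}^2}f(x)\,dx=0$ (componentwise). Then there exist an elastic $2$-tensor field $g\in C^\infty(\mathbb{R}^2;E^2(2))$, a vector field $u\in C^\infty(\mathbb{R}^2;\mathbb{R}^2)$ and an elastic $1$-tensor field $v\in C^\infty(\mathbb{R}^2;E^1(2))$ such that $$f(x)=Hv(x)+Ku(x)+g(x)\quad\text{with}\quad K^*g(x)=H^*g(x)=0\quad\text{for all } x\in\mathbb{R}^2,$$ and such that $v$ and $u$ satisfy, for some constant $C$ and all $x\in\mathbb{R}^2$ and all indices $i,j,k\in\{1,2\}$, the decay estimates $$|u_i(x)|\le C(1+|x|)^{-1}\quad\text{and}\quad |\partial_{x_k}v_{ij}(x)|\le C(1+|x|)^{-1}.$$ Moreover, $g$ and $Hv+Ku$ are uniquely determined by $f$ (among all triples $(g,u,v)$ with these properties).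
   Context: $E^1(n)=S^2(\mathbb{R}^n)$ is the space of symmetric $2$-tensors on $\mathbb{R}^n$. $E^2(n)$ is the space of elastic $2$-tensors: $4$-tensors $w=(w_{ijkl})$ on $\mathbb{R}^n$ with $w_{ijkl}=w_{jikl}=w_{ijlk}=w_{klij}$. $C^\infty(\mathbb{R}^n;V)$ and $\mathcal{S}(\mathbb{R}^n;V)$ denote the $V$-valued tensor fields with smooth, respectively Schwartz, components; their elements for $V=E^m(n)$ are called elastic $m$-tensor fields. For smooth $v$ with values in $E^1(n)$, smooth $u$ with values in $\mathbb{R}^n$, and smooth $w$ with values in $E^2(n)$, define (with all summations from $1$ to $n$) $$(Hv)_{ijkl}=\tfrac12\left(\frac{\partial^2v_{kl}}{\partial x_i\partial x_j}+\frac{\partial^2v_{ij}}{\partial x_k\partial x_l}\right),\qquad (H^*w)_{ij}=\sum_{k,l}\frac{\partial^2w_{ijkl}}{\partial x_k\partial x_l},$$ $$(Ku)_{ijkl}=\tfrac14\left(\frac{\partial u_j}{\partial x_i}+\frac{\partial u_i}{\partial x_j}\right)\delta_{kl}+\tfrac14\left(\frac{\partial u_k}{\partial x_l}+\frac{\partial u_l}{\partial x_k}\right)\delta_{ij},\qquad (K^*w)_i=-\sum_{j,k}\frac{\partial w_{ijkk}}{\partial x_j},$$ where $\delta_{ij}$ is the Kronecker delta. *)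

(* Defs.v *)
From HB Require Import structures.
From mathcomp Require Import all_boot all_order all_algebra.
From mathcomp Require Import all_classical all_reals all_analysis.

Set Implicit Arguments.
Unset Strict Implicit.
Unset Printing Implicit Defensive.

Import Order.TTheory GRing.Theory Num.Theory.
Import numFieldNormedType.Exports.

Local Open Scope ring_scope.

(* Points of R^n are row vectors.  Vectors, 2-tensors and 4-tensors on R^n
   take their values in 'rV[R]_n, 'M[R]_n and tensor4 R n respectively. *)
Definition tensor4 (R : realType) (n : nat) : Type :=
  'I_n -> 'I_n -> 'I_n -> 'I_n -> R.

(* The norm `|x| that the library puts on 'rV[R]_n is the sup norm; the length
   of a vector is the Euclidean one. *)
Definition enorm (R : realType) (n : nat) (x : 'rV[R]_n) : R :=
  Num.sqrt (\sum_(i < n) x 0 i ^+ 2).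

Definition partial (R : realType) (n : nat) (i : 'I_n) (h : 'rV[R]_n -> R) :
  'rV[R]_n -> R := fun x => 'D_(delta_mx 0 i) h x.

(* Iterated derivatives are indexed by the list of the differentiation
   directions: partials [:: i; j] h = partial i (partial j h). *)
Definition partials (R : realType) (n : nat) (s : seq 'I_n)
  (h : 'rV[R]_n -> R) : 'rV[R]_n -> R := foldr (@partial R n) h s.

(* 'D_v is a total operator, so the existence of each partial derivative has to
   be required separately. *)
Definition smooth (R : realType) (n : nat) (h : 'rV[R]_n -> R) : Prop :=
  forall s : seq 'I_n,
    continuous (partials s h) /\
    forall (i : 'I_n) (x : 'rV[R]_n), derivable (partials s h) x (delta_mx 0 i).

Definition schwartz (R : realType) (n : nat) (h : 'rV[R]_n -> R) : Prop :=
  smooth h /\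
  forall (a : 'I_n -> nat) (s : seq 'I_n), exists C : R, forall x : 'rV[R]_n,
    `|(\prod_(i < n) x 0 i ^+ a i) * partials s h x| <= C.

Definition elastic1 (R : realType) (n : nat) (v : 'M[R]_n) : Prop :=
  forall i j, v i j = v j i.

Definition elastic2 (R : realType) (n : nat) (w : tensor4 R n) : Prop :=
  forall i j k l,
    [/\ w i j k l = w j i k l, w i j k l = w i j l k & w i j k l = w k l i j].

Definition smooth_vector_field (R : realType) (n : nat)
    (u : 'rV[R]_n -> 'rV[R]_n) : Prop :=
  forall i, smooth (fun x => u x 0 i).

Definition smooth_elastic1_field (R : realType) (n : nat)
    (v : 'rV[R]_n -> 'M[R]_n) : Prop :=
  (forall x, elastic1 (v x)) /\ forall i j, smooth (fun x => v x i j).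

Definition smooth_elastic2_field (R : realType) (n : nat)
    (w : 'rV[R]_n -> tensor4 R n) : Prop :=
  (forall x, elastic2 (w x)) /\ forall i j k l, smooth (fun x => w x i j k l).

Definition schwartz_elastic2_field (R : realType) (n : nat)
    (w : 'rV[R]_n -> tensor4 R n) : Prop :=
  (forall x, elastic2 (w x)) /\ forall i j k l, schwartz (fun x => w x i j k l).

Definition Hop (R : realType) (n : nat) (v : 'rV[R]_n -> 'M[R]_n) :
    'rV[R]_n -> tensor4 R n :=
  fun x i j k l =>
    2^-1 * (partial i (partial j (fun y => v y k l)) x
            + partial k (partial l (fun y => v y i j)) x).

Definition Hadj (R : realType) (n : nat) (w : 'rV[R]_n -> tensor4 R n) :
    'rV[R]_n -> 'M[R]_n :=
  fun x => \matrix_(i, j)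
    \sum_(k < n) \sum_(l < n) partial k (partial l (fun y => w y i j k l)) x.

Definition Kop (R : realType) (n : nat) (u : 'rV[R]_n -> 'rV[R]_n) :
    'rV[R]_n -> tensor4 R n :=
  fun x i j k l =>
    4^-1 * (partial i (fun y => u y 0 j) x + partial j (fun y => u y 0 i) x)
      * (k == l)%:R
    + 4^-1 * (partial l (fun y => u y 0 k) x + partial k (fun y => u y 0 l) x)
      * (i == j)%:R.

Definition Kadj (R : realType) (n : nat) (w : 'rV[R]_n -> tensor4 R n) :
    'rV[R]_n -> 'rV[R]_n :=
  fun x => \row_i
    - \sum_(j < n) \sum_(k < n) partial j (fun y => w y i j k k) x.

Definition point2 (R : realType) (z : R * R) : 'rV[R]_2 :=
  \row_(i < 2) (if i == 0 then z.1 else z.2).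

Definition integral2 (R : realType) (h : 'rV[R]_2 -> R) : \bar R :=
  (\int[(@lebesgue_measure R \x @lebesgue_measure R)%E]_z (h (point2 z))%:E)%E.

Definition elastic_decomposition (R : realType) (n : nat)
    (f g : 'rV[R]_n -> tensor4 R n) (u : 'rV[R]_n -> 'rV[R]_n)
    (v : 'rV[R]_n -> 'M[R]_n) : Prop :=
  [/\ smooth_elastic2_field g, smooth_vector_field u & smooth_elastic1_field v]
  /\ [/\ (forall x i j k l,
            f x i j k l = Hop v x i j k l + Kop u x i j k l + g x i j k l),
         (forall x, Kadj g x = 0),
         (forall x, Hadj g x = 0)
       & exists C : R, forall (x : 'rV[R]_n) (i j k : 'I_n),
           `|u x 0 i| <= C * (1 + enorm x)^-1 /\
           `|partial k (fun y => v y i j) x| <= C * (1 + enorm x)^-1].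

(* Main.v *)
Require Import Defs.
From HB Require Import structures.
From mathcomp Require Import all_boot all_order all_algebra.
From mathcomp Require Import all_classical all_reals all_analysis.
From mathcomp Require Import measurable_realfun.
From mathcomp Require Import ring lra.

Import Order.TTheory GRing.Theory Num.Theory.
Import numFieldNormedType.Exports.

Local Open Scope classical_set_scope.
Local Open Scope ring_scope.

Set Implicit Arguments.
Unset Strict Implicit.
Unset Printing Implicit Defensive.

(** Write [d] for the gradient on the plane and [e = (- d1, d0)] for the rotated
    gradient; they are orthogonal, [d . e = 0], and [d . d = e . e] is the
    Laplacian.

    Existence. Suppose that [f = lap ^ 4 F] componentwise. Put
    [A = dddd:F], [B = ddee:F], [P = ddde:F], [Q = eede:F] (full contractions)
    and
      [v_ij = d_i d_j A + 2 e_i e_j B + 2 (d_i e_j + e_i d_j) (P - Q)],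
      [u_i = 4 e_i lap Q],
      [g_ijkl = e_i e_j e_k e_l (eeee:F)
                + (d_i e_j + e_i d_j) (d_k e_l + e_k d_l) (dede:F)].
    Then [f = H v + K u + g] and [K* g = H* g = 0] are identities between
    polynomials in the commuting variables [d0] and [d1]
    ([solution_identity], [sol_g_div], [sol_g_divdiv]). Both [u] and the first
    derivatives of [v] are combinations of derivatives of order 7 of [F], so it
    is enough to find [F] with all these derivatives of size
    [O (1 / (1 + |x|))].

    Such an [F] is given by [polyharmonic_potential]. In terms of
    [dz = (d0 - i d1) / 2] and its conjugate [dzb], the derivatives of order 7
    should be the fields [dz ^ k dzb ^ (- k - 1) f] with [k <= 3] and their
    conjugates, up to powers of 4. These fields are explicit: they are the ray
    integrals of [f] from [x] over all directions [t] with weight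
    [exp (- i (2 k + 1) t)], up to a constant. Ray integrals are smooth and decay
    like [1 / (1 + |x|)] ([smooth_ray_integral], [ray_integral_decay]), and
    integrating the radial derivative of [f] along rays
    ([ray_integral_radial]) gives the compatibility relations between
    consecutive fields. The family is then integrated to [F] by repeated use of
    the Poincare lemma ([integrate_family]).

    Uniqueness. Let [u] and [v] now denote the differences of the potentials of
    two decompositions, so that [w = H v + K u] satisfies [K* w = H* w = 0]. The
    gauge-fixed fields [U = 2 u + grad (tr v)] and [V = 2 v - (tr v) delta]
    satisfy [H V + K U = 2 w], and polynomial identities ([gauge_u_elliptic],
    [gauge_v_elliptic]) give [lap ^ 3 U = 0] and [lap ^ 4 V = 0]. As [U] and the
    derivatives of [V] tend to zero at infinity, they vanish by Liouville's
    theorem for polyharmonic functions ([polyharmonic_liouville]): the circle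
    means of a polyharmonic function are polynomials in the radius. Hence
    [w = 0]. *)

(** * The mean value theorem on the plane *)

Section PlaneCalculus.
Context {R : realType}.
Implicit Types (h k : 'rV[R]_2 -> R) (x y z v : 'rV[R]_2).

Lemma sum2 (V : nmodType) (F : 'I_2 -> V) : \sum_(i < 2) F i = F 0 + F 1.
Proof.
by rewrite big_ord_recl big_ord1; congr (F _ + F _); apply/val_inj.
Qed.

Lemma ord2P (i : 'I_2) : {i = 0} + {i = 1}.
Proof.
case: i => [[|[|//]]] ?; [left|right]; exact/val_inj.
Qed.

Lemma coord_le_norm x (i : 'I_2) : `|x 0 i| <= `|x|.
Proof.
rewrite {2}/Num.norm /= mx_normrE.
by apply: (@le_bigmax _ _ _ 0 (fun ij : 'I_1 * 'I_2 => `|x ij.1 ij.2|) (0, i)).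
Qed.

Lemma norm_le_coord x (M : R) : 0 <= M -> (forall i : 'I_2, `|x 0 i| <= M) ->
  `|x| <= M.
Proof.
move=> M0 H; rewrite {1}/Num.norm /= mx_normrE; apply: bigmax_le => // -[i j] _ /=.
by rewrite ord1.
Qed.

Lemma norm_lt_coord x (M : R) : 0 < M -> (forall i : 'I_2, `|x 0 i| < M) ->
  `|x| < M.
Proof.
move=> M0 H; rewrite {1}/Num.norm /= mx_normrE; apply: bigmax_lt => // -[i j] _ /=.
by rewrite ord1.
Qed.

Lemma row2_eq x y : x 0 0 = y 0 0 -> x 0 1 = y 0 1 -> x = y.
Proof.
by move=> h0 h1; apply/rowP => i; case: (ord2P i) => ->.
Qed.

Lemma derivable_line (V : normedModType R) (h : V -> R) (x v : V) (s : R) :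
  derivable h (x + s *: v) v ->
  is_derive s 1 (fun t : R => h (x + t *: v)) ('D_v h (x + s *: v)).
Proof.
move=> dh.
have E : (fun u : R => u^-1 *: (((fun t : R => h (x + t *: v)) \o shift s) (u *: 1)
             - h (x + s *: v)))
        = (fun u => u^-1 *: ((h \o shift (x + s *: v)) (u *: v) - h (x + s *: v))).
  apply/funext => u /=; congr (_ *: (h _ - _)).
  by rewrite scalerDl addrCA [u *: 1 : R]mulr1.
split; first by rewrite /derivable /= E.
by rewrite /derive /= E.
Qed.

(** The mean value theorem along a line; only the derivative along [v] is
    assumed to exist, and [t] may be negative. *)
Lemma mvt_line (V : normedModType R) (h : V -> R) (x v : V) (t : R) :
  (forall s, derivable h (x + s *: v) v) ->
  exists2 s, `|s| <= `|t| & h (x + t *: v) - h x = t * 'D_v h (x + s *: v).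
Proof.
move=> dh.
pose g s := h (x + s *: v).
have dg (s : R) : is_derive s 1 g ('D_v h (x + s *: v)) by exact: derivable_line.
have cg : continuous g.
  by move=> s; apply/differentiable_continuous/derivable1_diffP; case: (dg s).
have g0 : g 0 = h x by rewrite /g scale0r addr0.
have [t0|t0] := leP 0 t.
  have [s + E] := @MVT_segment _ g _ 0 t t0 (fun s _ => dg s)
                     (continuous_subspaceT cg).
  rewrite in_itv /= => /andP[s0 st]; exists s.
    by rewrite !ger0_norm //.
  by rewrite -g0 -[h (x + t *: v)]/(g t) E subr0 mulrC.
have [s + E] := @MVT_segment _ g _ t 0 (ltW t0) (fun s _ => dg s)
                     (continuous_subspaceT cg).
rewrite in_itv /= => /andP[s0 st]; exists s.
  by rewrite !ler0_norm // ?lerN2 // ltW.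
by rewrite -g0 -[h (x + t *: v)]/(g t) -opprB E sub0r mulrN opprK mulrC.
Qed.

Lemma deltaE (i j : 'I_2) : (delta_mx 0 i : 'rV[R]_2) 0 j = (i == j)%:R.
Proof. by rewrite mxE eqxx eq_sym. Qed.

(** The increment of [h] along an axis-parallel path from [z] to [y]: the two
    intermediate points stay in the box spanned by [y] and [z]. *)
Lemma plane_increment h y z :
  (forall i x, derivable h x (delta_mx 0 i)) ->
  exists p q : 'rV[R]_2,
  [/\ forall i, `|p 0 i - z 0 i| <= `|y 0 i - z 0 i|,
      forall i, `|q 0 i - z 0 i| <= `|y 0 i - z 0 i| &
   h y - h z = partial 0 h p * (y 0 0 - z 0 0) + partial 1 h q * (y 0 1 - z 0 1)].
Proof.
move=> dh.
pose m := z + (y 0 1 - z 0 1) *: delta_mx 0 1.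
have ym : y = m + (y 0 0 - z 0 0) *: delta_mx 0 0.
  by apply: row2_eq; rewrite !mxE !eqxx /=; ring.
have [s hs Es] := @mvt_line _ h m (delta_mx 0 0) (y 0 0 - z 0 0) (fun s => dh 0 _).
have [t ht Et] := @mvt_line _ h z (delta_mx 0 1) (y 0 1 - z 0 1) (fun s => dh 1 _).
exists (m + s *: delta_mx 0 0), (z + t *: delta_mx 0 1); split.
- move=> i; case: (ord2P i) => ->; rewrite !mxE !eqxx /=.
    by rewrite [X in `|X| <= _](_ : _ = s) //; ring.
  by rewrite [X in `|X| <= _](_ : _ = y 0 1 - z 0 1) //; ring.
- move=> i; case: (ord2P i) => ->; rewrite !mxE !eqxx /=.
    by rewrite [X in `|X| <= _](_ : _ = 0) ?normr0 //; ring.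
  by rewrite [X in `|X| <= _](_ : _ = t) //; ring.
- rewrite -ym in Es.
  rewrite -[LHS](subrKA (h m)) Es Et /partial; ring.
Qed.

Lemma continuous_locally_bounded h (K : R) : continuous h ->
  exists C : R, forall x, `|x| <= K -> `|h x| <= C.
Proof.
move=> ch.
have cK : compact [set x : 'rV[R]_2 | `|x| <= K].
  apply: bounded_closed_compact.
    exists K; split; first exact: num_real.
    by move=> M KM x /= xK; rewrite (le_trans xK) // ltW.
  apply: (@closed_comp _ _ (fun x : 'rV[R]_2 => `|x|) [set r | r <= K]).
    by move=> x _; exact: norm_continuous.
  exact: closed_le.
have /compact_bounded[M [_ HM]] := continuous_compact (continuous_subspaceT ch) cK.
exists (M + 1) => x xK; apply: (HM (M + 1)); first by rewrite ltrDl.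
by exists x.
Qed.

(** No continuity of the partial derivatives is needed. This is what makes
    smoothness of an integral a matter of dominating all derivatives. *)
Lemma continuous_of_bounded_partials h :
  (forall i x, derivable h x (delta_mx 0 i)) ->
  (forall (K : R), exists C : R, forall i x, `|x| <= K -> `|partial i h x| <= C) ->
  continuous h.
Proof.
move=> dh bh x; apply/(@cvgrPdist_le _ _ _ (nbhs x)) => e e0.
have [C HC] := bh (`|x| + 1).
have C0 : 0 <= C.
  by apply: le_trans (HC 0 x _); rewrite ?normr_ge0 // lerDl.
pose d := Num.min 1 (e / (2 * (C + 1))).
have d0 : 0 < d by rewrite lt_min ltr01 divr_gt0 // mulr_gt0 //; lra.
have nx : \forall y \near x, `|x - y| <= d.
  apply: filterS (nbhsx_ballx x d d0) => y.
  by rewrite -ball_normE => /ltW.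
near=> y.
have xy : `|x - y| <= d by near: y.
have xyi i : `|x 0 i - y 0 i| <= d.
  by have := coord_le_norm (x - y) i; rewrite !mxE => /le_trans; apply.
have [p [q [hp hq E]]] := plane_increment y x dh.
rewrite distrC {}E.
have near_x (w : 'rV[R]_2) : (forall i, `|w 0 i - x 0 i| <= `|y 0 i - x 0 i|) -> `|w| <= `|x| + 1.
  move=> hw; rewrite -[w](subrK x) (le_trans (ler_normD _ _)) // addrC lerD2l.
  apply: norm_le_coord => // i; rewrite !mxE (le_trans (hw i)) // distrC.
  by rewrite (le_trans (xyi i)) // /d ge_min lexx.
have hC := HC 0 _ (near_x _ hp); have hC' := HC 1 _ (near_x _ hq).
rewrite (le_trans (ler_normD _ _)) // !normrM.
have dd : `|y 0 0 - x 0 0| <= d by rewrite distrC.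
have dd' : `|y 0 1 - x 0 1| <= d by rewrite distrC.
apply: (@le_trans _ _ (C * d + C * d)).
  by apply: lerD; apply: ler_pM.
have : d <= e / (2 * (C + 1)) by rewrite /d ge_min lexx orbT.
rewrite ler_pdivlMr; last by rewrite mulr_gt0 //; lra.
have := ltW d0; nra.
Unshelve. all: by end_near. Qed.

End PlaneCalculus.

(** * Smooth functions on the plane *)

Section Smooth.
Context {R : realType}.
Implicit Types (h k : 'rV[R]_2 -> R) (x y z v : 'rV[R]_2) (s : seq 'I_2).

Lemma smooth_derivable h : smooth h ->
  forall (i : 'I_2) x, derivable h x (delta_mx 0 i).
Proof. by move=> /(_ [::])[_]. Qed.
Arguments smooth_derivable {h} sh i x : rename.

Lemma partials_rcons s i h : partials (rcons s i) h = partials s (partial i h).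
Proof. by rewrite /partials foldr_rcons. Qed.

Lemma smooth_partial i h : smooth h -> smooth (partial i h).
Proof. by move=> sh s; rewrite -partials_rcons; exact: sh. Qed.

Lemma smooth_partials s h : smooth h -> smooth (partials s h).
Proof.
by move=> sh; elim: s => [|i s IH]; [exact: sh|exact: smooth_partial IH].
Qed.

(** Descent on the order of differentiation: [h] may be known to be smooth only
    through its first partial derivatives. *)
Lemma smooth_of_partial h : continuous h ->
  (forall (i : 'I_2) x, derivable h x (delta_mx 0 i)) ->
  (forall i, smooth (partial i h)) -> smooth h.
Proof.
move=> ch dh sh s; elim/last_ind: s => [|s i _]; first by split.
by rewrite partials_rcons; exact: sh.
Qed.

Lemma partial_lin (a : R) h k (i : 'I_2) :
  (forall x, derivable h x (delta_mx 0 i)) ->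
  (forall x, derivable k x (delta_mx 0 i)) ->
  partial i (fun x => a * h x + k x) = (fun x => a * partial i h x + partial i k x).
Proof.
move=> dh dk; apply/funext => x; rewrite /partial.
have -> : (fun x => a * h x + k x) = a *: h + k by [].
by rewrite deriveD ?deriveZ //; exact: derivableZ.
Qed.

Lemma partials_lin s (a : R) h k : smooth h -> smooth k ->
  partials s (fun x => a * h x + k x) =
  (fun x => a * partials s h x + partials s k x).
Proof.
move=> sh sk; elim: s => //= i s ->.
rewrite partial_lin // => x.
  exact: (smooth_derivable (smooth_partials s sh)).
exact: (smooth_derivable (smooth_partials s sk)).
Qed.

Lemma smooth_lin (a : R) h k : smooth h -> smooth k -> smooth (fun x => a * h x + k x).
Proof.
move=> sh sk s; rewrite partials_lin //; split.
  move=> x; have c1 := (sh s).1 x; have c2 := (sk s).1 x.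
  exact: cvgD (cvgMl_tmp c1) c2.
move=> i x.
have -> : (fun x => a * partials s h x + partials s k x)
   = a *: partials s h + partials s k by [].
by apply: derivableD; [apply: derivableZ; exact: (proj2 (sh s))|exact: (proj2 (sk s))].
Qed.

Lemma partial_cst (a : R) (i : 'I_2) : partial i (fun=> a) = (fun _ : 'rV[R]_2 => 0).
Proof. by apply/funext => x; rewrite /partial derive_cst. Qed.

Lemma smooth_cst (a : R) : smooth (fun _ : 'rV[R]_2 => a).
Proof.
suff H s : exists b, partials s (fun _ : 'rV[R]_2 => a) = (fun=> b).
  move=> s; have [b ->] := H s; split; first exact: cst_continuous.
  by move=> i x; exact: derivable_cst.
elim: s => [|i s [b /= ->]]; first by exists a.
by exists 0; rewrite partial_cst.
Qed.

Lemma smoothD h k : smooth h -> smooth k -> smooth (fun x => h x + k x).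
Proof.
move=> sh sk; rewrite (_ : (fun x => _) = (fun x => 1 * h x + k x)).
  exact: smooth_lin.
by apply/funext => x; rewrite mul1r.
Qed.

Lemma smoothZ (a : R) h : smooth h -> smooth (fun x => a * h x).
Proof.
move=> sh; rewrite (_ : (fun x => _) = (fun x => a * h x + (fun=> 0) x)).
  exact: smooth_lin sh (smooth_cst 0).
by apply/funext => x; rewrite addr0.
Qed.

Lemma partialD i h k : smooth h -> smooth k ->
  partial i (fun x => h x + k x) = (fun x => partial i h x + partial i k x).
Proof.
move=> sh sk; rewrite (_ : (fun x => _) = (fun x => 1 * h x + k x)).
  rewrite partial_lin; first by apply/funext => x; rewrite mul1r.
    by move=> x; apply/smooth_derivable.
  by move=> x; apply/smooth_derivable.
by apply/funext => x; rewrite mul1r.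
Qed.

Lemma partialZ i (a : R) h : smooth h ->
  partial i (fun x => a * h x) = (fun x => a * partial i h x).
Proof.
move=> sh; rewrite (_ : (fun x => _) = (fun x => a * h x + (fun=> 0) x)).
  rewrite partial_lin; last by move=> x; exact: derivable_cst.
    by apply/funext => x; rewrite partial_cst addr0.
  by move=> x; apply/smooth_derivable.
by apply/funext => x; rewrite addr0.
Qed.

Lemma partialsZ s (a : R) h : smooth h ->
  partials s (fun x => a * h x) = (fun x => a * partials s h x).
Proof.
move=> sh; elim: s => [//|i s IH].
by rewrite [LHS]/= -/(partials s _) IH (partialZ i a (smooth_partials s sh)).
Qed.

Lemma smooth_sum (I : Type) (r : seq I) (F : I -> 'rV[R]_2 -> R) :
  (forall i, smooth (F i)) -> smooth (fun x => \sum_(i <- r) F i x).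
Proof.
move=> sF; elim: r => [|i r IH].
  rewrite (_ : (fun x => _) = fun=> 0); first exact: smooth_cst.
  by apply/funext => x; rewrite big_nil.
rewrite (_ : (fun x => _) = (fun x => F i x + \sum_(j <- r) F j x)).
  exact: smoothD (sF i) IH.
by apply/funext => x; rewrite big_cons.
Qed.

Lemma partial_sum j (I : Type) (r : seq I) (F : I -> 'rV[R]_2 -> R) :
  (forall i, smooth (F i)) ->
  partial j (fun x => \sum_(i <- r) F i x) = (fun x => \sum_(i <- r) partial j (F i) x).
Proof.
move=> sF; elim: r => [|i r IH].
  rewrite (_ : (fun x => _) = fun=> 0); last by apply/funext => x; rewrite big_nil.
  by rewrite partial_cst; apply/funext => x; rewrite big_nil.
rewrite (_ : (fun x => _) = (fun x => F i x + \sum_(j <- r) F j x)).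
  rewrite partialD //; last exact: smooth_sum.
  by rewrite IH; apply/funext => x; rewrite big_cons.
by apply/funext => x; rewrite big_cons.
Qed.

Lemma smooth_of_bounded_partials h :
  (forall s (i : 'I_2) x, derivable (partials s h) x (delta_mx 0 i)) ->
  (forall s (K : R), exists C : R, forall x, `|x| <= K -> `|partials s h x| <= C) ->
  smooth h.
Proof.
move=> dh bh s; split => //; apply: continuous_of_bounded_partials => // K.
have [C0 H0] := bh (0 :: s) K; have [C1 H1] := bh (1 :: s) K.
exists (Num.max C0 C1) => i x xK; rewrite le_max.
by case: (ord2P i) => ->; [rewrite (H0 x xK)|rewrite (H1 x xK) orbT].
Qed.

Lemma smooth_locally_bounded h s (K : R) : smooth h ->
  exists C : R, forall x, `|x| <= K -> `|partials s h x| <= C.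
Proof. by move=> /(_ s)[ch _]; exact: continuous_locally_bounded. Qed.

(** The second difference of [h] on a square of side [t] is [t ^+ 2] times a
    mixed derivative at a nearby point. It is symmetric in [i] and [j], and
    comparing the two evaluations gives the symmetry of second derivatives. *)
Let second_difference h (i j : 'I_2) x (t : R) : smooth h -> i != j ->
  exists p : 'rV[R]_2, (forall l, `|p 0 l - x 0 l| <= `|t|) /\
    h (x + t *: delta_mx 0 i + t *: delta_mx 0 j) - h (x + t *: delta_mx 0 j)
      - h (x + t *: delta_mx 0 i) + h x
    = t * (t * partial j (partial i h) p).
Proof.
move=> sh ij.
pose k y := h (y + t *: delta_mx 0 j) - h y.
have dk y : is_derive y (delta_mx 0 i) k
     (partial i h (y + t *: delta_mx 0 j) - partial i h y).
  have d1 : is_derive y (delta_mx 0 i) (fun y => h (y + t *: delta_mx 0 j))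
      (partial i h (y + t *: delta_mx 0 j)).
    have E : (fun u : R => u^-1 *: (((fun y => h (y + t *: delta_mx 0 j)) \o shift y)
                 (u *: delta_mx 0 i) - h (y + t *: delta_mx 0 j)))
      = (fun u => u^-1 *: ((h \o shift (y + t *: delta_mx 0 j)) (u *: delta_mx 0 i)
                 - h (y + t *: delta_mx 0 j))).
      by apply/funext => u /=; rewrite addrA.
    split; first by rewrite /derivable /= E; apply/smooth_derivable.
    by rewrite /derive /= E.
  have d2 : is_derive y (delta_mx 0 i) h (partial i h y).
    by split=> //; apply/smooth_derivable.
  exact: is_deriveB.
have [u hu Eu] := @mvt_line _ _ k x (delta_mx 0 i) t
   (fun s0 : R => @ex_derive _ _ _ _ _ _ _ (dk _)).
have [w hw Ew] := @mvt_line _ _ (partial i h) (x + u *: delta_mx 0 i) (delta_mx 0 j) t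
   (fun s0 : R => smooth_derivable (smooth_partial i sh) _ _).
exists (x + u *: delta_mx 0 i + w *: delta_mx 0 j); split.
  move=> l; rewrite !mxE !eqxx /=.
  have [->|lj] := eqVneq l j.
    by rewrite eq_sym (negbTE ij) mulr0 mulr1 addr0 [_ + w]addrC addrK.
  rewrite mulr0 addr0 [x 0 l + _]addrC addrK normrM.
  by apply: le_trans hu; case: (_ == _); rewrite ?normr1 ?mulr1 // normr0 mulr0.
transitivity (k (x + t *: delta_mx 0 i) - k x); first by rewrite /k; ring.
by rewrite Eu (@derive_val _ _ _ _ _ _ _ (dk _)) Ew.
Qed.

Lemma partialC h i j : smooth h -> partial i (partial j h) = partial j (partial i h).
Proof.
move=> sh; have [->//|ij] := eqVneq i j.
apply/funext => x; apply/eqP; rewrite -subr_eq0 -normr_le0; apply/ler_addgt0Pl => e e0.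
have cij a b : \forall y \near x,
    `|partial a (partial b h) x - partial a (partial b h) y| <= e / 2.
  have := (sh [:: a; b]).1 x.
  by move/(@cvgrPdist_le _ _ _ (nbhs x)); apply; rewrite divr_gt0.
have [d d0 H] : exists2 d : R, 0 < d & forall y, `|x - y| < d ->
   `|partial i (partial j h) x - partial i (partial j h) y| <= e / 2 /\
   `|partial j (partial i h) x - partial j (partial i h) y| <= e / 2.
  have [d d0 H] := (nbhs_ballP x _).1 (filterI (cij i j) (cij j i)).
  by exists d => // y xy; apply: H; rewrite -ball_normE.
pose t := d / 2; have t0 : 0 < t by rewrite divr_gt0.
have near_x (p : 'rV[R]_2) : (forall l, `|p 0 l - x 0 l| <= `|t|) -> `|x - p| < d.
  move=> hp; apply: norm_lt_coord => // l.
  rewrite !mxE distrC (le_lt_trans (hp l)) // gtr0_norm // /t; lra.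
have [p [hp Ep]] := second_difference x t sh ij.
have [q [hq Eq]] : exists p : 'rV[R]_2, (forall l, `|p 0 l - x 0 l| <= `|t|) /\
    h (x + t *: delta_mx 0 j + t *: delta_mx 0 i) - h (x + t *: delta_mx 0 i)
      - h (x + t *: delta_mx 0 j) + h x
    = t * (t * partial i (partial j h) p).
  by apply: second_difference => //; rewrite eq_sym.
have Epq : partial j (partial i h) p = partial i (partial j h) q.
  apply: (mulfI (lt0r_neq0 t0)); apply: (mulfI (lt0r_neq0 t0)).
  have C : x + t *: delta_mx 0 j + t *: delta_mx 0 i
         = x + t *: delta_mx 0 i + t *: delta_mx 0 j by rewrite addrAC.
  rewrite C in Eq; apply: etrans (esym Ep) (etrans _ Eq).
  by congr (_ + _); exact: addrAC.
have [_ Hp] := H _ (near_x _ hp); have [Hq _] := H _ (near_x _ hq).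
move: Hp Hq; rewrite Epq => Hp Hq.
rewrite addr0 [e]splitr -(subrKA (partial i (partial j h) q)).
apply: le_trans (ler_normD _ _) _; apply: lerD; first exact: Hq.
by rewrite distrC; exact: Hp.
Qed.

(** The chain rule along a curve in the plane, by [plane_increment]. *)
Lemma chain_rule h (c : R -> 'rV[R]_2) (t : R) (d : 'I_2 -> R) : smooth h ->
  (forall i, is_derive t 1 (fun s0 : R => c s0 0 i) (d i)) ->
  is_derive t 1 (fun s0 : R => h (c s0))
    (d 0 * partial 0 h (c t) + d 1 * partial 1 h (c t)).
Proof.
move=> sh dc.
have dh i y : derivable h y (delta_mx 0 i) by apply/smooth_derivable.
have /choice[p Hp] : forall e : R, exists p : 'rV[R]_2, exists q : 'rV[R]_2,
  [/\ forall i, `|p 0 i - c t 0 i| <= `|c (e *: 1 + t) 0 i - c t 0 i|,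
      forall i, `|q 0 i - c t 0 i| <= `|c (e *: 1 + t) 0 i - c t 0 i| &
   h (c (e *: 1 + t)) - h (c t) = partial 0 h p * (c (e *: 1 + t) 0 0 - c t 0 0)
      + partial 1 h q * (c (e *: 1 + t) 0 1 - c t 0 1)].
  by move=> e; apply: plane_increment.
have /choice[q Hq] := Hp.
have cvgc i : (c (e *: 1 + t) 0 i : R) @[e --> 0^'] --> c t 0 i.
  have cc : {for t, continuous (fun s0 : R => c s0 0 i)}.
    by apply/differentiable_continuous/derivable1_diffP; case: (dc i).
  have : (e *: (1 : R) + t : R) @[e --> 0^'] --> (t : R).
    rewrite -[X in _ --> X]add0r; apply: cvgD; last exact: cvg_cst.
    rewrite -[X in _ --> X](scale0r (1 : R)); apply: cvgZr_tmp.
    exact: cvg_within.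
  by move=> H; exact: (@cvg_comp _ _ _ _ (fun s0 : R => c s0 0 i) _ _ _ H cc).
have cvgpq (r : R -> 'rV[R]_2) : (forall e i, `|r e 0 i - c t 0 i| <=
    `|c (e *: 1 + t) 0 i - c t 0 i|) -> r e @[e --> 0^'] --> c t.
  move=> Hr; apply/cvgrPdist_le => e e0.
  have H i : \forall u \near (0 : R)^', `|c t 0 i - c (u *: 1 + t) 0 i| <= e.
    by have /cvgrPdist_le := cvgc i; apply.
  near=> u; apply: norm_le_coord; first exact: ltW.
  move=> i; rewrite !mxE distrC (le_trans (Hr _ _)) // distrC.
  by case: (ord2P i) => ->; near: u; exact: H.
have cvgq i : ((e^-1 *: (c (e *: 1 + t) 0 i - c t 0 i) : R)) @[e --> 0^'] --> d i.
  have [/[swap] <-] := dc i; exact.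
have L : (e^-1 *: (h (c (e *: 1 + t)) - h (c t)) : R) @[e --> 0^'] -->
     d 0 * partial 0 h (c t) + d 1 * partial 1 h (c t).
  rewrite (_ : (fun e => _) = (fun e =>
     (e^-1 *: (c (e *: 1 + t) 0 0 - c t 0 0)) * partial 0 h (p e) +
     (e^-1 *: (c (e *: 1 + t) 0 1 - c t 0 1)) * partial 1 h (q e))); last first.
    apply/funext => e; have [_ _ ->] := Hq e.
    by rewrite /GRing.scale /=; ring.
  apply: cvgD; apply: cvgM => //.
    apply: (@cvg_comp _ _ _ p (partial 0 h) _ (nbhs (c t))); last exact: (sh [:: 0]).1.
    by apply: cvgpq => e i; have [H _ _] := Hq e.
  apply: (@cvg_comp _ _ _ q (partial 1 h) _ (nbhs (c t))); last exact: (sh [:: 1]).1.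
  by apply: cvgpq => e i; have [_ H _] := Hq e.
split; first by apply/cvg_ex; exists (d 0 * partial 0 h (c t) + d 1 * partial 1 h (c t)).
exact/cvg_lim.
Unshelve. all: by end_near. Qed.

End Smooth.
Arguments smooth_derivable {R h} sh i x : rename.

(** * Integrals depending on a parameter *)

Section ParametricIntegrals.
Context {R : realType}.
Notation mu := (@lebesgue_measure R).
Notation RM := (measurableTypeR R).
Implicit Types (x : 'rV[R]_2) (s : seq 'I_2) (D : set RM).

(** Differentiation under the integral sign for real-valued integrals, the
    derivative being dominated for parameters at distance at most 1. *)
Lemma is_derive_integral D (f g : R -> R -> R) (G : R -> R) (a : R) :
  measurable D ->
  (forall u, mu.-integrable D (EFin \o f u)) ->
  (forall u t : R, D t -> is_derive u 1 (f ^~ t) (g u t)) ->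
  mu.-integrable D (EFin \o G) ->
  (forall u t : R, `|u - a| <= 1 -> D t -> `|g u t| <= G t) ->
  is_derive a 1 (fun u => \int[mu]_(t in D) f u t) (\int[mu]_(t in D) g a t).
Proof.
move=> mD intf df intG gG.
have Ia : a \in `]a - 1, a + 1[ by rewrite in_itv /=; lra.
have inI u : `]a - 1, a + 1[%classic u -> `|u - a| <= 1.
  by rewrite /= in_itv /= ler_norml => /andP[? ?]; lra.
have d1 u t : D t -> partial1of2 f u t = g u t.
  by move=> Dt; rewrite partial1of2E; have [_ ->] := df u t Dt.
have intG' : mu.-integrable D (EFin \o (fun t => `|G t|)).
  by have := integrable_norm intG.
have G_ub u t : `]a - 1, a + 1[%classic u -> D t -> `|partial1of2 f u t| <= `|G t|.
  move=> /inI ua Dt; rewrite d1 //; apply: le_trans (gG u t ua Dt) _.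
  exact: ler_norm.
have df1 u t : `]a - 1, a + 1[%classic u -> D t -> derivable (f ^~ t) u 1.
  by move=> _ Dt; case: (df u t Dt).
have intf' u : `]a - 1, a + 1[%classic u -> mu.-integrable D (EFin \o f u) by [].
split.
  exact: (@derivable_under_integral R _ _ mu f D mD a (a - 1) (a + 1) Ia intf' df1 _
    (fun t => normr_ge0 (G t)) intG' G_ub).
rewrite -derive1E.
rewrite (@differentiation_under_integral R _ _ mu f D mD a (a - 1) (a + 1) Ia intf' df1 _
    (fun t => normr_ge0 (G t)) intG' G_ub).
by apply: eq_Rintegral => t; rewrite inE => Dt; exact: d1.
Qed.

Lemma is_derive_line (V : normedModType R) (h : V -> R) (x v : V) (l : R) :
  is_derive (0 : R) 1 (fun t : R => h (x + t *: v)) l -> is_derive x v h l.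
Proof.
move=> [dh lh].
have E : (fun u : R => u^-1 *: (((fun t : R => h (x + t *: v)) \o shift 0) (u *: 1)
             - h (x + 0 *: v)))
        = (fun u => u^-1 *: ((h \o shift x) (u *: v) - h x)).
  apply/funext => u /=; congr (_ *: (h _ - h _)).
    by rewrite addr0 addrC [u *: 1 : R]mulr1.
  by rewrite scale0r addr0.
split; first by move: dh; rewrite /derivable /= E.
by move: lh; rewrite /derive /= E.
Qed.

Lemma integrable_dominated D (f G : R -> R) : measurable D ->
  measurable_fun D (f : RM -> R) -> mu.-integrable D (EFin \o G) ->
  (forall t, D t -> `|f t| <= G t) -> mu.-integrable D (EFin \o f).
Proof.
move=> mD mf iG fG; apply: le_integrable iG => //.
  exact/measurable_EFinP.
move=> t Dt; rewrite /= lee_fin; apply: le_trans (fG t Dt) _.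
exact: ler_norm.
Qed.

Lemma Rintegral_norm_le D (f G : R -> R) : measurable D ->
  measurable_fun D (f : RM -> R) -> mu.-integrable D (EFin \o G) ->
  (forall t, D t -> `|f t| <= G t) ->
  `|\int[mu]_(t in D) f t| <= \int[mu]_(t in D) G t.
Proof.
move=> mD mf iG fG.
have if_ := integrable_dominated mD mf iG fG.
apply: le_trans (le_normr_Rintegral mD if_) _.
apply: le_Rintegral => //.
by have := integrable_norm if_.
Qed.

(** If every partial derivative in the parameter [x] is measurable in [t] and
    dominated, locally uniformly in [x], by an integrable function of [t], then
    the integral is smooth in [x] and differentiates under the integral sign. *)
Section SmoothIntegral.
Variables (D : set RM) (Phi : 'rV[R]_2 -> R -> R).
Hypothesis mD : measurable D.
Hypothesis sPhi : forall t, D t -> smooth (Phi ^~ t).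
Hypothesis mPhi : forall s x, measurable_fun D (fun t : RM => partials s (Phi ^~ t) x).
Hypothesis bPhi : forall s (K : R), exists2 G : R -> R,
  mu.-integrable D (EFin \o G) &
  forall x t, `|x| <= K -> D t -> `|partials s (Phi ^~ t) x| <= G t.

Let I s x := \int[mu]_(t in D) partials s (Phi ^~ t) x.

Let int_partials s x : mu.-integrable D (EFin \o (fun t => partials s (Phi ^~ t) x)).
Proof.
have [G iG HG] := bPhi s `|x|.
by apply: (integrable_dominated mD _ iG) => // t Dt; exact: HG.
Qed.

Let is_derive_I s (i : 'I_2) x : is_derive x (delta_mx 0 i) (I s) (I (i :: s) x).
Proof.
apply: is_derive_line.
have [G iG HG] := bPhi (i :: s) (`|x| + 1).
pose g (u t : R) := partials (i :: s) (Phi ^~ t) (x + u *: delta_mx 0 i).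
rewrite [I (i :: s) x](_ : _ = \int[mu]_(t in D) g 0 t); last first.
  by rewrite /g scale0r addr0.
apply: (is_derive_integral (g := g) (G := G)) => //.
- move=> u t Dt; apply: derivable_line.
  exact: (proj2 (sPhi Dt s)).
- move=> u t; rewrite subr0 => u1 Dt; apply: HG => //.
  apply: le_trans (ler_normD _ _) _; rewrite lerD2l normrZ.
  rewrite -[leRHS]mulr1; apply: ler_pM => //.
  apply: norm_le_coord => // j; rewrite deltaE.
  by case: eqP => _; rewrite ?normr1 ?normr0.
Qed.

Let partialsI s : partials s (I [::]) = I s.
Proof.
elim: s => [//|i s IH]; rewrite [LHS]/= -/(partials s (I [::])) IH.
by apply/funext => x; exact: (@derive_val _ _ _ _ _ _ _ (is_derive_I s i x)).
Qed.

Lemma partials_integral s x :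
  partials s (fun y => \int[mu]_(t in D) Phi y t) x =
  \int[mu]_(t in D) partials s (Phi ^~ t) x.
Proof. by rewrite -[RHS]/(I s x) -partialsI. Qed.

Lemma smooth_integral : smooth (fun y => \int[mu]_(t in D) Phi y t).
Proof.
apply: smooth_of_bounded_partials => s; rewrite -/(I [::]) partialsI.
  by move=> i x; exact: (@ex_derive _ _ _ _ _ _ _ (is_derive_I s i x)).
move=> K; have [G iG HG] := bPhi s K.
exists (\int[mu]_(t in D) G t) => x xK.
by apply: Rintegral_norm_le => // t Dt; exact: HG.
Qed.

End SmoothIntegral.

Lemma segment_integrable a b (f : R -> R) : continuous f ->
  mu.-integrable `[a, b] (EFin \o f).
Proof.
move=> cf; apply: continuous_compact_integrable; first exact: segment_compact.
exact: continuous_subspaceT.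
Qed.

Lemma is_derive_continuous (f g : R -> R) :
  (forall t : R, is_derive t 1 f (g t)) -> continuous f.
Proof.
move=> df t; apply/differentiable_continuous/derivable1_diffP.
by case: (df t).
Qed.

Lemma fundamental_theorem a b (f F : R -> R) : a < b -> continuous f ->
  (forall t : R, is_derive t 1 F (f t)) ->
  \int[mu]_(t in `[a, b]) f t = F b - F a.
Proof.
move=> ab cf dF; rewrite /Rintegral.
have cF := is_derive_continuous dF.
rewrite (@continuous_FTC2 _ f F) //.
- exact: continuous_subspaceT.
- split; first by move=> t _; case: (dF t).
    by apply: cvg_at_right_filter; exact: cF.
  by apply: cvg_at_left_filter; exact: cF.
- by move=> t _; rewrite derive1E; have [_ ->] := dF t.
Qed.

Lemma segment_integral_lin a b (c : R) (f g : R -> R) :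
  continuous f -> continuous g ->
  \int[mu]_(t in `[a, b]) (c * f t + g t) =
  c * \int[mu]_(t in `[a, b]) f t + \int[mu]_(t in `[a, b]) g t.
Proof.
move=> cf cg; rewrite RintegralD ?RintegralZl //; try exact: segment_integrable.
by apply: segment_integrable => t; apply: cvgMl_tmp; exact: cf.
Qed.

Lemma segment_length a b : a <= b -> fine (mu `[a, b]) = b - a.
Proof.
move=> ab; rewrite lebesgue_measure_itv /= lte_fin.
by case: ltgtP ab => // -> _; rewrite subrr.
Qed.

Lemma segment_integral_cst a b (c : R) : a <= b ->
  \int[mu]_(t in `[a, b]) c = c * (b - a).
Proof.
by move=> ab; rewrite Rintegral_cst // [fine _]segment_length.
Qed.

End ParametricIntegrals.

(** * Weighted means over circles *)

Section CircleMeans.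
Context {R : realType}.
Notation mu := (@lebesgue_measure R).
Notation RM := (measurableTypeR R).
Notation twopi := (2 * (pi : R)).
Implicit Types (x : 'rV[R]_2) (h k : 'rV[R]_2 -> R) (p q : R -> R) (r : R).

Lemma twopi_gt0 : 0 < twopi.
Proof. by rewrite mulr_gt0 // pi_gt0. Qed.

Lemma cos_twopi : cos twopi = 1.
Proof. by rewrite mulr_natl cos2pi. Qed.

Lemma sin_twopi : sin twopi = 0.
Proof. by rewrite mulr_natl sin2pi. Qed.

(** The unit vector of polar angle [t]. *)
Definition dir (t : R) : 'rV[R]_2 := point2 (cos t, sin t).

Lemma dir0 t : dir t 0 0 = cos t. Proof. by rewrite mxE. Qed.
Lemma dir1 t : dir t 0 1 = sin t. Proof. by rewrite mxE. Qed.

Lemma norm_dir t : `|dir t| <= 1.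
Proof.
apply: norm_le_coord => // i.
by case: (ord2P i) => ->; rewrite ?dir0 ?dir1 ?cos_max ?sin_max.
Qed.

Lemma norm_polar x r t : `|x + r *: dir t| <= `|x| + `|r|.
Proof.
apply: le_trans (ler_normD _ _) _; rewrite lerD2l normrZ.
rewrite -[leRHS]mulr1; apply: ler_pM; rewrite ?normr_ge0 //; exact: norm_dir.
Qed.

(** Angular weights: continuous functions of the angle bounded by 1. They need
    not be periodic. *)
Definition angular p := continuous p /\ forall t, `|p t| <= 1.

Lemma angular1 : angular (fun=> 1).
Proof. by split=> [|t]; [exact: cst_continuous|rewrite normr1]. Qed.

Lemma angular_cos : angular cos.
Proof. by split; [exact: continuous_cos|exact: cos_max]. Qed.

Lemma angular_sin : angular sin.
Proof. by split; [exact: continuous_sin|exact: sin_max]. Qed.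

Lemma angularM p q : angular p -> angular q -> angular (fun t => p t * q t).
Proof.
move=> [cp bp] [cq bq]; split=> t.
  exact: cvgM (cp t) (cq t).
by rewrite normrM -[leRHS]mulr1; apply: ler_pM; rewrite ?normr_ge0.
Qed.

Lemma is_derive_circle h x r (t : R) : smooth h ->
  is_derive t 1 (fun t : R => h (x + r *: dir t))
    (r * (cos t * partial 1 h (x + r *: dir t) - sin t * partial 0 h (x + r *: dir t))).
Proof.
move=> sh.
have := @chain_rule R h (fun t => x + r *: dir t) t
  (fun i : 'I_2 => if i == 0 then r * - sin t else r * cos t) sh.
move=> H; apply: is_derive_eq; first apply: H.
  move=> i; case: (ord2P i) => -> /=.
    rewrite (_ : (fun s => _) = (fun s => x 0 0 + r * cos s)).
      by apply: is_derive_eq; rewrite /GRing.scale /=; ring.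
    by apply/funext => s; rewrite !mxE.
  rewrite (_ : (fun s => _) = (fun s => x 0 1 + r * sin s)).
    by apply: is_derive_eq; rewrite /GRing.scale /=; ring.
  by apply/funext => s; rewrite !mxE.
by rewrite /=; set d0 := partial 0 _ _; set d1 := partial 1 _ _; ring.
Qed.

Lemma is_derive_radius h x r (t : R) : smooth h ->
  is_derive r 1 (fun r : R => h (x + r *: dir t))
    (cos t * partial 0 h (x + r *: dir t) + sin t * partial 1 h (x + r *: dir t)).
Proof.
move=> sh.
have := @chain_rule R h (fun r => x + r *: dir t) r
  (fun i : 'I_2 => if i == 0 then cos t else sin t) sh.
apply => i; case: (ord2P i) => -> /=.
  rewrite (_ : (fun s => _) = (fun s => x 0 0 + s * cos t)).
    by apply: is_derive_eq; rewrite /GRing.scale /=; ring.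
  by apply/funext => s; rewrite !mxE.
rewrite (_ : (fun s => _) = (fun s => x 0 1 + s * sin t)).
  by apply: is_derive_eq; rewrite /GRing.scale /=; ring.
by apply/funext => s; rewrite !mxE.
Qed.

Lemma continuous_circle p h x r : continuous p -> smooth h ->
  continuous (fun t => p t * h (x + r *: dir t)).
Proof.
move=> cp sh t; apply: (cvgM (cp t)).
exact: (is_derive_continuous (fun t => is_derive_circle x r t sh)).
Qed.

Arguments continuous_circle {p h} x r cp sh : rename.

(** The integral of [h] over the circle of centre [x] and radius [r] against
    the weight [p], in the angle variable. It is not divided by [2 * pi], and
    [r] may be any real number. *)
Definition circle_mean p h x (r : R) : R :=
  \int[mu]_(t in `[0, twopi]) (p t * h (x + r *: dir t)).

Lemma circle_mean_linr p (a : R) h k x r : continuous p -> smooth h -> smooth k ->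
  circle_mean p (fun y => a * h y + k y) x r =
  a * circle_mean p h x r + circle_mean p k x r.
Proof.
move=> ap sh sk; rewrite /circle_mean -segment_integral_lin.
- by apply: eq_Rintegral => t _; ring.
- exact: continuous_circle.
- exact: continuous_circle.
Qed.

Lemma circle_mean_linl p q (a : R) h x r : continuous p -> continuous q -> smooth h ->
  circle_mean (fun t => a * p t + q t) h x r =
  a * circle_mean p h x r + circle_mean q h x r.
Proof.
move=> ap aq sh; rewrite /circle_mean -segment_integral_lin.
- by apply: eq_Rintegral => t _; ring.
- exact: continuous_circle.
- exact: continuous_circle.
Qed.

Lemma circle_meanZl p (a : R) h x r : continuous p -> smooth h ->
  circle_mean (fun t => a * p t) h x r = a * circle_mean p h x r.
Proof.
move=> cp sh; rewrite /circle_mean -RintegralZl //.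
  by apply: eq_Rintegral => t _; rewrite mulrA.
exact/segment_integrable/continuous_circle.
Qed.

Lemma eq_circle_meanl p q h x r : p =1 q -> circle_mean p h x r = circle_mean q h x r.
Proof. by move=> /funext ->. Qed.

Lemma circle_mean0 p h x : continuous p ->
  circle_mean p h x 0 = h x * \int[mu]_(t in `[0, twopi]) p t.
Proof.
move=> cp; rewrite -RintegralZl //; last exact: segment_integrable.
by apply: eq_Rintegral => t _; rewrite scale0r addr0 mulrC.
Qed.

Lemma partials_shift (s : seq 'I_2) (a : R) h (w : 'rV[R]_2) : smooth h ->
  partials s (fun y => a * h (y + w)) = (fun y => a * partials s h (y + w)).
Proof.
move=> sh.
have D (k : 'rV[R]_2 -> R) (i : 'I_2) y : smooth k ->
    is_derive y (delta_mx 0 i) (fun y => k (y + w)) (partial i k (y + w)).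
  move=> sk.
  have E : (fun u : R => u^-1 *: (((fun y => k (y + w)) \o shift y)
                 (u *: delta_mx 0 i) - k (y + w)))
      = (fun u => u^-1 *: ((k \o shift (y + w)) (u *: delta_mx 0 i)
                 - k (y + w))).
    by apply/funext => u /=; rewrite addrA.
  split; first by rewrite /derivable /= E; exact: (smooth_derivable sk).
  by rewrite /derive /= E.
elim: s => [//|i s IH]; rewrite /= -/(partials s _) IH.
apply/funext => y; rewrite {1}/partial.
have Di := D _ i y (smooth_partials s sh).
exact: (@derive_val _ _ _ _ _ _ _ (is_deriveZ a Di)).
Qed.

Lemma smooth_shift (a : R) h (w : 'rV[R]_2) : smooth h ->
  smooth (fun y => a * h (y + w)).
Proof.
move=> sh; apply: smoothZ; apply: smooth_of_bounded_partials => [s i y|s K].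
  have D : (fun y => h (y + w)) = (fun y => 1 * h (y + w)).
    by apply/funext => z; rewrite mul1r.
  rewrite D partials_shift //.
  apply/derivable1P.
  have /derivable1P := smooth_derivable (smooth_partials s sh) i (y + w).
  rewrite (_ : (fun u : R => partials s h (u *: delta_mx 0 i + (y + w))) =
    (fun u : R => 1 * partials s h (u *: delta_mx 0 i + y + w))) //.
  by apply/funext => u; rewrite mul1r addrA.
have [C HC] := smooth_locally_bounded s (K + `|w|) sh.
exists C => y yK.
have -> : (fun y => h (y + w)) = (fun y => 1 * h (y + w)).
  by apply/funext => z; rewrite mul1r.
rewrite partials_shift // mul1r; apply: HC.
by apply: le_trans (ler_normD _ _) _; rewrite lerD2r.
Qed.

Let mean_family p h r s : angular p -> smooth h ->
  (forall x, measurable_fun (`[0, twopi] : set RM)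
     (fun t : RM => partials s (fun y => p t * h (y + r *: dir t)) x)) /\
  (forall K : R, exists2 G : R -> R, mu.-integrable `[0, twopi] (EFin \o G) &
    forall x t, `|x| <= K -> `[0, twopi]%classic t ->
     `|partials s (fun y => p t * h (y + r *: dir t)) x| <= G t).
Proof.
move=> ap sh; split=> [x|K].
  rewrite (_ : (fun t : RM => _) = (fun t : RM => p t * partials s h (x + r *: dir t))).
    apply: measurable_funTS; apply: continuous_measurable_fun.
    exact: continuous_circle ap.1 (smooth_partials s sh).
  by apply/funext => t; rewrite partials_shift.
have [C HC] := smooth_locally_bounded s (K + `|r|) sh.
exists (fun=> C); first by apply: segment_integrable; exact: cst_continuous.
move=> x t xK _; rewrite partials_shift // normrM -[leRHS]mul1r.
apply: ler_pM; rewrite ?normr_ge0 //; first exact: ap.2.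
by apply: HC; apply: le_trans (norm_polar _ _ _) _; rewrite lerD2r.
Qed.

Lemma smooth_circle_mean p h r : angular p -> smooth h ->
  smooth (fun x => circle_mean p h x r).
Proof.
move=> ap sh; apply: smooth_integral.
- exact: measurable_itv.
- by move=> t _; exact: smooth_shift.
- by move=> s x; have [H _] := mean_family r s ap sh; exact: H.
- by move=> s K; have [_ H] := mean_family r s ap sh; exact: H.
Qed.

Lemma partials_circle_mean p h r s x : angular p -> smooth h ->
  partials s (fun x => circle_mean p h x r) x = circle_mean p (partials s h) x r.
Proof.
move=> ap sh; rewrite partials_integral.
- by apply: eq_Rintegral => t _; rewrite partials_shift.
- exact: measurable_itv.
- by move=> t _; exact: smooth_shift.
- by move=> s' y; have [H _] := mean_family r s' ap sh; exact: H.
- by move=> s' K; have [_ H] := mean_family r s' ap sh; exact: H.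
Qed.

(** The derivative in the radius is the mean of the radial derivative of
    [h]. *)
Lemma is_derive_circle_mean p h x r : angular p -> smooth h ->
  is_derive r 1 (circle_mean p h x)
    (circle_mean (fun t => p t * cos t) (partial 0 h) x r +
     circle_mean (fun t => p t * sin t) (partial 1 h) x r).
Proof.
move=> ap sh.
have s0 := smooth_partial 0 sh; have s1 := smooth_partial 1 sh.
have ac := angularM ap angular_cos; have as_ := angularM ap angular_sin.
have [C0 H0] := smooth_locally_bounded [:: 0] (`|x| + (`|r| + 1)) sh.
have [C1 H1] := smooth_locally_bounded [:: 1] (`|x| + (`|r| + 1)) sh.
pose g (r t : R) := p t * cos t * partial 0 h (x + r *: dir t) +
                    p t * sin t * partial 1 h (x + r *: dir t).
apply: is_derive_eq.
  apply: (@is_derive_integral _ _ _ g (fun=> C0 + C1)) => //.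
  - by move=> u; apply: segment_integrable; exact: (continuous_circle _ _ ap.1).
  - move=> u t _; rewrite /g; apply: is_derive_eq.
      by apply: is_deriveZ; exact: is_derive_radius.
    rewrite /GRing.scale /=.
    by set d0 := partial 0 _ _; set d1 := partial 1 _ _; ring.
  - by apply: segment_integrable; exact: cst_continuous.
  - move=> u t ur _; rewrite /g; apply: le_trans (ler_normD _ _) _.
    have ub : `|x + u *: dir t| <= `|x| + (`|r| + 1).
      apply: le_trans (norm_polar _ _ _) _; rewrite lerD2l addrC -lerBlDr.
      by apply: le_trans ur; exact: lerB_dist.
    apply: lerD; rewrite normrM -[leRHS]mul1r.
      by apply: ler_pM; rewrite ?normr_ge0 //; [exact: ac.2|exact: H0].
    by apply: ler_pM; rewrite ?normr_ge0 //; [exact: as_.2|exact: H1].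
rewrite /g RintegralD //; apply: segment_integrable.
  exact: continuous_circle ac.1 s0.
exact: continuous_circle as_.1 s1.
Qed.

(** Integration by parts along the circle: the angular derivative of [h] is [r]
    times its tangential derivative, and [p] takes equal values at the two
    ends. *)
Lemma circle_mean_parts p q h x r : continuous q ->
  (forall t : R, is_derive t 1 p (q t)) -> p twopi = p 0 -> smooth h ->
  circle_mean q h x r =
  r * (circle_mean (fun t => p t * sin t) (partial 0 h) x r
       - circle_mean (fun t => p t * cos t) (partial 1 h) x r).
Proof.
move=> cq dp pp sh.
have s0 := smooth_partial 0 sh; have s1 := smooth_partial 1 sh.
have cp := is_derive_continuous dp.
have cc : continuous (fun t => p t * cos t).
  by move=> t; apply: cvgM (cp t) _; exact: continuous_cos.
have cs : continuous (fun t => p t * sin t).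
  by move=> t; apply: cvgM (cp t) _; exact: continuous_sin.
pose A t := q t * h (x + r *: dir t).
pose B t := p t * cos t * partial 1 h (x + r *: dir t).
pose C t := p t * sin t * partial 0 h (x + r *: dir t).
have cA : continuous A by exact: continuous_circle cq sh.
have cB : continuous B by exact: continuous_circle cc s1.
have cC : continuous C by exact: continuous_circle cs s0.
have cBC : continuous (fun t => r * (B t - C t)).
  by move=> t; apply: cvgMl_tmp; apply: cvgB; [exact: cB|exact: cC].
have F : \int[mu]_(t in `[0, twopi]) (A t + r * (B t - C t)) = 0.
  have cABC : continuous (fun t => A t + r * (B t - C t)).
    by move=> t; apply: cvgD; [exact: cA|exact: cBC].
  have dF (t : R) : is_derive t 1 (fun t : R => p t * h (x + r *: dir t))
      (A t + r * (B t - C t)).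
    have dc := is_derive_circle x r t sh; have dpt := dp t.
    apply: is_derive_eq.
    rewrite /A /B /C /GRing.scale /=.
    set u := h _; set u0 := partial 0 _ _; set u1 := partial 1 _ _; ring.
  rewrite (fundamental_theorem twopi_gt0 cABC dF).
  have -> : dir twopi = dir 0.
    by rewrite /dir cos_twopi sin_twopi cos0 sin0.
  by rewrite pp subrr.
rewrite RintegralD // in F; try exact: segment_integrable.
rewrite RintegralZl // in F; last first.
  by apply: segment_integrable => t; apply: cvgB; [exact: cB|exact: cC].
rewrite RintegralB // in F; try exact: segment_integrable.
move/eqP: F; rewrite addr_eq0 => /eqP F.
rewrite -[LHS]/(\int[mu]_(t in `[0, twopi]) A t) F /circle_mean.
by rewrite -mulrN opprB.
Qed.

End CircleMeans.
Arguments continuous_circle {R p h} x r cp sh : rename.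

(** * A Liouville theorem for polyharmonic functions *)

Section Liouville.
Context {R : realType}.
Notation twopi := (2 * (pi : R)).
Implicit Types (x : 'rV[R]_2) (h k : 'rV[R]_2 -> R) (r : R).

(** The Laplacian on the plane. *)
Definition laplacian h : 'rV[R]_2 -> R :=
  fun x => partial 0 (partial 0 h) x + partial 1 (partial 1 h) x.

Lemma smooth_laplacian h : smooth h -> smooth (laplacian h).
Proof.
move=> sh; apply: smoothD.
  exact: (smooth_partial 0 (smooth_partial 0 sh)).
exact: (smooth_partial 1 (smooth_partial 1 sh)).
Qed.

Notation mean h := (circle_mean (fun=> 1) h).

Lemma is_derive_mean h x r : smooth h ->
  is_derive r 1 (mean h x)
   (circle_mean cos (partial 0 h) x r + circle_mean sin (partial 1 h) x r).
Proof.
move=> sh; apply: is_derive_eq; first exact: is_derive_circle_mean angular1 sh.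
by congr (_ + _); apply: eq_circle_meanl => t; rewrite mul1r.
Qed.

(** [(r * M')' = r * M_lap], where [M] is the circle mean of [h], [M'] its
    radial derivative and [M_lap] the circle mean of the Laplacian: in polar
    coordinates the angular part of the Laplacian has mean zero. *)
Lemma mean_laplacian h x r : smooth h ->
  is_derive r 1 (fun r : R => r * (circle_mean cos (partial 0 h) x r
                            + circle_mean sin (partial 1 h) x r))
    (r * mean (laplacian h) x r).
Proof.
move=> sh.
have s0 := smooth_partial 0 sh; have s1 := smooth_partial 1 sh.
have s00 := smooth_partial 0 s0; have s01 := smooth_partial 0 s1.
have s11 := smooth_partial 1 s1.
have ac := @angular_cos R; have as_ := @angular_sin R.
have acc := angularM ac ac; have ass := angularM as_ as_.
have D0 := is_derive_circle_mean x r ac s0.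
have D1 := is_derive_circle_mean x r as_ s1.
have cNs : continuous (fun t : R => - sin t).
  by move=> t; apply: cvgN; exact: continuous_sin.
have P0 := circle_mean_parts x r ac.1 (fun t : R => is_derive_sin t) _ s0.
have P1 := circle_mean_parts x r cNs (fun t : R => is_derive_cos t) _ s1.
move: P0 P1; rewrite sin_twopi sin0 cos_twopi cos0 => /(_ erefl) P0 /(_ erefl) P1.
have N1 : circle_mean (fun t => - sin t) (partial 1 h) x r
        = - circle_mean sin (partial 1 h) x r.
  rewrite -mulN1r -circle_meanZl //; last exact: as_.1.
  by apply: eq_circle_meanl => t; rewrite mulN1r.
have one_cs (k : 'rV[R]_2 -> R) : smooth k -> mean k x r =
    circle_mean (fun t => cos t * cos t) k x r + circle_mean (fun t => sin t * sin t) k x r.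
  move=> sk; rewrite -[X in X + _]mul1r -circle_mean_linl //; [|exact: acc.1|exact: ass.1].
  by apply: eq_circle_meanl => t; rewrite mul1r -!expr2 cos2Dsin2.
have ML : mean (laplacian h) x r =
    mean (partial 0 (partial 0 h)) x r + mean (partial 1 (partial 1 h)) x r.
  have -> : laplacian h =
      (fun y => 1 * partial 0 (partial 0 h) y + partial 1 (partial 1 h) y).
    by apply/funext => y; rewrite mul1r.
  by rewrite circle_mean_linr ?mul1r //; exact: (@angular1 R).1.
have D := is_deriveM (is_derive_id r 1) (is_deriveD D0 D1).
have E10 : partial 1 (partial 0 h) = partial 0 (partial 1 h) by exact: partialC.
have EA := congr1 (fun k => circle_mean (fun t => cos t * sin t) k x r) E10.
have EB := congr1 (fun k => circle_mean (fun t => sin t * cos t) k x r) E10.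
have M := etrans ML (congr2 +%R (one_cs _ s00) (one_cs _ s11)).
have alg (c0 si n1 cc0 ss0 cc1 ss1 a b c d m : R) : c0 = r * (ss0 - b) ->
   n1 = r * (c - cc1) -> n1 = - si -> a = c -> b = d ->
   m = cc0 + ss0 + (cc1 + ss1) ->
   r *: ((cc0 + a) + (d + ss1)) + (c0 + si) *: (1 : R) = r * m.
  move=> -> e1 e2 -> -> ->; have -> : si = - (r * (c - cc1)) by rewrite -e1 e2 opprK.
  by rewrite /GRing.scale /=; ring.
exact: (is_derive_eq D (alg _ _ _ _ _ _ _ _ _ _ _ _ P0 P1 N1 EA EB M)).
Qed.

(** The equation [(r * M')' = r * q] with a polynomial [q] is solved by
    [M' = r * S] with a polynomial [S]. *)
Lemma radial_primitive (q : {poly R}) : exists S : {poly R},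
  ('X * ('X * S))^`() = 'X * q.
Proof.
exists (\poly_(i < size q) (q`_i / (i.+2)%:R)).
apply/polyP => i; rewrite coef_deriv !coefXM /=.
case: i => [|i] /=; first by rewrite mul0rn.
rewrite coef_poly; case: ltnP => qi; last by rewrite mul0rn nth_default.
by rewrite -[LHS]mulr_natr divfK // pnatr_eq0.
Qed.

Lemma is_derive_horner (q : {poly R}) r : is_derive r 1 (horner q) (q^`().[r]).
Proof.
split; first exact: derivable_horner.
by rewrite -derive1E -derivE.
Qed.

Lemma derive_eq_cst (f g F : R -> R) : (forall t : R, is_derive t 1 f (F t)) ->
  (forall t : R, is_derive t 1 g (F t)) -> forall t, f t = g t + (f 0 - g 0).
Proof.
move=> df dg t.
have D (s : R) : is_derive s 1 (fun s => f s - g s) 0.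
  have dfs := df s; have dgs := dg s.
  by apply: is_derive_eq; rewrite subrr.
by rewrite -(is_derive_0_is_cst t 0 D) addrC subrK.
Qed.

(** The circle means of a polyharmonic function are polynomial in the radius,
    by induction on the order with [mean_laplacian] and [radial_primitive]. *)
Lemma mean_polyharmonic m h x : smooth h ->
  (forall y, iter m laplacian h y = 0) ->
  exists q : {poly R}, forall r, mean h x r = q.[r].
Proof.
elim: m h => [|m IH] h sh hh.
  exists 0 => r; rewrite horner0 /circle_mean.
  rewrite (@eq_Rintegral _ _ _ _ _ (fun=> 0)).
    by rewrite segment_integral_cst ?mul0r // ltW // twopi_gt0.
  by move=> t _; rewrite mul1r; exact: hh.
have [|q1 Hq1] := IH (laplacian h) (smooth_laplacian sh).
  by move=> y; rewrite -iterSr.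
have [S HS] := radial_primitive q1.
have [T HT] := radial_primitive S.
have rM' r : r * (circle_mean cos (partial 0 h) x r + circle_mean sin (partial 1 h) x r)
     = ('X * ('X * S)).[r].
  have dg (t : R) : is_derive t 1 (horner ('X * ('X * S))) (t * mean (laplacian h) x t).
    rewrite Hq1; have := is_derive_horner ('X * ('X * S)) t.
    by rewrite HS hornerM hornerX.
  rewrite (derive_eq_cst (fun t => mean_laplacian x t sh) dg r).
  by rewrite mul0r [X in _ - X]hornerM hornerX mul0r subrr addr0.
have M' r : circle_mean cos (partial 0 h) x r + circle_mean sin (partial 1 h) x r
     = ('X * S).[r].
  have [->|r0] := eqVneq r 0; last first.
    apply: (mulfI r0); rewrite rM'.
    by rewrite [LHS]hornerM hornerX.
  rewrite hornerM hornerX mul0r !circle_mean0; [|exact: continuous_sin|exact: continuous_cos].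
  rewrite (fundamental_theorem twopi_gt0 (@continuous_cos R) (fun t : R => is_derive_sin t)).
  have dNc (t : R) : is_derive t 1 (fun t : R => - cos t) (sin t).
    by apply: is_derive_eq; rewrite opprK.
  rewrite (fundamental_theorem twopi_gt0 (@continuous_sin R) dNc).
  by rewrite sin_twopi sin0 cos_twopi cos0; ring.
exists ('X * ('X * T) + (mean h x 0 - 0)%:P) => r.
have df (t : R) : is_derive t 1 (mean h x) ('X * S).[t].
  exact: is_derive_eq (is_derive_mean x t sh) (M' t).
have dg (t : R) : is_derive t 1 (horner ('X * ('X * T))) ('X * S).[t].
  by rewrite -HT; exact: is_derive_horner.
rewrite (derive_eq_cst df dg r) hornerD hornerC; congr (_ + (_ - _)).
by rewrite [LHS]hornerM hornerX mul0r.
Qed.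

Lemma poly_decay (q : {poly R}) (K r0 : R) : 0 < r0 ->
  (forall r, r0 <= r -> `|q.[r]| <= K / r) -> q = 0.
Proof.
move=> r00; elim/poly_ind: q K => [//|q c IH] K H.
have K0 : 0 <= K.
  have := le_trans (normr_ge0 _) (H r0 (lexx _)).
  by rewrite pmulr_lge0 // invr_gt0.
have q0 : q = 0.
  apply: (IH (K / r0 + `|c|)) => r rr0; have r_gt0 := lt_le_trans r00 rr0.
  rewrite ler_pdivlMr //.
  have := H r rr0; rewrite hornerD hornerMX hornerC => Hr.
  have -> : `|q.[r]| * r = `|q.[r] * r| by rewrite normrM (gtr0_norm r_gt0).
  have -> : q.[r] * r = q.[r] * r + c - c by rewrite addrK.
  apply: le_trans (ler_normB _ _) _; rewrite lerD2r; apply: le_trans Hr _.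
  by rewrite ler_wpM2l // lef_pV2.
have : c = 0.
  apply/eqP; rewrite -normr_le0; apply/ler_addgt0Pl => e e0; rewrite addr0.
  (* A radius at which the bound K / r is at most e. *)
  pose r := r0 + K / e.
  have rr0 : r0 <= r by rewrite /r lerDl divr_ge0 // ltW.
  have r_gt0 := lt_le_trans r00 rr0.
  have := H r rr0; rewrite q0 mul0r add0r hornerC => /le_trans; apply.
  rewrite ler_pdivrMr // /r mulrDr mulrCA divff ?gt_eqF // mulr1 lerDr.
  by rewrite mulr_ge0 // ltW.
by move=> ->; rewrite q0 mul0r add0r.
Qed.

Lemma enorm_ge0 (x : 'rV[R]_2) : 0 <= enorm x.
Proof. exact: sqrtr_ge0. Qed.

(** Cauchy-Schwarz for a unit vector. *)
Lemma enorm_dir (y : 'rV[R]_2) t : y 0 0 * cos t + y 0 1 * sin t <= enorm y.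
Proof.
apply: le_trans (ler_norm _) _; rewrite -sqrtr_sqr /enorm sum2 ler_wsqrtr //.
have := cos2Dsin2 t; set c := cos t; set s := sin t => cs.
have : 0 <= (y 0 0 * s - y 0 1 * c) ^+ 2 by exact: sqr_ge0.
set a := y 0 0; set b := y 0 1 => H.
have -> : a ^+ 2 + b ^+ 2 = (a * c + b * s) ^+ 2 + (a * s - b * c) ^+ 2.
  transitivity ((a ^+ 2 + b ^+ 2) * (c ^+ 2 + s ^+ 2)); first by rewrite cs mulr1.
  by ring.
by rewrite lerDl.
Qed.

Lemma enorm_polar x r t : r - 2 * `|x| <= enorm (x + r *: dir t).
Proof.
apply: le_trans (enorm_dir _ t).
rewrite !mxE /=.
have b0 := coord_le_norm x 0; have b1 := coord_le_norm x 1.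
have := cos2Dsin2 t; have := cos_max t; have := sin_max t.
set c := cos t; set s := sin t => hs hc cs.
have E : (x 0 0 + r * c) * c + (x 0 1 + r * s) * s = r + (x 0 0 * c + x 0 1 * s).
  transitivity (r * (c ^+ 2 + s ^+ 2) + (x 0 0 * c + x 0 1 * s)); first by ring.
  by rewrite cs mulr1.
rewrite E lerD2l lerNl; apply: le_trans (ler_norm _) _; rewrite normrN.
apply: le_trans (ler_normD _ _) _; rewrite mulr_natl mulr2n !normrM.
by apply: lerD; rewrite -[leRHS]mulr1; apply: ler_pM; rewrite ?normr_ge0.
Qed.

(** Liouville's theorem: the circle means of a decaying polyharmonic function
    are polynomial in the radius and tend to zero at infinity, so they vanish;
    at radius 0 the mean is [2 * pi] times the value at the centre. *)
Lemma polyharmonic_liouville m h (C : R) : smooth h ->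
  (forall y, iter m laplacian h y = 0) ->
  (forall x, `|h x| <= C * (1 + enorm x)^-1) -> forall x, h x = 0.
Proof.
move=> sh hh bh x.
have C0 : 0 <= C.
  have := le_trans (normr_ge0 _) (bh 0).
  by rewrite pmulr_lge0 // invr_gt0 ltr_wpDr // enorm_ge0.
have [q Hq] := mean_polyharmonic x sh hh.
(* Beyond this radius the circle stays at distance at least r / 2 from 0. *)
have r00 : 0 < 4 * `|x| + 1 by rewrite ltr_wpDl // mulr_ge0.
have q0 : q = 0.
  apply: (@poly_decay q (twopi * (2 * C)) _ r00) => r rx.
  have r0 := lt_le_trans r00 rx.
  have x0 := normr_ge0 x.
  rewrite -Hq /circle_mean.
  apply: le_trans (Rintegral_norm_le (G := fun=> 2 * C / r) _ _ _ _) _.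
  - exact: measurable_itv.
  - apply: measurable_funTS; apply: continuous_measurable_fun.
    exact: continuous_circle _ _ (@angular1 R).1 sh.
  - by apply: segment_integrable; exact: cst_continuous.
  - move=> t _; rewrite mul1r; apply: le_trans (bh _) _.
    rewrite [2 * C]mulrC -mulrA ler_wpM2l //.
    rewrite -[2 in leRHS]invrK -invfM lef_pV2 ?posrE ?mulr_gt0 ?invr_gt0 //.
      by have := enorm_polar x r t; lra.
    by rewrite ltr_wpDr // enorm_ge0.
  - rewrite segment_integral_cst; last exact: ltW twopi_gt0.
    by rewrite subr0 [leLHS]mulrC [in leLHS]mulrA.
have := Hq 0; rewrite q0 horner0 circle_mean0; last exact: cst_continuous.
rewrite segment_integral_cst ?mul1r ?subr0; last exact: ltW twopi_gt0.
by move/eqP; rewrite mulf_eq0 (gt_eqF twopi_gt0) orbF => /eqP.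
Qed.

End Liouville.

(** * Integrals over the half-line *)

Section HalfLine.
Context {R : realType}.
Notation mu := (@lebesgue_measure R).
Notation RM := (measurableTypeR R).
Notation H := (`[0, +oo[%classic : set RM).

Lemma oneDsqr_gt0 (t : R) : 0 < oneDsqr t.
Proof. exact: lt_le_trans ltr01 (oneDsqr_ge1 t). Qed.

Lemma oneDsqrV_ge0 (t : R) : 0 <= (oneDsqr t)^-1.
Proof. by rewrite invr_ge0 ltW // oneDsqr_gt0. Qed.

Lemma is_derive_atan_shift (C a t : R) :
  is_derive t 1 (fun t : R => C * atan (t + a)) (C * (oneDsqr (t + a))^-1).
Proof.
have D : is_derive t 1 (fun t : R => t + a) 1.
  by apply: is_derive_eq; rewrite addr0.
have D1 := @is_derive1_comp R atan (fun t => t + a) t _ _ (is_derive1_atan (t + a)) D.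
have D2 := is_deriveZ C D1.
by apply: (is_derive_eq D2); rewrite /GRing.scale /= mulr1 /oneDsqr.
Qed.

Lemma cvg_atan_shift (C a : R) : C * atan (t + a) @[t --> +oo] --> C * (pi / 2).
Proof.
apply: cvgMl_tmp; apply: (@cvg_comp _ _ _ (fun t : R => t + a) atan _ +oo).
  exact: cvg_addrr.
exact: cvgy_atan.
Qed.

Lemma continuous_oneDsqrV_shift (C a : R) :
  continuous (fun t : R => C * (oneDsqr (t + a))^-1).
Proof.
move=> t; apply: cvgMl_tmp.
apply: (@continuous_comp _ _ _ (fun t : R => t + a) (fun t => (oneDsqr t)^-1)).
  by apply: cvgD; [exact: cvg_id|exact: cvg_cst].
exact: continuous_oneDsqrV.
Qed.

(** Stated in the extended reals, so that it also says that the integral is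
    finite. *)
Lemma halfline_FTC_ge0 (f F : R -> R) (l : R) : continuous f ->
  (forall t : R, is_derive t 1 F (f t)) -> (forall t, 0 <= t -> 0 <= f t) ->
  F t @[t --> +oo] --> l ->
  (\int[mu]_(t in `[0%R, +oo[) (f t)%:E = (l - F 0)%:E)%E.
Proof.
move=> cf dF f0 Fl.
have F0 : F x @[x --> 0^'+] --> F 0.
  by apply: cvg_at_right_filter; exact: (is_derive_continuous dF).
have dF0 t : 0 < t -> derivable F t 1 by case: (dF t).
have dFE : {in `]0, +oo[, (F^`())%classic =1 f}.
  by move=> t _; rewrite derive1E; have [_ ->] := dF t.
by rewrite (ge0_continuous_FTC2y f0 (continuous_subspaceT cf) Fl dF0 F0 dFE).
Qed.

Lemma halfline_integral_oneDsqr (C a : R) : 0 <= C ->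
  (\int[mu]_(t in `[0%R, +oo[) (C * (oneDsqr (t + a))^-1)%:E =
  (C * (pi / 2) - C * atan a)%:E)%E.
Proof.
move=> C0.
have pos (t : R) : 0 <= t -> 0 <= C * (oneDsqr (t + a))^-1.
  by rewrite mulr_ge0 // oneDsqrV_ge0.
rewrite (halfline_FTC_ge0 (@continuous_oneDsqrV_shift C a)
  (fun t => is_derive_atan_shift C a t) pos (@cvg_atan_shift C a)).
by rewrite add0r.
Qed.

Lemma halfline_integrable (C : R) : 0 <= C ->
  mu.-integrable H (EFin \o (fun t : R => C * (oneDsqr t)^-1)).
Proof.
move=> C0; apply/integrableP; split.
  apply/measurable_EFinP; apply: measurable_funTS; apply: continuous_measurable_fun.
  have := @continuous_oneDsqrV_shift C 0.
  by under eq_fun do rewrite addr0.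
have E : (\int[mu]_(t in `[0%R, +oo[) `|(C * (oneDsqr t)^-1)%:E| =
          \int[mu]_(t in `[0%R, +oo[) (C * (oneDsqr (t + 0))^-1)%:E)%E.
  apply: eq_integral => t _ /=.
  by rewrite addr0 ger0_norm // mulr_ge0 // oneDsqrV_ge0.
by rewrite [ltLHS]E halfline_integral_oneDsqr // ltry.
Qed.

(** The fundamental theorem on the half-line for a signed integrand dominated by
    [C / (1 + t ^+ 2)]; adding this bound reduces it to the nonnegative case. *)
Lemma halfline_FTC (d F : R -> R) (C l : R) : 0 <= C -> continuous d ->
  (forall t : R, is_derive t 1 F (d t)) ->
  (forall t, 0 <= t -> `|d t| <= C * (oneDsqr t)^-1) ->
  F t @[t --> +oo] --> l ->
  \int[mu]_(t in H) d t = l - F 0.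
Proof.
move=> C0 cd dF dC Fl.
pose G t := C * (oneDsqr t)^-1.
have cG : continuous G.
  have := @continuous_oneDsqrV_shift C 0.
  by under eq_fun do rewrite addr0.
have dG (t : R) : is_derive t 1 (fun t : R => C * atan t) (G t).
  have := is_derive_atan_shift C 0 t.
  by rewrite addr0; under eq_fun do rewrite addr0.
have iG := halfline_integrable C0.
have id_ : mu.-integrable H (EFin \o d).
  apply: (integrable_dominated (G := G)) => //.
    by apply: measurable_funTS; exact: continuous_measurable_fun.
  by move=> t /=; rewrite in_itv /= andbT; exact: dC.
have IG : (\int[mu]_(t in `[0%R, +oo[) (G t)%:E = (C * (pi / 2))%:E)%E.
  have := halfline_integral_oneDsqr 0 C0; rewrite atan0 mulr0 subr0 => <-.
  by apply: eq_integral => t _; rewrite addr0.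
have IdG : (\int[mu]_(t in `[0%R, +oo[) (d t + G t)%:E =
     (l + C * (pi / 2) - F 0)%:E)%E.
  have cdG : continuous (fun t => d t + G t).
    by move=> t; apply: cvgD; [exact: cd|exact: cG].
  have dFG (t : R) : is_derive t 1 (fun t : R => F t + C * atan t) (d t + G t).
    by have dFt := dF t; have dGt := dG t; exact: is_deriveD.
  have pos t : 0 <= t -> 0 <= d t + G t.
    move=> t0; have := dC t t0; rewrite -/(G t) ler_norml => /andP[? _].
    by rewrite -lerBlDr sub0r.
  have lim : F t + C * atan t @[t --> +oo] --> l + C * (pi / 2).
    apply: cvgD => //; have := @cvg_atan_shift C 0.
    by under eq_fun do rewrite addr0.
  by rewrite (halfline_FTC_ge0 cdG dFG pos lim) atan0 mulr0 addr0.
have E : \int[mu]_(t in H) (d t + G t) = \int[mu]_(t in H) d t + \int[mu]_(t in H) G t.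
  by rewrite RintegralD.
move: E; rewrite {1}/Rintegral IdG /= {2}/Rintegral IG /= => E.
by apply/(addIr (C * (pi / 2))); rewrite -E addrAC.
Qed.

End HalfLine.

(** * Ray integrals of Schwartz functions *)

Section RayIntegrals.
Context {R : realType}.
Notation mu := (@lebesgue_measure R).
Notation RM := (measurableTypeR R).
Notation H := (`[0, +oo[%classic : set RM).
Notation twopi := (2 * (pi : R)).
Implicit Types (x y : 'rV[R]_2) (f h k : 'rV[R]_2 -> R) (p q : R -> R) (r : R)
  (s : seq 'I_2).

Lemma schwartz_smooth f : schwartz f -> smooth f.
Proof. by case. Qed.

Lemma schwartz_partials s f : schwartz f -> schwartz (partials s f).
Proof.
move=> [sf bf]; split; first exact: smooth_partials.
move=> a s'; have [C HC] := bf a (s' ++ s); exists C => x.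
by have := HC x; rewrite /partials foldr_cat.
Qed.

Lemma schwartz_partial i f : schwartz f -> schwartz (partial i f).
Proof. exact: (@schwartz_partials [:: i]). Qed.

(** The weight [1 + |y| ^+ 2], with the Euclidean norm. *)
Definition weight y : R := 1 + y 0 0 ^+ 2 + y 0 1 ^+ 2.

Lemma weight_ge1 y : 1 <= weight y.
Proof. by rewrite /weight -addrA lerDl addr_ge0 // sqr_ge0. Qed.

Lemma weight_gt0 y : 0 < weight y.
Proof. exact: lt_le_trans ltr01 (weight_ge1 y). Qed.

(** A Schwartz function is [O ((1 + |y| ^+ 2) ^- 2)]. *)
Lemma schwartz_decay f : schwartz f ->
  exists2 C : R, 0 <= C & forall y, `|f y| <= C / weight y ^+ 2.
Proof.
move=> [_ bf].
pose a (m n : nat) := fun i : 'I_2 => if i == 0 then m else n.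
have mono m n : exists C : R, forall y, `|y 0 0 ^+ m * y 0 1 ^+ n * f y| <= C.
  have [C HC] := bf (a m n) [::]; exists C => y.
  have := HC y; rewrite /= big_ord_recl big_ord1.
  by rewrite /a /= (_ : lift ord0 ord0 = 1) //; apply/val_inj.
have [C00 H00] := mono 0%N 0%N; have [C20 H20] := mono 2%N 0%N.
have [C02 H02] := mono 0%N 2%N; have [C40 H40] := mono 4%N 0%N.
have [C22 H22] := mono 2%N 2%N; have [C04 H04] := mono 0%N 4%N.
(* The constants follow the expansion of weight y ^+ 2. *)
pose C := C00 + 2 * C20 + 2 * C02 + C40 + 2 * C22 + C04.
have key y : `|f y| * weight y ^+ 2 <= C.
  have w0 : 0 <= weight y ^+ 2 by rewrite sqr_ge0.
  rewrite -[X in _ * X <= _](ger0_norm w0) -normrM.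
  have -> : f y * weight y ^+ 2 =
     y 0 0 ^+ 0 * y 0 1 ^+ 0 * f y + 2 * (y 0 0 ^+ 2 * y 0 1 ^+ 0 * f y)
     + 2 * (y 0 0 ^+ 0 * y 0 1 ^+ 2 * f y) + y 0 0 ^+ 4 * y 0 1 ^+ 0 * f y
     + 2 * (y 0 0 ^+ 2 * y 0 1 ^+ 2 * f y) + y 0 0 ^+ 0 * y 0 1 ^+ 4 * f y.
    by rewrite /weight; set u := y 0 0; set v := y 0 1; set w := f y; ring.
  have n2 (z c : R) : `|z| <= c -> `|2 * z| <= 2 * c.
    by move=> zc; rewrite normrM ger0_norm // ler_wpM2l.
  apply: le_trans (ler_normD _ _) _; apply: lerD; last exact: H04.
  apply: le_trans (ler_normD _ _) _; apply: lerD; last exact: n2.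
  apply: le_trans (ler_normD _ _) _; apply: lerD; last exact: H40.
  apply: le_trans (ler_normD _ _) _; apply: lerD; last exact: n2.
  apply: le_trans (ler_normD _ _) _; apply: lerD; last exact: n2.
  exact: H00.
exists C => [|y].
  by apply: le_trans (key 0); rewrite mulr_ge0 // sqr_ge0.
by rewrite ler_pdivlMr ?exprn_gt0 ?weight_gt0 // key.
Qed.

(** Along a ray from [x] the weight grows like [1 + r ^+ 2], locally uniformly
    in [x]. *)
Lemma weight_polar x r t : oneDsqr r <= (2 + 4 * `|x| ^+ 2) * weight (x + r *: dir t).
Proof.
have [c0 c1] := (coord_le_norm x 0, coord_le_norm x 1).
have hx : x 0 0 ^+ 2 + x 0 1 ^+ 2 <= 2 * `|x| ^+ 2.
  rewrite mulr_natl mulr2n; apply: lerD.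
    by rewrite -real_normK ?num_real // lerXn2r ?nnegrE.
  by rewrite -real_normK ?num_real // lerXn2r ?nnegrE.
have w1 := weight_ge1 (x + r *: dir t).
set w := weight _ in w1 *.
have r2 : r ^+ 2 <= 2 * (w - 1) + 2 * (x 0 0 ^+ 2 + x 0 1 ^+ 2).
  have cs := cos2Dsin2 t.
  have -> : w - 1 = (x 0 0 + r * cos t) ^+ 2 + (x 0 1 + r * sin t) ^+ 2.
    by rewrite /w /weight !mxE /=; ring.
  have -> : r ^+ 2 = (r * cos t) ^+ 2 + (r * sin t) ^+ 2.
    by rewrite !exprMn -mulrDr cs mulr1.
  have sq (u v : R) : v ^+ 2 <= 2 * (u + v) ^+ 2 + 2 * u ^+ 2.
    rewrite -subr_ge0.
    have -> : 2 * (u + v) ^+ 2 + 2 * u ^+ 2 - v ^+ 2 = (2 * u + v) ^+ 2 by ring.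
    exact: sqr_ge0.
  have := lerD (sq (x 0 0) (r * cos t)) (sq (x 0 1) (r * sin t)).
  by move=> /le_trans; apply; rewrite !mulrDr; lra.
have n0 : 0 <= `|x| ^+ 2 by rewrite sqr_ge0.
set n := `|x| ^+ 2 in hx n0 *; set q := x 0 0 ^+ 2 + _ in hx r2.
rewrite /oneDsqr; have wn : 0 <= (w - 1) * n by rewrite mulr_ge0 // subr_ge0.
have -> : (2 + 4 * n) * w = 2 * w + 4 * n + 4 * ((w - 1) * n) by ring.
move: ((w - 1) * n) wn => m m0; lra.
Qed.

Lemma circle_mean_bound p f x r (B : R) : angular p -> smooth f ->
  (forall t, `|f (x + r *: dir t)| <= B) -> `|circle_mean p f x r| <= twopi * B.
Proof.
move=> ap sf HB.
apply: le_trans (Rintegral_norm_le (G := fun=> B) _ _ _ _) _.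
- exact: measurable_itv.
- apply: measurable_funTS; apply: continuous_measurable_fun.
  exact: continuous_circle _ _ ap.1 sf.
- by apply: segment_integrable; exact: cst_continuous.
- move=> t _; rewrite normrM -[leRHS]mul1r; apply: ler_pM; rewrite ?normr_ge0 //.
  exact: ap.2.
- rewrite segment_integral_cst; last exact: ltW (@twopi_gt0 R).
  by rewrite subr0 mulrC.
Qed.

Lemma circle_mean_schwartz p f (K : R) : angular p -> schwartz f ->
  exists2 C : R, 0 <= C & forall x r, `|x| <= K ->
    `|circle_mean p f x r| <= C * (oneDsqr r)^-1.
Proof.
move=> ap sf; have [C C0 HC] := schwartz_decay sf.
have D0 : 0 <= 2 + 4 * K ^+ 2 by rewrite addr_ge0 // mulr_ge0 // sqr_ge0.
exists (twopi * (C * (2 + 4 * K ^+ 2))) => [|x r xK].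
  by rewrite !mulr_ge0 // pi_ge0.
rewrite -mulrA; apply: circle_mean_bound => //; first exact: schwartz_smooth.
move=> t; apply: le_trans (HC _) _; rewrite -mulrA ler_wpM2l //.
have w1 := weight_ge1 (x + r *: dir t); have w0 := weight_gt0 (x + r *: dir t).
rewrite ler_pdivlMr ?oneDsqr_gt0 // mulrC ler_pdivrMr ?exprn_gt0 //.
apply: le_trans (weight_polar x r t) _.
apply: (@le_trans _ _ ((2 + 4 * K ^+ 2) * weight (x + r *: dir t))).
  apply: ler_wpM2r; first exact: ltW.
  rewrite lerD2l ler_wpM2l // lerXn2r ?nnegrE //.
  exact: le_trans (normr_ge0 x) xK.
by rewrite ler_wpM2l // expr2 -[leLHS]mulr1 ler_wpM2l // ltW.
Qed.

(** The ray integral [U_p f x]: the integral of [p t * f (x + r *: dir t)] over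
    [r >= 0] and [0 <= t <= 2 pi]. It is the convolution of [f] with a kernel
    homogeneous of degree -1; since the area element is [r dr dt], the integrand
    has no singularity in polar coordinates. *)
Definition ray_integral p f x : R := \int[mu]_(r in H) circle_mean p f x r.

Lemma continuous_circle_mean p f x : angular p -> smooth f ->
  continuous (circle_mean p f x).
Proof.
by move=> ap sf; exact: (is_derive_continuous (fun r => is_derive_circle_mean x r ap sf)).
Qed.

Lemma circle_mean_integrable p f x : angular p -> schwartz f ->
  mu.-integrable H (EFin \o circle_mean p f x).
Proof.
move=> ap sf; have [C C0 HC] := circle_mean_schwartz `|x| ap sf.
apply: (integrable_dominated (G := fun r => C * (oneDsqr r)^-1)).
- exact: measurable_itv.
- apply: measurable_funTS; apply: continuous_measurable_fun.
  by apply: continuous_circle_mean => //; exact: schwartz_smooth.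
- exact: halfline_integrable.
- by move=> r _; exact: HC.
Qed.

Let ray_family p f s : angular p -> schwartz f ->
  (forall x, measurable_fun H
     (fun r : RM => partials s (fun y => circle_mean p f y r) x)) /\
  (forall K : R, exists2 G : R -> R, mu.-integrable H (EFin \o G) &
    forall x r, `|x| <= K -> H r ->
     `|partials s (fun y => circle_mean p f y r) x| <= G r).
Proof.
move=> ap sf; have sm := schwartz_smooth sf; split=> [x|K].
  rewrite (_ : (fun r : RM => _) = (fun r : RM => circle_mean p (partials s f) x r)).
    apply: measurable_funTS; apply: continuous_measurable_fun.
    exact: continuous_circle_mean ap (smooth_partials s sm).
  by apply/funext => r; rewrite partials_circle_mean.
have [C C0 HC] := circle_mean_schwartz K ap (schwartz_partials s sf).
exists (fun r => C * (oneDsqr r)^-1); first exact: halfline_integrable.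
by move=> x r xK _; rewrite partials_circle_mean //; exact: HC.
Qed.

Lemma smooth_ray_integral p f : angular p -> schwartz f ->
  smooth (ray_integral p f).
Proof.
move=> ap sf; have sm := schwartz_smooth sf; apply: smooth_integral.
- exact: measurable_itv.
- by move=> r _; exact: smooth_circle_mean.
- by move=> s x; have [+ _] := ray_family s ap sf; exact.
- by move=> s K; have [_ +] := ray_family s ap sf; exact.
Qed.

Lemma partial_ray_integral p f i x : angular p -> schwartz f ->
  partial i (ray_integral p f) x = ray_integral p (partial i f) x.
Proof.
move=> ap sf; have sm := schwartz_smooth sf.
rewrite -[LHS]/(partials [:: i] (ray_integral p f) x) partials_integral.
- by apply: eq_Rintegral => r _; rewrite partials_circle_mean.
- exact: measurable_itv.
- by move=> r _; exact: smooth_circle_mean.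
- by move=> s y; have [+ _] := ray_family s ap sf; exact.
- by move=> s K; have [_ +] := ray_family s ap sf; exact.
Qed.

(** The radial derivative of [f], integrated along every ray from [x], gives
    [- f x]. *)
Lemma ray_integral_radial p f x : angular p -> schwartz f ->
  ray_integral (fun t => p t * cos t) (partial 0 f) x +
  ray_integral (fun t => p t * sin t) (partial 1 f) x =
  - (f x * \int[mu]_(t in `[0, twopi]) p t).
Proof.
move=> ap sf; have sm := schwartz_smooth sf.
have s0 := schwartz_partial 0 sf; have s1 := schwartz_partial 1 sf.
have ac := angularM ap (@angular_cos R); have as_ := angularM ap (@angular_sin R).
have [C0 C00 H0] := circle_mean_schwartz `|x| ac s0.
have [C1 C10 H1] := circle_mean_schwartz `|x| as_ s1.
have [C C_0 HC] := circle_mean_schwartz `|x| ap sf.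
rewrite /ray_integral -RintegralD; [|exact: measurable_itv|
  exact: circle_mean_integrable|exact: circle_mean_integrable].
have Fl : circle_mean p f x r @[r --> +oo] --> 0.
  apply/cvgrPdist_le => e e0.
  near=> r.
  rewrite sub0r normrN; apply: le_trans (HC x r (lexx _)) _.
  have r1 : 1 <= r by near: r; exact: nbhs_pinfty_ge.
  have rC : C / e <= r by near: r; apply: nbhs_pinfty_ge; exact: num_real.
  rewrite ler_pdivrMr ?oneDsqr_gt0 // mulrC -ler_pdivrMr //.
  apply: le_trans rC _; rewrite /oneDsqr.
  have : r <= r ^+ 2 by rewrite expr2 -[leLHS]mul1r ler_wpM2r // (le_trans ler01).
  lra.
rewrite (@halfline_FTC _ _ _ (C0 + C1) 0 _ _
   (fun r => is_derive_circle_mean x r ap sm) _ Fl).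
- by rewrite circle_mean0 ?sub0r //; exact: ap.1.
- by rewrite addr_ge0.
- move=> r; apply: cvgD.
    exact: (continuous_circle_mean ac (schwartz_smooth s0)).
  exact: (continuous_circle_mean as_ (schwartz_smooth s1)).
- move=> r _; apply: le_trans (ler_normD _ _) _.
  by rewrite mulrDl; apply: lerD; [exact: H0|exact: H1].
Unshelve. all: by end_near. Qed.

(** The field [(U_cos f, U_sin f)] is curl free, because the tangential
    derivative of [f] integrates to zero over every circle. *)
Lemma ray_integral_curl f x : schwartz f ->
  ray_integral sin (partial 0 f) x = ray_integral cos (partial 1 f) x.
Proof.
move=> sf; have sm := schwartz_smooth sf.
have s0 := schwartz_partial 0 sf; have s1 := schwartz_partial 1 sf.
have int_sin : \int[mu]_(t in `[0, twopi]) sin t = 0.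
  have dNc (t : R) : is_derive t 1 (fun t : R => - cos t) (sin t).
    by apply: is_derive_eq; rewrite opprK.
  rewrite (fundamental_theorem twopi_gt0 (@continuous_sin R) dNc).
  by rewrite cos_twopi cos0; ring.
have int_cos : \int[mu]_(t in `[0, twopi]) cos t = 0.
  rewrite (fundamental_theorem twopi_gt0 (@continuous_cos R) (fun t : R => is_derive_sin t)).
  by rewrite sin_twopi sin0; ring.
apply: eq_Rintegral => r _.
have [->|r0] := eqVneq r 0.
  rewrite !circle_mean0 ?int_sin ?int_cos ?mulr0 //.
    exact: continuous_cos.
  exact: continuous_sin.
have d1 (t : R) : is_derive t 1 (fun=> 1 : R) (0 : R) by exact: is_derive_cst.
have := circle_mean_parts x r (@cst_continuous R R 0) d1 erefl sm.
have -> : circle_mean (cst 0) f x r = 0.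
  have E := circle_meanZl 0 x r (@angular1 R).1 sm.
  by rewrite !mul0r in E; exact: E.
move=> /esym/eqP; rewrite mulf_eq0 (negbTE r0) /= subr_eq0 => /eqP E.
have -> : circle_mean sin (partial 0 f) x r =
    circle_mean (fun t => 1 * sin t) (partial 0 f) x r.
  by apply: eq_circle_meanl => t; rewrite mul1r.
by rewrite E; apply: eq_circle_meanl => t; rewrite mul1r.
Qed.

End RayIntegrals.

(** * Decay of ray integrals *)

Section RayDecay.
Context {R : realType}.
Notation mu := (@lebesgue_measure R).
Notation RM := (measurableTypeR R).
Notation H := (`[0, +oo[%classic : set RM).
Notation twopi := (2 * (pi : R)).
Implicit Types (x y : 'rV[R]_2) (f : 'rV[R]_2 -> R) (p : R -> R) (r t : R).

(** The components of [x] along the direction of angle [t] and across it. *)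
Definition along x t : R := x 0 0 * cos t + x 0 1 * sin t.
Definition across x t : R := x 0 1 * cos t - x 0 0 * sin t.

Lemma is_derive_along x t : is_derive t 1 (along x) (across x t).
Proof.
have D0 := is_deriveZ (x 0 0) (is_derive_cos t).
have D1 := is_deriveZ (x 0 1) (is_derive_sin t).
by apply: (is_derive_eq (is_deriveD D0 D1)); rewrite /across /GRing.scale /=; ring.
Qed.

Lemma is_derive_across x t : is_derive t 1 (across x) (- along x t).
Proof.
have D0 := is_deriveZ (x 0 1) (is_derive_cos t).
have D1 := is_deriveZ (x 0 0) (is_derive_sin t).
by apply: (is_derive_eq (is_deriveB D0 D1)); rewrite /along /GRing.scale /=; ring.
Qed.

Lemma continuous_along x : continuous (along x).
Proof. exact: (is_derive_continuous (is_derive_along x)). Qed.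

Lemma continuous_across x : continuous (across x).
Proof. exact: (is_derive_continuous (is_derive_across x)). Qed.

Lemma along_across x t : along x t ^+ 2 + across x t ^+ 2 = enorm x ^+ 2.
Proof.
rewrite /enorm sqr_sqrtr ?sum2; last by rewrite addr_ge0 // sqr_ge0.
transitivity ((x 0 0 ^+ 2 + x 0 1 ^+ 2) * (cos t ^+ 2 + sin t ^+ 2)).
  by rewrite /along /across; ring.
by rewrite cos2Dsin2 mulr1.
Qed.

Lemma weight_along_across x r t :
  weight (x + r *: dir t) = 1 + (r + along x t) ^+ 2 + across x t ^+ 2.
Proof.
rewrite /weight !mxE /=.
have -> : (r + along x t) ^+ 2 = r ^+ 2 + 2 * r * along x t + along x t ^+ 2 by ring.
have E := along_across x t; rewrite -addrA; symmetry; rewrite -addrA; congr (_ + _).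
rewrite -addrA E /enorm sqr_sqrtr ?sum2; last by rewrite addr_ge0 // sqr_ge0.
have cs := cos2Dsin2 t.
transitivity (r ^+ 2 * (cos t ^+ 2 + sin t ^+ 2) + 2 * r * along x t
   + (x 0 0 ^+ 2 + x 0 1 ^+ 2)); first by rewrite cs mulr1.
by rewrite /along; ring.
Qed.

Lemma norm_across x t : `|across x t| <= enorm x.
Proof.
rewrite -(ler_pXn2r (n := 2)) ?nnegrE ?enorm_ge0 //.
by rewrite real_normK ?num_real // -(along_across x t) lerDr sqr_ge0.
Qed.

Lemma norm_atan (t : R) : `|atan t| <= pi / 2.
Proof. by rewrite ler_norml (ltW (atan_gtNpi2 t)) (ltW (atan_ltpi2 t)). Qed.

(** The inverse of [1 + across ^+ 2], which bounds the angular integrand. *)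
Let invb x t := (oneDsqr (across x t))^-1.

Let continuous_invb x : continuous (invb x).
Proof.
move=> t; apply: (@continuous_comp _ _ _ (across x) (fun t => (oneDsqr t)^-1)).
  exact: continuous_across.
exact: continuous_oneDsqrV.
Qed.

Let invb_le1 x t : invb x t <= 1.
Proof. by rewrite /invb invf_le1 ?oneDsqr_gt0 // oneDsqr_ge1. Qed.

(** The integral of [1 / (1 + s ^+ 2)] over the circle, [s] being the component
    of [x] across the direction, is [O (1 / (1 + |x|))]. With [c] the component
    along the direction, [c * atan s] is periodic with derivative
    [s * atan s - c ^+ 2 / (1 + s ^+ 2)], so the integral of
    [|x| ^+ 2 / (1 + s ^+ 2)], where [|x| ^+ 2 = c ^+ 2 + s ^+ 2], is at most
    [2 * pi] plus the integral of [s * atan s], hence is [O (1 + |x|)]. *)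
Lemma circle_oneDsqr x :
  \int[mu]_(t in `[0, twopi]) (oneDsqr (across x t))^-1 <=
  (4 * pi + pi ^+ 2) * (1 + enorm x)^-1.
Proof.
set J := (X in X <= _); set rho := enorm x; have rho0 : 0 <= rho := enorm_ge0 x.
have pi0 : 0 <= pi :> R := pi_ge0 R.
have J1 : J <= twopi.
  apply: le_trans (ler_norm _) _.
  apply: le_trans (Rintegral_norm_le (G := fun=> 1) _ _ _ _) _.
  - exact: measurable_itv.
  - by apply: measurable_funTS; apply: continuous_measurable_fun; exact: continuous_invb.
  - by apply: segment_integrable; exact: cst_continuous.
  - by move=> t _; rewrite ger0_norm ?oneDsqrV_ge0 //; exact: invb_le1.
  - rewrite segment_integral_cst; last exact: ltW (@twopi_gt0 R).
    by rewrite subr0 mul1r.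
pose c2 t := along x t ^+ 2 * invb x t.
pose bat t := across x t * atan (across x t).
have c_c2 : continuous c2.
  move=> t; have cal := @continuous_along x t.
  exact: (cvgM (cvgM cal cal) (@continuous_invb x t)).
have c_bat : continuous bat.
  move=> t; apply: (cvgM (@continuous_across x t)).
  apply: (@continuous_comp _ _ _ (across x) atan); first exact: continuous_across.
  exact: continuous_atan.
have I1 : \int[mu]_(t in `[0, twopi]) (-1 * c2 t + bat t) = 0.
  have dF t : is_derive t 1 (fun t => along x t * atan (across x t)) (-1 * c2 t + bat t).
    have D0 := @is_derive1_comp R atan (across x) t _ _
       (is_derive1_atan (across x t)) (is_derive_across x t).
    apply: (is_derive_eq (is_deriveM (is_derive_along x t) D0)).
    by rewrite /c2 /bat /invb /oneDsqr /GRing.scale /=; ring.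
  have cF : continuous (fun t => -1 * c2 t + bat t).
    by move=> t; apply: cvgD (c_bat t); apply: cvgMl_tmp; exact: c_c2.
  rewrite (fundamental_theorem (@twopi_gt0 R) cF dF).
  by rewrite /along /across cos_twopi sin_twopi cos0 sin0 subrr.
have I2 : \int[mu]_(t in `[0, twopi]) bat t <= twopi * (rho * (pi / 2)).
  apply: le_trans (ler_norm _) _.
  apply: le_trans (Rintegral_norm_le (G := fun=> rho * (pi / 2)) _ _ _ _) _.
  - exact: measurable_itv.
  - by apply: measurable_funTS; exact: continuous_measurable_fun.
  - by apply: segment_integrable; exact: cst_continuous.
  - move=> t _; rewrite /bat normrM; apply: ler_pM; rewrite ?normr_ge0 ?norm_atan //.
    exact: norm_across.
  - rewrite segment_integral_cst; last exact: ltW (@twopi_gt0 R).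
    by rewrite subr0 mulrC.
have J2 : rho ^+ 2 * J <= twopi + twopi * (rho * (pi / 2)).
  rewrite /J -RintegralZl //; last by apply: segment_integrable; exact: continuous_invb.
  apply: (@le_trans _ _ (\int[mu]_(t in `[0, twopi]) (1 * (fun=> 1) t + c2 t))).
    apply: le_Rintegral => //.
    - by apply: segment_integrable => t; apply: cvgMl_tmp; exact: continuous_invb.
    - apply: segment_integrable => t; apply: cvgD; last exact: c_c2.
      by apply: cvgMl_tmp; exact: cvg_cst.
    - move=> t _; rewrite /rho -(along_across x t) /c2 mulr1 mulrDl addrC lerD2r.
      rewrite -/(invb x t) ler_pdivrMr ?oneDsqr_gt0 // mul1r /oneDsqr.
      by rewrite lerDr.
  rewrite segment_integral_lin //; last exact: cst_continuous.
  move: I1; rewrite segment_integral_lin // mulN1r => /eqP.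
  rewrite addrC subr_eq0 => /eqP <-.
  rewrite mul1r; apply: lerD => //.
  rewrite segment_integral_cst; last exact: ltW (@twopi_gt0 R).
  by rewrite subr0 mul1r.
have J0 : 0 <= J by apply: Rintegral_ge0 => t _; exact: oneDsqrV_ge0.
rewrite ler_pdivlMr; last by rewrite ltr_wpDr.
(* For rho <= 1 the trivial bound J1 suffices; for rho > 1 divide J2 by rho. *)
have [r1|r1] := leP rho 1.
  apply: (@le_trans _ _ (twopi * 2)).
    apply: ler_pM => //; first by rewrite addr_ge0.
    by rewrite -[leRHS]/(1 + 1) lerD2l.
  by have : 0 <= (pi : R) ^+ 2 := sqr_ge0 _; lra.
have rJ : rho * J <= twopi + pi ^+ 2.
  have r0 : 0 < rho := lt_trans ltr01 r1.
  rewrite -(ler_pM2l r0) mulrA -expr2; apply: le_trans J2 _.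
  have : twopi <= rho * twopi by rewrite -[leLHS]mul1r ler_wpM2r ?mulr_ge0 // ltW.
  have -> : twopi * (rho * (pi / 2)) = rho * pi ^+ 2 by rewrite expr2; field.
  by move=> ?; rewrite [leRHS]mulrDr lerD2r.
by rewrite mulrDr mulr1 [J * _]mulrC; lra.
Qed.

Lemma integral_indicE (D : set RM) (g : RM -> R) :
  (\int[mu]_(t in D) (g t)%:E = \int[mu]_t (g t * \1_D t)%:E)%E.
Proof.
rewrite integral_mkcond; apply: eq_integral => t _.
by rewrite patchE indicE; case: ifP => _; rewrite ?mulr1 ?mulr0.
Qed.

(** Tonelli's theorem for a nonnegative function on a product of two sets. *)
Section Tonelli.
Variables (A B : set RM) (k : RM * RM -> R).
Hypotheses (mA : measurable A) (mB : measurable B).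
Hypotheses (mk : measurable_fun setT k) (k0 : forall z, 0 <= k z).

Let kB (z : RM * RM) : \bar R := (k z * \1_B z.2)%:E.

Let m_kB : measurable_fun setT kB.
Proof.
apply/measurable_EFinP; apply: measurable_funM => //.
by apply: measurableT_comp; [exact: measurable_indic|exact: measurable_snd].
Qed.

Lemma measurable_section_integral :
  measurable_fun A (fun r : RM => \int[mu]_(t in B) (k (r, t))%:E)%E.
Proof.
have kB0 z : (0 <= kB z)%E by rewrite lee_fin mulr_ge0.
have := measurable_fun_fubini_tonelli_F (m2 := mu) kB m_kB kB0.
move=> /(measurable_funS measurableT (@subsetT _ A)).
apply: eq_measurable_fun => r _.
by rewrite integral_indicE.
Qed.

Lemma tonelli_domains :
  (\int[mu]_(r in A) \int[mu]_(t in B) (k (r, t))%:E =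
   \int[mu]_(t in B) \int[mu]_(r in A) (k (r, t))%:E)%E.
Proof.
pose kk (z : RM * RM) : \bar R := (k z * \1_A z.1 * \1_B z.2)%:E.
have m_kk : measurable_fun setT kk.
  apply/measurable_EFinP; apply: measurable_funM; last first.
    by apply: measurableT_comp; [exact: measurable_indic|exact: measurable_snd].
  apply: measurable_funM => //.
  by apply: measurableT_comp; [exact: measurable_indic|exact: measurable_fst].
have kk0 z : (0 <= kk z)%E by rewrite lee_fin !mulr_ge0.
transitivity (\int[mu]_r \int[mu]_t kk (r, t))%E.
  rewrite integral_mkcond; apply: eq_integral => r _.
  rewrite patchE; case: ifP => rA.
    rewrite integral_indicE; apply: eq_integral => t _.
    by rewrite /kk /= [\1_A _]indicE rA mulr1.
  symmetry; apply: integral0_eq => t _.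
  by rewrite /kk /= [\1_A _]indicE rA mulr0 mul0r.
rewrite (fubini_tonelli kk m_kk kk0).
rewrite [RHS]integral_mkcond; apply: eq_integral => t _.
rewrite patchE; case: ifP => tB.
  rewrite integral_indicE; apply: eq_integral => r _.
  by rewrite /kk /= [\1_B _]indicE tB mulr1.
apply: integral0_eq => r _.
by rewrite /kk /= [\1_B _]indicE tB mulr0.
Qed.

End Tonelli.

(** Write [x + r *: dir t] in the components along and across the direction [t].
    By the decay of [f] the integrand is at most [C] times the product of
    [1 / (1 + (r + along) ^+ 2)] and [1 / (1 + across ^+ 2)]; integrate first in
    [r], by Tonelli, and then in [t], by [circle_oneDsqr]. *)
Lemma ray_integral_decay p f : angular p -> schwartz f ->
  exists C : R, forall x, `|ray_integral p f x| <= C * (1 + enorm x)^-1.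
Proof.
move=> ap sf; have sm := schwartz_smooth sf.
have [C C0 HC] := schwartz_decay sf.
exists (C * pi * (4 * pi + pi ^+ 2)) => x.
pose k (z : RM * RM) := C * (oneDsqr (z.1 + along x z.2))^-1 * invb x z.2.
have mk : measurable_fun setT k.
  apply: measurable_funM.
    apply: measurable_funM; first exact: measurable_cst.
    apply: (@measurableT_comp _ _ _ _ _ _ (fun t : RM => (oneDsqr t)^-1 : R)).
      by apply: continuous_measurable_fun; exact: continuous_oneDsqrV.
    apply: measurable_funD; first exact: measurable_fst.
    apply: measurableT_comp; last exact: measurable_snd.
    by apply: continuous_measurable_fun; exact: continuous_along.
  apply: measurableT_comp; last exact: measurable_snd.
  by apply: continuous_measurable_fun; exact: continuous_invb.
have k0 z : 0 <= k z.
  by rewrite /k mulr_ge0 ?oneDsqrV_ge0 // mulr_ge0 // oneDsqrV_ge0.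
have fk r t : `|f (x + r *: dir t)| <= k (r, t).
  apply: le_trans (HC _) _; rewrite /k -mulrA ler_wpM2l //= -invfM.
  rewrite lef_pV2 ?posrE ?mulr_gt0 ?exprn_gt0 ?oneDsqr_gt0 ?weight_gt0 //.
  rewrite expr2 weight_along_across /oneDsqr.
  by apply: ler_pM; rewrite ?addr_ge0 ?sqr_ge0 //; [rewrite lerDl sqr_ge0|
    rewrite -addrA lerD2l lerDr sqr_ge0].
have cmk r : (`|(circle_mean p f x r)%:E| <= \int[mu]_(t in `[0%R, twopi]) (k (r, t))%:E)%E.
  have cpf := continuous_circle x r ap.1 sm.
  have ipf := segment_integrable 0 twopi cpf.
  rewrite -[leLHS]/(`|circle_mean p f x r|%:E) EFin_normr_Rintegral //.
  apply: le_trans (le_abse_integral _ _ _) _ => //.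
    by apply/measurable_EFinP; apply: measurable_funTS; exact: continuous_measurable_fun.
  apply: ge0_le_integral => //.
  - apply/measurable_EFinP; apply: measurable_funTS; apply: continuous_measurable_fun.
    by move=> t; apply: cvg_norm; exact: cpf.
  - apply/measurable_EFinP; apply: measurable_funTS.
    exact: measurable_fun_pair2.
  - move=> t _; rewrite lee_fin normrM -[leRHS]mul1r.
    by apply: ler_pM; rewrite ?normr_ge0 ?ap.2 //; exact: fk.
have icm := circle_mean_integrable x ap sf.
have mcm : measurable_fun H (EFin \o circle_mean p f x) by case/integrableP: icm.
rewrite -lee_fin EFin_normr_Rintegral //.
apply: le_trans (le_abse_integral _ _ mcm) _ => //.
apply: (@le_trans _ _ (\int[mu]_(r in H) \int[mu]_(t in `[0%R, twopi]) (k (r, t))%:E)%E).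
  apply: ge0_le_integral => //.
  - exact: measurableT_comp.
  - exact: measurable_section_integral.
  - by move=> r _; exact: cmk.
rewrite (@tonelli_domains H `[0, twopi]%classic k (measurable_itv _) (measurable_itv _) mk k0).
apply: (@le_trans _ _ (\int[mu]_(t in `[0%R, twopi]) (C * pi * invb x t)%:E)%E).
  apply: ge0_le_integral => //.
  - by move=> t _; apply: integral_ge0 => r _; rewrite lee_fin.
  - apply: (@measurable_section_integral _ _ (fun z => k (z.2, z.1))) => //.
    by apply: measurableT_comp mk _; apply: measurable_fun_pair;
      [exact: measurable_snd|exact: measurable_fst].
  - apply/measurable_EFinP; apply: measurable_funTS; apply: continuous_measurable_fun.
    by move=> t; apply: cvgMl_tmp; exact: continuous_invb.
  - move=> t _; 
    have -> : (\int[mu]_(r in H) (k (r, t))%:E =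
        \int[mu]_(r in H) (C * invb x t * (oneDsqr (r + along x t))^-1)%:E)%E.
      by apply: eq_integral => r _; rewrite /k /= mulrAC.
    rewrite halfline_integral_oneDsqr; last by rewrite mulr_ge0 // oneDsqrV_ge0.
    rewrite lee_fin -mulrBr [C * pi * _]mulrAC ler_wpM2l //.
      by rewrite mulr_ge0 // oneDsqrV_ge0.
    by have := atan_gtNpi2 (along x t); lra.
have ci : continuous (fun t => C * pi * invb x t).
  by move=> t; apply: cvgMl_tmp; exact: continuous_invb.
have ii := segment_integrable 0 twopi ci.
rewrite -[leLHS](fineK (integrable_fin_num _ ii)) // lee_fin.
rewrite -[leLHS]/(\int[mu]_(t in `[0, twopi]) (C * pi * invb x t)).
rewrite RintegralZl //; last by apply: segment_integrable; exact: continuous_invb.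
rewrite -[leRHS]mulrA ler_wpM2l ?mulr_ge0 ?pi_ge0 //.
exact: circle_oneDsqr.
Qed.

End RayDecay.

(** * Poincare lemma and complex derivatives *)

Section Potentials.
Context {R : realType}.
Notation mu := (@lebesgue_measure R).
Implicit Types (x y : 'rV[R]_2) (h w : 'rV[R]_2 -> R).

Lemma smooth_of_gradient (V w0 w1 : 'rV[R]_2 -> R) :
  smooth w0 -> smooth w1 ->
  (forall x, is_derive x (delta_mx 0 0) V (w0 x)) ->
  (forall x, is_derive x (delta_mx 0 1) V (w1 x)) ->
  [/\ smooth V, partial 0 V = w0 & partial 1 V = w1].
Proof.
move=> s0 s1 d0 d1.
have E0 : partial 0 V = w0.
  by apply/funext => x; exact: (@derive_val _ _ _ _ _ _ _ (d0 x)).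
have E1 : partial 1 V = w1.
  by apply/funext => x; exact: (@derive_val _ _ _ _ _ _ _ (d1 x)).
have dV (i : 'I_2) x : derivable V x (delta_mx 0 i).
  by case: (ord2P i) => ->; [case: (d0 x)|case: (d1 x)].
split; [|exact: E0|exact: E1]; apply: smooth_of_partial; [|exact: dV|].
  apply: continuous_of_bounded_partials; [exact: dV|move=> K].
  have [C0 H0] := smooth_locally_bounded [::] K s0.
  have [C1 H1] := smooth_locally_bounded [::] K s1.
  exists (Num.max C0 C1) => i x xK; rewrite le_max.
  case: (ord2P i) => ->; first by rewrite E0 (H0 x xK).
  by rewrite E1 (H1 x xK) orbT.
by move=> i; case: (ord2P i) => ->; [rewrite E0; exact: s0|rewrite E1; exact: s1].
Qed.

(** The integrand, in [t], of the radial primitive of the form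
    [w0 dx0 + w1 dx1]. *)
Let radial (w0 w1 : 'rV[R]_2 -> R) y (t : R) :=
  y 0 0 * w0 (t *: y) + y 0 1 * w1 (t *: y).

Let is_derive_scale w y (t : R) : smooth w ->
  is_derive t 1 (fun t : R => t * w (t *: y))
    (w (t *: y) + t * (y 0 0 * partial 0 w (t *: y) + y 0 1 * partial 1 w (t *: y))).
Proof.
move=> sw.
have D : is_derive t 1 (fun t : R => w (t *: y))
    (y 0 0 * partial 0 w (t *: y) + y 0 1 * partial 1 w (t *: y)).
  apply: (chain_rule (d := fun i => y 0 i) sw) => i.
  rewrite (_ : (fun s => _) = (fun s : R => s * y 0 i)).
    by apply: is_derive_eq; rewrite /GRing.scale /=; ring.
  by apply/funext => s; rewrite mxE.
apply: (is_derive_eq (is_deriveM (is_derive_id t 1) D)).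
by rewrite /GRing.scale /= mulr1 addrC.
Qed.

Let is_derive_radial w0 w1 (i : 'I_2) x (t u : R) : smooth w0 -> smooth w1 ->
  partial 1 w0 = partial 0 w1 ->
  let y := x + u *: delta_mx 0 i in
  let w := if i == 0 then w0 else w1 in
  is_derive u 1 (fun u : R => radial w0 w1 (x + u *: delta_mx 0 i) t)
    (w (t *: y) + t * (y 0 0 * partial 0 w (t *: y) + y 0 1 * partial 1 w (t *: y))).
Proof.
move=> s0 s1 E y w.
have Dw (k : 'rV[R]_2 -> R) : smooth k -> is_derive u 1 (fun u : R => k (t *: (x + u *: delta_mx 0 i)))
    ((t * (i == 0)%:R) * partial 0 k (t *: y) + (t * (i == 1)%:R) * partial 1 k (t *: y)).
  move=> sk.
  apply: (chain_rule (d := fun j => t * (i == j)%:R) sk) => j.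
  rewrite (_ : (fun s => _) = (fun s : R => t * x 0 j + s * (t * (i == j)%:R))).
    by apply: is_derive_eq; rewrite /GRing.scale /=; ring.
  by apply/funext => s; rewrite !mxE /= eq_sym; ring.
have Dc (j : 'I_2) : is_derive u 1 (fun u : R => (x + u *: delta_mx 0 i) 0 j) (i == j)%:R.
  rewrite (_ : (fun s => _) = (fun s : R => x 0 j + s * (i == j)%:R)).
    by apply: is_derive_eq; rewrite /GRing.scale /=; ring.
  by apply/funext => s; rewrite !mxE /= eq_sym.
apply: (is_derive_eq (is_deriveD (is_deriveM (Dc 0) (Dw _ s0)) (is_deriveM (Dc 1) (Dw _ s1)))).
rewrite -/y /w; case: (ord2P i) => -> /=; rewrite /GRing.scale /=.
  rewrite E; set a := w0 _; set b := partial _ _ _; set c := partial _ _ _; ring.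
rewrite -E; set a := w1 _; set b := partial _ _ _; set c := partial _ _ _; ring.
Qed.

Let continuous_scale w y : smooth w -> continuous (fun t : R => w (t *: y)).
Proof.
move=> sw; apply: (is_derive_continuous (g := fun t : R =>
    y 0 0 * partial 0 w (t *: y) + y 0 1 * partial 1 w (t *: y))) => t.
apply: (chain_rule (d := fun i => y 0 i) sw) => i.
rewrite (_ : (fun s => _) = (fun s : R => s * y 0 i)).
  by apply: is_derive_eq; rewrite /GRing.scale /=; ring.
by apply/funext => s; rewrite mxE.
Qed.

Let continuous_scale_derivative w y : smooth w -> continuous (fun t : R =>
  w (t *: y) + t * (y 0 0 * partial 0 w (t *: y) + y 0 1 * partial 1 w (t *: y))).
Proof.
move=> sw t; apply: cvgD; first exact: continuous_scale.
apply: cvgM; first exact: cvg_id.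
apply: cvgD; apply: cvgMl_tmp; apply: continuous_scale; exact: smooth_partial.
Qed.

(** For a closed form, the derivative of [radial] in direction [i] equals the
    derivative of [t * w_i (t *: y)] in [t], so that the primitive has
    derivative [w_i]. *)
Let is_derive_primitive w0 w1 (i : 'I_2) x : smooth w0 -> smooth w1 ->
  partial 1 w0 = partial 0 w1 ->
  is_derive x (delta_mx 0 i) (fun y => \int[mu]_(t in `[0, 1]) radial w0 w1 y t)
    ((if i == 0 then w0 else w1) x).
Proof.
move=> s0 s1 E; set w := if i == 0 then w0 else w1.
have sw : smooth w by rewrite /w; case: ifP => _.
apply: is_derive_line.
pose g (u t : R) := let y := x + u *: delta_mx 0 i in
  w (t *: y) + t * (y 0 0 * partial 0 w (t *: y) + y 0 1 * partial 1 w (t *: y)).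
set K := `|x| + 1.
have [C HC] := smooth_locally_bounded [::] K sw.
have [C0 H0] := smooth_locally_bounded [:: 0] K sw.
have [C1 H1] := smooth_locally_bounded [:: 1] K sw.
have K0 : 0 <= K by rewrite addr_ge0.
have -> : w x = \int[mu]_(t in `[0, 1]) g 0 t.
  have dF t := is_derive_scale x t sw.
  have := fundamental_theorem ltr01 (@continuous_scale_derivative w x sw) dF.
  rewrite scale1r mul1r mul0r subr0 => <-.
  by rewrite /g scale0r addr0.
apply: (is_derive_integral (G := fun=> C + (K * C0 + K * C1))).
- exact: measurable_itv.
- move=> u; apply: segment_integrable => t.
  by apply: cvgD; apply: cvgMl_tmp; exact: continuous_scale.
- by move=> u t _; exact: is_derive_radial.
- by apply: segment_integrable; exact: cst_continuous.
- move=> u t; rewrite subr0 /= in_itv /= => u1 /andP[t0 t1].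
  rewrite /g; set y := x + _.
  have yK : `|y| <= K.
    apply: le_trans (ler_normD _ _) _; rewrite lerD2l normrZ.
    rewrite -[leRHS]mulr1; apply: ler_pM => //.
    apply: norm_le_coord => // j; rewrite deltaE.
    by case: eqP => _; rewrite ?normr1 ?normr0.
  have tyK : `|t *: y| <= K.
    by rewrite normrZ -[leRHS]mul1r; apply: ler_pM => //; rewrite ger0_norm.
  apply: le_trans (ler_normD _ _) _; apply: lerD; first exact: HC.
  rewrite normrM ger0_norm // -[leRHS]mul1r; apply: ler_pM => //.
  apply: le_trans (ler_normD _ _) _; rewrite !normrM.
  apply: lerD; apply: ler_pM; rewrite ?normr_ge0 //.
  + exact: le_trans (coord_le_norm _ _) yK.
  + exact: H0.
  + exact: le_trans (coord_le_norm _ _) yK.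
  + exact: H1.
Qed.

(** The Poincare lemma on the plane, for closed 1-forms. *)
Lemma poincare w0 w1 : smooth w0 -> smooth w1 -> partial 1 w0 = partial 0 w1 ->
  exists V, [/\ smooth V, partial 0 V = w0 & partial 1 V = w1].
Proof.
move=> s0 s1 E; exists (fun y => \int[mu]_(t in `[0, 1]) radial w0 w1 y t).
apply: smooth_of_gradient.
- exact: s0.
- exact: s1.
- by move=> x; exact: (is_derive_primitive 0 x s0 s1 E).
- by move=> x; exact: (is_derive_primitive 1 x s0 s1 E).
Qed.

(** Complex-valued functions on the plane, as pairs of a real and an imaginary
    part. *)
Definition cfield : Type := ('rV[R]_2 -> R) * ('rV[R]_2 -> R).

(** Smoothness of both parts. *)
Definition csmooth (F : cfield) := smooth F.1 /\ smooth F.2.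

(** The Wirtinger derivatives [dz = (d0 - i d1) / 2] and
    [dzb = (d0 + i d1) / 2], written on real and imaginary parts. *)
Definition dz (F : cfield) : cfield :=
  (fun x => 2^-1 * (partial 0 F.1 x + partial 1 F.2 x),
   fun x => 2^-1 * (partial 0 F.2 x + -1 * partial 1 F.1 x)).
Definition dzb (F : cfield) : cfield :=
  (fun x => 2^-1 * (partial 0 F.1 x + -1 * partial 1 F.2 x),
   fun x => 2^-1 * (partial 0 F.2 x + partial 1 F.1 x)).

Lemma csmooth_dzb F : csmooth F -> csmooth (dzb F).
Proof.
move=> [s1 s2]; split; apply: smoothZ; apply: smoothD; try exact: smooth_partial.
by apply: smoothZ; exact: smooth_partial.
Qed.

Let partial_half i h (k : 'rV[R]_2 -> R) : smooth h -> smooth k ->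
  partial i (fun x => 2^-1 * (h x + k x)) =
  (fun x => 2^-1 * (partial i h x + partial i k x)).
Proof. by move=> sh sk; rewrite (partialZ i 2^-1 (smoothD sh sk)) (partialD i sh sk). Qed.

Let partial_halfB i h (k : 'rV[R]_2 -> R) : smooth h -> smooth k ->
  partial i (fun x => 2^-1 * (h x + -1 * k x)) =
  (fun x => 2^-1 * (partial i h x + -1 * partial i k x)).
Proof.
by move=> sh sk; rewrite (partial_half i sh (smoothZ (-1) sk)) (partialZ i (-1) sk).
Qed.

Let quarterB (a b c d : R) : c = d ->
  2^-1 * (2^-1 * (a + -1 * c) + 2^-1 * (d + b)) = 4^-1 * (a + b).
Proof. by move=> ->; field. Qed.

Let quarterD (a b c d : R) : c = d ->
  2^-1 * (2^-1 * (a + c) + -1 * (2^-1 * (d + -1 * b))) = 4^-1 * (a + b).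
Proof. by move=> ->; field. Qed.

(** [4 dz dzb] is the Laplacian. *)
Lemma dz_dzb F : csmooth F -> dz (dzb F) =
  (fun x => 4^-1 * laplacian F.1 x, fun x => 4^-1 * laplacian F.2 x).
Proof.
case: F => F G [/= sF sG].
have [s0F s1F] := (smooth_partial 0 sF, smooth_partial 1 sF).
have [s0G s1G] := (smooth_partial 0 sG, smooth_partial 1 sG).
have CF := partialC 0 1 sF; have CG := partialC 0 1 sG.
rewrite /dz /dzb /=.
rewrite (partial_halfB 0 s0F s1G) (partial_half 1 s0G s1F).
rewrite (partial_half 0 s0G s1F) (partial_halfB 1 s0F s1G).
by congr pair; apply/funext => x;
  [apply: quarterB; exact: (congr1 (@^~ x) CG)|apply: quarterD; exact: (congr1 (@^~ x) CF)].
Qed.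

Lemma dzb_dz F : csmooth F -> dzb (dz F) = dz (dzb F).
Proof.
move=> cF; rewrite dz_dzb //; case: F cF => F G [/= sF sG].
have [s0F s1F] := (smooth_partial 0 sF, smooth_partial 1 sF).
have [s0G s1G] := (smooth_partial 0 sG, smooth_partial 1 sG).
have CF := partialC 0 1 sF; have CG := partialC 0 1 sG.
rewrite /dz /dzb /=.
rewrite (partial_half 0 s0F s1G) (partial_halfB 1 s0G s1F).
rewrite (partial_halfB 0 s0G s1F) (partial_half 1 s0F s1G).
by congr pair; apply/funext => x;
  [apply: quarterD; exact: (congr1 (@^~ x) CG)|apply: quarterB; exact: (congr1 (@^~ x) CF)].
Qed.

Lemma csmooth_iter_dzb n F : csmooth F -> csmooth (iter n dzb F).
Proof. by move=> sF; elim: n => [|n IH]; [exact: sF|exact: csmooth_dzb IH]. Qed.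

Lemma dz_iter_dzb n F : csmooth F -> dz (iter n dzb F) = iter n dzb (dz F).
Proof.
move=> sF; elim: n => [//|n IH]; rewrite /= -IH dzb_dz; first by [].
exact: csmooth_iter_dzb.
Qed.

Lemma iter_laplacianZ n h (c : R) : smooth h ->
  iter n laplacian (fun x => c * h x) = (fun x => c * iter n laplacian h x).
Proof.
move=> sh; elim: n => [//|n IH]; rewrite iterS IH.
have sn : smooth (iter n laplacian h).
  by elim: n {IH} => [|n IH]; [exact: sh|exact: smooth_laplacian IH].
rewrite {1}/laplacian !(partialZ _ c sn).
rewrite (partialZ 0 c (smooth_partial 0 sn)) (partialZ 1 c (smooth_partial 1 sn)).
by apply/funext => x; rewrite /laplacian mulrDr.
Qed.

Lemma iter_dz_dzb n F : csmooth F -> iter n dz (iter n dzb F) =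
  (fun x => 4^-1 ^+ n * iter n laplacian F.1 x,
   fun x => 4^-1 ^+ n * iter n laplacian F.2 x).
Proof.
elim: n F => [|n IH] F sF.
  by case: F {sF} => F G /=; congr pair; apply/funext => x; rewrite mul1r.
rewrite (iterSr n dz) (iterSr n dzb) dz_iter_dzb; last exact: csmooth_dzb.
rewrite dz_dzb // IH; last by case: sF => s1 s2; split; apply: smoothZ; exact: smooth_laplacian.
have [s1 s2] := (smooth_laplacian sF.1, smooth_laplacian sF.2).
congr pair; apply/funext => x /=.
  by rewrite (iter_laplacianZ n _ s1) mulrA -exprSr -iterSr.
by rewrite (iter_laplacianZ n _ s2) mulrA -exprSr -iterSr.
Qed.

(** Complex conjugation, which exchanges [dz] and [dzb]. *)
Definition cconj (F : cfield) : cfield := (F.1, fun x => -1 * F.2 x).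

Lemma dz_cconj F : csmooth F -> dz (cconj F) = cconj (dzb F).
Proof.
case: F => F G [/= sF sG]; rewrite /dz /dzb /cconj /=.
rewrite (partialZ 0 (-1) sG) (partialZ 1 (-1) sG).
by congr pair; apply/funext => x; ring.
Qed.

Lemma dzb_cconj F : csmooth F -> dzb (cconj F) = cconj (dz F).
Proof.
case: F => F G [/= sF sG]; rewrite /dz /dzb /cconj /=.
rewrite (partialZ 0 (-1) sG) (partialZ 1 (-1) sG).
by congr pair; apply/funext => x; ring.
Qed.

(** The Poincare lemma in complex form: the integrability condition of
    [dz t = s1], [dzb t = s0] is [dzb s1 = dz s0]. *)
Lemma complex_poincare (s0 s1 : cfield) : csmooth s0 -> csmooth s1 ->
  dzb s1 = dz s0 -> exists2 t, csmooth t & dz t = s1 /\ dzb t = s0.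
Proof.
case: s0 s1 => a0 b0 [a1 b1] [/= sa0 sb0] [/= sa1 sb1].
rewrite /dz /dzb /= => -[E1 E2].
have e1 x : partial 0 a1 x - partial 1 b1 x = partial 0 a0 x + partial 1 b0 x.
  have := congr1 (fun h => 2 * h x) E1; rewrite !mulrA divff // !mul1r mulN1r.
  by [].
have e2 x : partial 0 b1 x + partial 1 a1 x = partial 0 b0 x - partial 1 a0 x.
  have := congr1 (fun h => 2 * h x) E2; rewrite !mulrA divff // !mul1r mulN1r.
  by [].
have nb h : smooth h -> smooth (fun x => -1 * h x) by exact: smoothZ.
have [| |  |t1 [st1 t10 t11]] := @poincare (fun x => a1 x + a0 x) (fun x => b0 x + -1 * b1 x).
- exact: smoothD sa1 sa0.
- exact: smoothD sb0 (nb _ sb1).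
- rewrite (partialD _ sa1 sa0) (partialD _ sb0 (nb _ sb1)) (partialZ _ _ sb1).
  apply/funext => x; have := e2 x.
  set p := partial 0 b1 x; set q := partial 1 a1 x; set r := partial 0 b0 x.
  by set s := partial 1 a0 x => h; lra.
have [| |  |t2 [st2 t20 t21]] := @poincare (fun x => b1 x + b0 x) (fun x => a1 x + -1 * a0 x).
- exact: smoothD sb1 sb0.
- exact: smoothD sa1 (nb _ sa0).
- rewrite (partialD _ sb1 sb0) (partialD _ sa1 (nb _ sa0)) (partialZ _ _ sa0).
  apply/funext => x; have := e1 x.
  set p := partial 0 a1 x; set q := partial 1 b1 x; set r := partial 0 a0 x.
  by set s := partial 1 b0 x => h; lra.
exists (t1, t2); first exact: (conj st1 st2).
by rewrite /= t10 t11 t20 t21; split; congr pair; apply/funext => x; field.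
Qed.

(** Properties of functions that are stable under linear combinations. *)
Definition lin_closed (Q : ('rV[R]_2 -> R) -> Prop) : Prop :=
  forall (a : R) h w, Q h -> Q w -> Q (fun x => a * h x + w x).

(** If [s 0, ..., s n] satisfy [dzb s_(k+1) = dz s_k], they are the derivatives
    [dz ^ k dzb ^ (n - k) F] of one function [F]: integrate consecutive pairs to
    get a family of the same kind with [n] members, and repeat. As the operators
    [dz ^ k dzb ^ (n - k)] span the derivatives of order [n], a linear property
    [Q] of the family holds for all partial derivatives of order [n] of [F]. *)
Lemma integrate_family n (s : nat -> cfield) (Q : ('rV[R]_2 -> R) -> Prop) :
  lin_closed Q ->
  (forall k, (k <= n)%N -> csmooth (s k) /\ Q (s k).1 /\ Q (s k).2) ->
  (forall k, (k < n)%N -> dzb (s k.+1) = dz (s k)) ->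
  exists F, [/\ csmooth F,
    forall k, (k <= n)%N -> iter k dz (iter (n - k) dzb F) = s k &
    forall sq, size sq = n -> Q (partials sq F.1) /\ Q (partials sq F.2)].
Proof.
elim: n s Q => [|n IH] s Q linQ Hs closed.
  exists (s 0%N); have [c0 q0] := Hs 0%N (leqnn _); split=> // [k|sq /size0nil -> //].
  by rewrite leqn0 => /eqP ->.
have /choice[t Ht] : forall k, exists t : cfield,
    (k <= n)%N -> [/\ csmooth t, dz t = s k.+1 & dzb t = s k].
  move=> k; case: (leqP k n) => kn; last by exists (s 0%N).
  have [c0 _] := Hs k (leqW kn); have [c1 _] := Hs k.+1 kn.
  by have [t ct [t1 t2]] := complex_poincare c0 c1 (closed k kn); exists t.
(* The property carried by the shorter family: the derivatives have Q. *)
pose Q' h := [/\ smooth h, Q (partial 0 h) & Q (partial 1 h)].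
have linQ' : lin_closed Q'.
  move=> a h h' [sh h0 h1] [sk k0 k1]; split; first exact: smooth_lin.
    rewrite partial_lin; first exact: linQ.
      exact: smooth_derivable.
    exact: smooth_derivable.
  rewrite partial_lin; first exact: linQ.
    exact: smooth_derivable.
  exact: smooth_derivable.
have [k kn||F [cF HF QF]] := IH t Q' linQ'.
- have [ct t1 t2] := Ht k kn.
  have [_ [q1 q2]] := Hs k (leqW kn); have [_ [p1 p2]] := Hs k.+1 kn.
  have Q2 h k' : Q h -> Q k' -> Q (fun x => h x + k' x).
    move=> qh qk; rewrite (_ : (fun x => _) = (fun x => 1 * h x + k' x)); first exact: linQ.
    by apply/funext => x; rewrite mul1r.
  have [st1 st2] := ct.
  have e0 : partial 0 (t k).1 = (fun x => (s k.+1).1 x + (s k).1 x).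
    by apply/funext => y; rewrite -t1 -t2 /=; field.
  have e1 : partial 1 (t k).1 = (fun x => -1 * (s k.+1).2 x + (s k).2 x).
    by apply/funext => y; rewrite -t1 -t2 /=; field.
  have e2 : partial 0 (t k).2 = (fun x => (s k.+1).2 x + (s k).2 x).
    by apply/funext => y; rewrite -t1 -t2 /=; field.
  have e3 : partial 1 (t k).2 = (fun x => -1 * (s k).1 x + (s k.+1).1 x).
    by apply/funext => y; rewrite -t1 -t2 /=; field.
  split; first by [].
  split; split=> //; rewrite ?e0 ?e1 ?e2 ?e3; solve [exact: Q2|exact: linQ].
- move=> k kn; have [_ t1 _] := Ht k (ltnW kn); have [_ _ t2] := Ht k.+1 kn.
  by rewrite t1 t2.
exists F; split=> // [[|k]|[//|i sq]].
- rewrite subn0 /= => _; have := HF 0%N (leq0n _); rewrite subn0 /= => ->.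
  by have [_ _ ->] := Ht 0%N (leq0n _).
- move=> kn; rewrite subSS /= HF //.
  by have [_ -> _] := Ht k kn.
- move=> [szq]; have [[_ q0 q1] [_ p0 p1]] := QF sq szq.
  by case: (ord2P i) => ->.
Qed.

End Potentials.

(** * Polyharmonic potentials of Schwartz functions *)

Section PolyharmonicPotential.
Context {R : realType}.
Notation mu := (@lebesgue_measure R).
Notation RM := (measurableTypeR R).
Notation H := (`[0, +oo[%classic : set RM).
Notation twopi := (2 * (pi : R)).
Implicit Types (x y : 'rV[R]_2) (f : 'rV[R]_2 -> R) (p q : R -> R) (n : nat) (t : R).

(** The weights [cos (n t)] and [sin (n t)]. *)
Definition cosn n (t : R) : R := cos (n%:R * t).
Definition sinn n (t : R) : R := sin (n%:R * t).

Lemma is_derive_mulrn n (t : R) : is_derive t 1 (fun t : R => n%:R * t) n%:R.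
Proof. by apply: is_derive_eq; rewrite /GRing.scale /=; ring. Qed.

Lemma is_derive_cosn n t : is_derive t 1 (cosn n) (- n%:R * sinn n t).
Proof.
have D := @is_derive1_comp R cos (fun t => n%:R * t) t _ _
  (is_derive_cos _) (is_derive_mulrn n t).
by apply: (is_derive_eq D); rewrite /sinn; ring.
Qed.

Lemma is_derive_sinn n t : is_derive t 1 (sinn n) (n%:R * cosn n t).
Proof.
have D := @is_derive1_comp R sin (fun t => n%:R * t) t _ _
  (is_derive_sin _) (is_derive_mulrn n t).
by apply: (is_derive_eq D); rewrite /cosn; ring.
Qed.

Lemma angular_cosn n : angular (cosn n).
Proof.
by split=> [|t]; [exact: (is_derive_continuous (is_derive_cosn n))|exact: cos_max].
Qed.

Lemma angular_sinn n : angular (sinn n).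
Proof.
by split=> [|t]; [exact: (is_derive_continuous (is_derive_sinn n))|exact: sin_max].
Qed.

Lemma cosnS n t : cosn n.+1 t = cosn n t * cos t - sinn n t * sin t.
Proof. by rewrite /cosn -natr1 mulrDl mul1r cosD. Qed.

Lemma sinnS n t : sinn n.+1 t = sinn n t * cos t + cosn n t * sin t.
Proof. by rewrite /sinn -natr1 mulrDl mul1r sinD. Qed.

Lemma cosnP n t : cosn n t = cosn n.+1 t * cos t + sinn n.+1 t * sin t.
Proof. by rewrite /cosn /sinn -cosB -natr1 mulrDl mul1r addrK. Qed.

Lemma sinnP n t : sinn n t = sinn n.+1 t * cos t - cosn n.+1 t * sin t.
Proof. by rewrite /cosn /sinn -sinB -natr1 mulrDl mul1r addrK. Qed.

Lemma cossinn_twopi n : cosn n twopi = 1 /\ sinn n twopi = 0.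
Proof.
elim: n => [|n [c s]]; first by rewrite /cosn /sinn !mul0r cos0 sin0.
by rewrite cosnS sinnS c s cos_twopi sin_twopi; split; ring.
Qed.

Lemma integral_cosn n : \int[mu]_(t in `[0, twopi]) cosn n.+1 t = 0.
Proof.
have n0 : n.+1%:R != 0 :> R by rewrite pnatr_eq0.
have D t : is_derive t 1 (fun t => n.+1%:R^-1 * sinn n.+1 t) (cosn n.+1 t).
  by apply: (is_derive_eq (is_deriveZ _ (is_derive_sinn n.+1 t)));
    rewrite /GRing.scale /= mulrA mulVf ?mul1r.
rewrite (fundamental_theorem twopi_gt0 (angular_cosn n.+1).1 D).
by rewrite (cossinn_twopi n.+1).2 /sinn !mulr0 sin0 mulr0 subrr.
Qed.

Lemma integral_sinn n : \int[mu]_(t in `[0, twopi]) sinn n.+1 t = 0.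
Proof.
have n0 : n.+1%:R != 0 :> R by rewrite pnatr_eq0.
have D t : is_derive t 1 (fun t => - n.+1%:R^-1 * cosn n.+1 t) (sinn n.+1 t).
  by apply: (is_derive_eq (is_deriveZ _ (is_derive_cosn n.+1 t)));
    rewrite /GRing.scale /= mulrA mulrNN mulVf ?mul1r.
rewrite (fundamental_theorem twopi_gt0 (angular_sinn n.+1).1 D).
by rewrite (cossinn_twopi n.+1).1 /cosn mulr0 cos0 subrr.
Qed.

(** Ray integrals are linear in the weight, in the form in which the
    product-to-sum formulas use it. *)
Lemma ray_integral_half p q1 q2 (e : R) f x : angular p -> angular q1 -> angular q2 ->
  schwartz f -> (forall t, 2 * p t = q1 t + e * q2 t) ->
  2 * ray_integral p f x = ray_integral q1 f x + e * ray_integral q2 f x.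
Proof.
move=> ap a1 a2 sf E; have sm := schwartz_smooth sf.
have i1 := circle_mean_integrable x a1 sf; have i2 := circle_mean_integrable x a2 sf.
have i3 := circle_mean_integrable x ap sf.
rewrite /ray_integral -!RintegralZl //; try exact: measurable_itv.
rewrite -RintegralD //; last first.
  have := @integrableZl _ _ _ mu H (measurable_itv _) e _ i2.
  by apply: eq_integrable => // t _; rewrite /= EFinM.
apply: eq_Rintegral => r _.
rewrite -(circle_meanZl 2 x r ap.1 sm) addrC -(circle_mean_linl e x r a2.1 a1.1 sm).
by apply: eq_circle_meanl => t; rewrite E addrC.
Qed.

Notation A n f := (ray_integral (cosn n) f).
Notation B n f := (ray_integral (sinn n) f).

Let half_sum (u v a b c d : R) : 2 * u = a + 1 * b -> 2 * v = c + -1 * d ->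
  u + v = 0 -> a + b + (c - d) = 0.
Proof. by move=> *; lra. Qed.

(** The radial relation for the weight [cos ((n + 2) t)], rewritten by the
    product-to-sum formulas: the real part of the recursion [S_rec] below. *)
Lemma ray_cos_relation n f x : schwartz f ->
  A n.+3 (partial 0 f) x + A n.+1 (partial 0 f) x
  + (B n.+3 (partial 1 f) x - B n.+1 (partial 1 f) x) = 0.
Proof.
move=> sf; have s0 := schwartz_partial 0 sf; have s1 := schwartz_partial 1 sf.
have ac := angular_cosn n.+2.
have := ray_integral_radial x ac sf; rewrite integral_cosn mulr0 oppr0 => E.
have E0 := @ray_integral_half (fun t => cosn n.+2 t * cos t) (cosn n.+3) (cosn n.+1) 1
  _ x (angularM ac (@angular_cos R)) (angular_cosn _) (angular_cosn _) s0.
have E1 := @ray_integral_half (fun t => cosn n.+2 t * sin t) (sinn n.+3) (sinn n.+1) (-1)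
  _ x (angularM ac (@angular_sin R)) (angular_sinn _) (angular_sinn _) s1.
apply: half_sum (E0 _) (E1 _) E.
- by move=> t; rewrite (cosnS n.+2) (cosnP n.+1); ring.
- by move=> t; rewrite (sinnS n.+2) (sinnP n.+1); ring.
Qed.

(** The same for [sin ((n + 2) t)], giving the imaginary part. *)
Lemma ray_sin_relation n f x : schwartz f ->
  B n.+3 (partial 0 f) x + B n.+1 (partial 0 f) x
  + (A n.+1 (partial 1 f) x - A n.+3 (partial 1 f) x) = 0.
Proof.
move=> sf; have s0 := schwartz_partial 0 sf; have s1 := schwartz_partial 1 sf.
have as_ := angular_sinn n.+2.
have := ray_integral_radial x as_ sf; rewrite integral_sinn mulr0 oppr0 => E.
have E0 := @ray_integral_half (fun t => sinn n.+2 t * cos t) (sinn n.+3) (sinn n.+1) 1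
  _ x (angularM as_ (@angular_cos R)) (angular_sinn _) (angular_sinn _) s0.
have E1 := @ray_integral_half (fun t => sinn n.+2 t * sin t) (cosn n.+1) (cosn n.+3) (-1)
  _ x (angularM as_ (@angular_sin R)) (angular_cosn _) (angular_cosn _) s1.
apply: half_sum (E0 _) (E1 _) E.
- by move=> t; rewrite (sinnS n.+2) (sinnP n.+1); ring.
- by move=> t; rewrite (cosnS n.+2) (cosnP n.+1); ring.
Qed.

(** The two relations at frequency 1, where the ray integrals are, up to sign,
    the first derivatives of the convolution of [f] with the logarithm. *)
Lemma ray_div1 f x : schwartz f ->
  A 1 (partial 0 f) x + B 1 (partial 1 f) x = - (twopi * f x).
Proof.
move=> sf; have E := ray_integral_radial x (@angular1 R) sf.
have wc : cosn 1 = (fun t => 1 * cos t) by apply/funext => t; rewrite /cosn !mul1r.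
have ws : sinn 1 = (fun t => 1 * sin t) by apply/funext => t; rewrite /sinn !mul1r.
rewrite wc ws; apply: etrans E _.
rewrite segment_integral_cst; last exact: ltW twopi_gt0.
by rewrite subr0 mul1r mulrC.
Qed.

Lemma ray_curl1 f x : schwartz f -> B 1 (partial 0 f) x = A 1 (partial 1 f) x.
Proof.
move=> sf; have E := ray_integral_curl x sf.
have wc : cosn 1 = cos by apply/funext => t; rewrite /cosn mul1r.
have ws : sinn 1 = sin by apply/funext => t; rewrite /sinn mul1r.
by rewrite wc ws; exact: E.
Qed.

(** The decaying field [dz ^ k dzb ^ (- k - 1) f]: up to the constant
    [- (-1) ^ k / pi], the ray integral of [f] with the complex weight
    [exp (- i (2 k + 1) t)]. The exponents are justified by [dzb S_0 = f] and
    [dzb S_(k+1) = dz S_k], proved in [S_0] and [S_rec]. *)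
Let S f k : @cfield R :=
  (fun x => (- (-1) ^+ k / pi) * A k.*2.+1 f x,
   fun x => ((-1) ^+ k / pi) * B k.*2.+1 f x).

Let sA n f : schwartz f -> smooth (A n f).
Proof. move=> sf; exact (@smooth_ray_integral R _ _ (angular_cosn n) sf). Qed.

Let sB n f : schwartz f -> smooth (B n f).
Proof. move=> sf; exact (@smooth_ray_integral R _ _ (angular_sinn n) sf). Qed.

Let pA n i f : schwartz f -> partial i (A n f) = A n (partial i f).
Proof.
by move=> sf; apply/funext => x; exact: (partial_ray_integral i x (angular_cosn n) sf).
Qed.

Let pB n i f : schwartz f -> partial i (B n f) = B n (partial i f).
Proof.
by move=> sf; apply/funext => x; exact: (partial_ray_integral i x (angular_sinn n) sf).
Qed.

Let pi_neq0 : pi != 0 :> R.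
Proof. by rewrite gt_eqF // pi_gt0. Qed.

Let pcA (c : R) n i f : schwartz f ->
  partial i (fun x => c * A n f x) = (fun x => c * A n (partial i f) x).
Proof. by move=> sf; rewrite (partialZ i c (@sA n f sf)) (pA n i sf). Qed.

Let pcB (c : R) n i f : schwartz f ->
  partial i (fun x => c * B n f x) = (fun x => c * B n (partial i f) x).
Proof. by move=> sf; rewrite (partialZ i c (@sB n f sf)) (pB n i sf). Qed.

Let dzE (F : @cfield R) a b c d : partial 0 F.1 = a -> partial 1 F.2 = b ->
  partial 0 F.2 = c -> partial 1 F.1 = d ->
  dz F = (fun x => 2^-1 * (a x + b x), fun x => 2^-1 * (c x + -1 * d x)).
Proof. by move=> <- <- <- <-. Qed.

Let dzbE (F : @cfield R) a b c d : partial 0 F.1 = a -> partial 1 F.2 = b ->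
  partial 0 F.2 = c -> partial 1 F.1 = d ->
  dzb F = (fun x => 2^-1 * (a x + -1 * b x), fun x => 2^-1 * (c x + d x)).
Proof. by move=> <- <- <- <-. Qed.

Let alg_rec (e p a1 a2 b1 b2 : R) : a1 + a2 + (b1 - b2) = 0 ->
  2^-1 * ((- (-1 * e) / p) * a1 + -1 * ((-1 * e) / p * b1)) =
  2^-1 * ((- e / p) * a2 + e / p * b2).
Proof. by move=> h; have -> : a1 = - a2 - (b1 - b2) by [lra]; ring. Qed.

Let alg_rec' (e p a1 a2 b1 b2 : R) : b1 + b2 + (a2 - a1) = 0 ->
  2^-1 * ((-1 * e) / p * b1 + (- (-1 * e) / p) * a1) =
  2^-1 * (e / p * b2 + -1 * ((- e / p) * a2)).
Proof. by move=> h; have -> : b1 = - b2 - (a2 - a1) by [lra]; ring. Qed.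

Let S_rec f k : schwartz f -> dzb (S f k.+1) = dz (S f k).
Proof.
move=> sf.
have E1 := @dzbE (S f k.+1) _ _ _ _ (pcA _ _ 0 sf) (pcB _ _ 1 sf) (pcB _ _ 0 sf) (pcA _ _ 1 sf).
have E2 := @dzE (S f k) _ _ _ _ (pcA _ _ 0 sf) (pcB _ _ 1 sf) (pcB _ _ 0 sf) (pcA _ _ 1 sf).
apply: (etrans E1); apply: (etrans _ (esym E2)).
congr pair; apply/funext => x; rewrite exprS.
  exact: (alg_rec _ _ (ray_cos_relation k.*2 x sf)).
exact: (alg_rec' _ _ (ray_sin_relation k.*2 x sf)).
Qed.

Let alg0 (p a b v : R) : p != 0 -> a + b = - (2 * p * v) ->
  2^-1 * ((- 1 / p) * a + -1 * (1 / p * b)) = v.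
Proof. by move=> p0 h; have -> : a = - (2 * p * v) - b by [lra]; field. Qed.

Let alg0' (p a b : R) : b = a -> 2^-1 * (1 / p * b + (- 1 / p) * a) = 0.
Proof. by move=> ->; ring. Qed.

Let S_0 f : schwartz f -> dzb (S f 0) = (f, fun=> 0).
Proof.
move=> sf.
have E := @dzbE (S f 0) _ _ _ _ (pcA _ _ 0 sf) (pcB _ _ 1 sf) (pcB _ _ 0 sf) (pcA _ _ 1 sf).
apply: (etrans E); rewrite expr0; congr pair; apply/funext => x.
  exact: (alg0 pi_neq0 (ray_div1 x sf)).
exact: (alg0' _ (ray_curl1 x sf)).
Qed.

(** Functions that are [O (1 / (1 + |x|))]. *)
Definition decaying (h : 'rV[R]_2 -> R) : Prop :=
  exists C : R, forall x, `|h x| <= C * (1 + enorm x)^-1.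

Lemma decaying_lin : @lin_closed R decaying.
Proof.
move=> a h w [C HC] [D HD]; exists (`|a| * C + D) => x.
apply: le_trans (ler_normD _ _) _; rewrite mulrDl; apply: lerD; last exact: HD.
by rewrite normrM -mulrA ler_wpM2l.
Qed.

Lemma decayingZ (a : R) h : decaying h -> decaying (fun x => a * h x).
Proof.
move=> dh; have -> : (fun x => a * h x) = (fun x => (a - 1) * h x + h x).
  by apply/funext => x; ring.
exact: decaying_lin.
Qed.

Lemma decayingD h w : decaying h -> decaying w -> decaying (fun x => h x + w x).
Proof.
move=> dh dw; have -> : (fun x => h x + w x) = (fun x => 1 * h x + w x).
  by apply/funext => x; rewrite mul1r.
exact: decaying_lin.
Qed.

Let S_prop f k : schwartz f ->
  csmooth (S f k) /\ decaying (S f k).1 /\ decaying (S f k).2.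
Proof.
move=> sf; split.
  split; apply: smoothZ; [exact (@sA _ f sf)|exact (@sB _ f sf)].
split; apply: decayingZ.
  exact: ray_integral_decay (angular_cosn _) sf.
exact: ray_integral_decay (angular_sinn _) sf.
Qed.

(** The equation [lap ^ (m + 1) F = f] has a smooth solution whose partial
    derivatives of order [2 m + 1] all decay like [1 / (1 + |x|)]. These
    derivatives are prescribed to be the conjugates of [S_m, ..., S_0] followed
    by [S_0, ..., S_m]; in the middle the family is closed because [dzb S_0] and
    [dz] of the conjugate of [S_0] are both [f], as [f] is real. *)
Lemma polyharmonic_potential m f : schwartz f -> exists F : 'rV[R]_2 -> R,
  [/\ smooth F, iter m.+1 laplacian F = f &
   forall s : seq 'I_2, size s = m.*2.+1 -> decaying (partials s F)].
Proof.
move=> sf.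
pose s k := if (k <= m)%N then cconj (S f (m - k)) else S f (k - m.+1).
have Hs k : (k <= m.*2.+1)%N -> csmooth (s k) /\ decaying (s k).1 /\ decaying (s k).2.
  move=> _; rewrite /s; case: ifP => _; last exact: S_prop.
  have [[s1 s2] [d1 d2]] := S_prop (m - k) sf.
  split; first by split; [exact: s1|exact: smoothZ s2].
  by split; [exact: d1|exact: decayingZ d2].
have cS k := (S_prop k sf).1.
have mid : dz (cconj (S f 0)) = (f, fun=> 0).
  rewrite (dz_cconj (cS 0%N)) (S_0 sf) /cconj /=.
  by congr pair; apply/funext => x; rewrite mulr0.
have closed k : (k < m.*2.+1)%N -> dzb (s k.+1) = dz (s k).
  move=> _; rewrite /s; case: (ltngtP k m) => km.
  - have -> : (m - k = (m - k.+1).+1)%N by rewrite subnSK.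
    by rewrite (dzb_cconj (cS _)) (dz_cconj (cS _)) (S_rec _ sf).
  - by rewrite subSS -(subnSK km) (S_rec _ sf).
  - by rewrite km !subnn (S_0 sf) mid.
have [F [cF HF decF]] := integrate_family decaying_lin Hs closed.
have E := iter_dz_dzb m.+1 cF.
rewrite iterS in E.
have Em := HF m (leqW (leq_trans (leq_addr m m) _)).
rewrite addnn in Em; have {}Em := Em (leqnn _).
have nm : (m.*2.+1 - m = m.+1)%N by rewrite -addnn -addnS addKn.
rewrite nm in Em.
move: E; rewrite Em /s leqnn subnn mid => -[E _].
exists (fun x => 4^-1 ^+ m.+1 * F.1 x); split.
- exact: smoothZ cF.1.
- by rewrite (iter_laplacianZ _ _ cF.1) -E.
- move=> sq szq; rewrite (partialsZ _ _ cF.1); apply: decayingZ.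
  exact: (decF sq szq).1.
Qed.

End PolyharmonicPotential.

(** * Additive maps defined on monomials *)

Section PolySum.
Variables (T : nzRingType) (V : zmodType).
Implicit Types (g : nat -> T -> V) (p q : {poly T}).

(** The additive map sending [c * 'X^i] to [g i c]. *)
Definition psum g p : V := \sum_(i < size p) g i p`_i.

Lemma psum_widen g p n : (forall i, g i 0 = 0) -> (size p <= n)%N ->
  psum g p = \sum_(i < n) g i p`_i.
Proof.
move=> g0 pn; rewrite /psum (big_ord_widen n (fun i => g i p`_i) pn) big_mkcond.
apply: eq_bigr => i _; case: ltnP => // pi.
by rewrite nth_default.
Qed.

Lemma psumD g p q : (forall i, g i 0 = 0) ->
  (forall i, {morph g i : a b / a + b >-> a + b}) ->
  psum g (p + q) = psum g p + psum g q.
Proof.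
move=> g0 gD; pose n := maxn (size p) (size q).
rewrite (psum_widen g0 (leq_maxl _ _ : (size p <= n)%N)).
rewrite (psum_widen g0 (leq_maxr _ _ : (size q <= n)%N)).
rewrite (psum_widen g0 (size_polyD _ _ : (size (p + q)%R <= n)%N)).
by rewrite -big_split; apply: eq_bigr => i _; rewrite /= coefD gD.
Qed.

Lemma psumXl g p : (forall i, g i 0 = 0) ->
  psum g ('X * p) = psum (fun i => g i.+1) p.
Proof.
move=> g0; have [->|p0] := eqVneq p 0.
  by rewrite mulr0 /psum size_poly0 !big_ord0.
rewrite /psum -commr_polyX size_mulX // big_ord_recl coefMX eqxx g0 add0r.
by apply: eq_bigr => i _; rewrite coefMX.
Qed.

Lemma psumCl g p c : (forall i, g i 0 = 0) ->
  psum g (c%:P * p) = psum (fun i a => g i (c * a)) p.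
Proof.
move=> g0; rewrite (@psum_widen g _ (size p)) //.
  by apply: eq_bigr => i _; rewrite coefCM.
apply: leq_trans (size_polyMleq _ _) _.
by rewrite size_polyC; case: eqP => _ /=; rewrite ?addn0 // ?leq_pred.
Qed.

Lemma psum0 g : psum g 0 = 0.
Proof. by rewrite /psum size_poly0 big_ord0. Qed.

Lemma psum_Xn g n : (forall i, g i 0 = 0) -> psum g 'X^n = g n 1.
Proof.
move=> g0; rewrite /psum size_polyXn big_ord_recr /= coefXn eqxx big1 ?add0r //.
by move=> i _; rewrite coefXn ltn_eqF.
Qed.

Lemma psum1 g : (forall i, g i 0 = 0) -> psum g 1 = g 0%N 1.
Proof. by move=> g0; have := psum_Xn 0 g0; rewrite expr0. Qed.

Lemma eq_psum g g' p : (forall i a, g i a = g' i a) -> psum g p = psum g' p.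
Proof. by move=> E; apply: eq_bigr => i _; exact: E. Qed.

End PolySum.

(** * Differential operators as polynomials *)

Section SymbolCalculus.
Context {R : realType}.
Implicit Types (x : 'rV[R]_2).

(** Constant-coefficient differential expressions in unknown functions
    [F 0, F 1, ...], as polynomials over [R]: the innermost and the middle
    variable stand for the derivatives [d1] and [d0], and the [k]-th power of the
    outermost variable for the unknown [F k]. Only expressions linear in the
    unknowns are represented: a product of two powers of the outermost variable
    does not stand for a product of unknowns. *)
Definition symbol : Type := {poly {poly {poly R}}}.

(** The symbols of [d0], of [d1] and of the unknown [F k]. *)
Definition sX : symbol := 'X%:P.
Definition sY : symbol := 'X%:P%:P.
Definition sZ (k : nat) : symbol := 'X^k.

Variable F : nat -> 'rV[R]_2 -> R.
Hypothesis sF : forall k, smooth (F k).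

(** The monomials: [i] derivatives in direction 0 and [j] in direction 1 of the
    [k]-th unknown. *)
Let d i j k : 'rV[R]_2 -> R := iter i (partial 0) (iter j (partial 1) (F k)).

Let sd i j k : smooth (d i j k).
Proof.
have s1 : smooth (iter j (partial 1) (F k)).
  by elim: j => [|j IH]; [exact: sF|exact: smooth_partial IH].
by rewrite /d; elim: i => [|i IH]; [exact: s1|exact: smooth_partial IH].
Qed.

Let d0 i j k : partial 0 (d i j k) = d i.+1 j k.
Proof. by []. Qed.

Let d1 i j k : partial 1 (d i j k) = d i j.+1 k.
Proof.
elim: i => [//|i IH].
by rewrite -[d i.+1 j k]d0 (partialC 1 0 (sd i j k)) IH.
Qed.

(** The function denoted by a symbol. *)
Definition sact (p : symbol) x : R :=
  psum (fun k => psum (fun i => psum (fun j a => a * d i j k x))) p.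

Let in0 x i k (j : nat) : (0 : R) * d i j k x = 0.
Proof. exact: mul0r. Qed.

Let inD x i k (j : nat) : {morph (fun a : R => a * d i j k x) : a b / a + b}.
Proof. by move=> a b; exact: mulrDl. Qed.

Let in1 x k (i : nat) : psum (fun j a => a * d i j k x) (0 : {poly R}) = 0.
Proof. exact: psum0. Qed.

Let in1D x k (i : nat) :
  {morph (psum (fun j a => a * d i j k x) : {poly R} -> R) : a b / a + b}.
Proof. by move=> a b; apply: psumD => *; [exact: in0|exact: inD]. Qed.

Let in2 x (k : nat) :
  psum (fun i => psum (fun j a => a * d i j k x)) (0 : {poly {poly R}}) = 0.
Proof. exact: psum0. Qed.

Let in2D x (k : nat) :
  {morph (psum (fun i => psum (fun j a => a * d i j k x)) : {poly {poly R}} -> R) :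
     a b / a + b}.
Proof. by move=> a b; apply: psumD => *; [exact: in1|exact: in1D]. Qed.

Lemma sactD p q x : sact (p + q) x = sact p x + sact q x.
Proof. by apply: psumD => *; [exact: in2|exact: in2D]. Qed.

Lemma sact0 x : sact 0 x = 0.
Proof. exact: psum0. Qed.

Lemma sactN p x : sact (- p) x = - sact p x.
Proof. by apply/eqP; rewrite -addr_eq0 -sactD addNr sact0. Qed.

Lemma sactB p q x : sact (p - q) x = sact p x - sact q x.
Proof. by rewrite sactD sactN. Qed.

Lemma sact_nat n p x : sact (n%:R * p) x = n%:R * sact p x.
Proof.
elim: n => [|n IH]; first by rewrite !mul0r sact0.
by rewrite -!natr1 !mulrDl !mul1r sactD IH.
Qed.

Lemma sactZ k x : sact (sZ k) x = F k x.
Proof.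
rewrite /sact psum_Xn; last exact: in2.
rewrite psum1; last exact: in1.
by rewrite psum1 ?mul1r //; exact: in0.
Qed.

Lemma smooth_sact p : smooth (sact p).
Proof.
by apply: smooth_sum => k; apply: smooth_sum => i; apply: smooth_sum => j;
  apply: smoothZ; exact: sd.
Qed.

Let partial_sact (l : 'I_2) p x : partial l (sact p) x =
  psum (fun k => psum (fun i => psum (fun j a => a * partial l (d i j k) x))) p.
Proof.
have s1 k i j (a : R) : smooth (fun x => a * d i j k x) by apply: smoothZ; exact: sd.
have s2 k i (q : {poly R}) : smooth (fun x => psum (fun j a => a * d i j k x) q).
  by apply: smooth_sum => j; exact: s1.
have s3 k (q : {poly {poly R}}) :
    smooth (fun x => psum (fun i => psum (fun j a => a * d i j k x)) q).
  by apply: smooth_sum => i; exact: s2.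
rewrite /sact {1}/psum (partial_sum l _ (fun k : 'I_(size p) => s3 k p`_k)).
apply: eq_bigr => k _; rewrite {1}/psum (partial_sum l _ (fun i : 'I_(size p`_k) => s2 k i p`_k`_i)).
apply: eq_bigr => i _; rewrite {1}/psum (partial_sum l _ (fun j : 'I_(size p`_k`_i) => s1 k i j p`_k`_i`_j)).
by apply: eq_bigr => j _; rewrite (partialZ l _ (sd i j k)).
Qed.

Lemma partial0_sact p x : partial 0 (sact p) x = sact (sX * p) x.
Proof.
rewrite partial_sact /sact psumCl; last exact: in2.
by apply: eq_psum => k q; rewrite psumXl //; exact: in1.
Qed.

Lemma partial1_sact p x : partial 1 (sact p) x = sact (sY * p) x.
Proof.
rewrite partial_sact /sact psumCl; last exact: in2.
apply: eq_psum => k q; rewrite psumCl; last exact: in1.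
apply: eq_psum => i r; rewrite psumXl; last by move=> j; exact: in0.
by apply: eq_psum => j a; rewrite d1.
Qed.

End SymbolCalculus.
Arguments symbol R : clear implicits.

(** * Polynomial identities behind the decomposition *)

Section SymbolIdentities.
Variables (T : comNzRingType) (X Y : T) (Z : nat -> T).
Implicit Types (i j k l a b c d : 'I_2).

(** The symbols of the gradient and of the rotated gradient [(- d1, d0)]. *)
Definition sder i : T := if i == 0 then X else Y.
Definition seta i : T := if i == 0 then - Y else X.

(** The position of an unordered pair of indices among 00, 01, 11. *)
Definition pair_index a b : nat :=
  if a == 0 then (if b == 0 then 0%N else 1%N) else (if b == 0 then 1%N else 2%N).

(** The position of a component of an elastic 2-tensor among the six independent
    ones, 0000, 0001, 0011, 0101, 0111, 1111: an unordered pair of unordered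
    pairs of indices. *)
Definition elastic_index a b c d : nat :=
  match pair_index a b, pair_index c d with
  | 0%N, 0%N => 0%N
  | 0%N, 1%N | 1%N, 0%N => 1%N
  | 0%N, _ | _, 0%N => 2%N
  | 1%N, 1%N => 3%N
  | 1%N, _ | _, 1%N => 4%N
  | _, _ => 5%N
  end.

(** A generic elastic 2-tensor. *)
Let F a b c d := Z (elastic_index a b c d).

Definition sum4 (G : 'I_2 -> 'I_2 -> 'I_2 -> 'I_2 -> T) : T :=
  \sum_(a < 2) \sum_(b < 2) \sum_(c < 2) \sum_(d < 2) G a b c d.

(** The symbol of the Laplacian. *)
Definition slap (p : T) : T := X * (X * p) + Y * (Y * p).

Lemma slap_mull (c p : T) : slap (c * p) = c * slap p.
Proof. by rewrite /slap; ring. Qed.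

(** Full contractions of [F] with gradients ([d]) and rotated gradients ([e]),
    the letters of the name giving the operator contracted with each index. *)
Definition contr_dddd : T :=
  sum4 (fun a b c d => sder a * (sder b * (sder c * (sder d * F a b c d)))).
Definition contr_ddee : T :=
  sum4 (fun a b c d => sder a * (sder b * (seta c * (seta d * F a b c d)))).
Definition contr_ddde : T :=
  sum4 (fun a b c d => sder a * (sder b * (sder c * (seta d * F a b c d)))).
Definition contr_eede : T :=
  sum4 (fun a b c d => seta a * (seta b * (sder c * (seta d * F a b c d)))).
Definition contr_dede : T :=
  sum4 (fun a b c d => sder a * (seta b * (sder c * (seta d * F a b c d)))).
Definition contr_eeee : T :=
  sum4 (fun a b c d => seta a * (seta b * (seta c * (seta d * F a b c d)))).

(** The parts of the decomposition of the tensor [lap ^ 4 F]. *)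
Definition sol_v i j : T :=
  sder i * (sder j * contr_dddd) + 2%:R * (seta i * (seta j * contr_ddee))
  + 2%:R * (sder i * (seta j * (contr_ddde - contr_eede))
            + seta i * (sder j * (contr_ddde - contr_eede))).
Definition sol_u i : T := 4%:R * (seta i * slap contr_eede).
Definition sol_g i j k l : T :=
  seta i * (seta j * (seta k * (seta l * contr_eeee)))
  + (sder i * seta j + seta i * sder j) * (sder k * seta l + seta k * sder l) * contr_dede.

(** The symbol of [4 (H v + K u)]. *)
Definition sym_HK (u : 'I_2 -> T) (v : 'I_2 -> 'I_2 -> T) i j k l : T :=
  2%:R * (sder i * (sder j * v k l) + sder k * (sder l * v i j))
  + (k == l)%:R * (sder i * u j + sder j * u i)
  + (i == j)%:R * (sder l * u k + sder k * u l).

(** Four times the decomposition [lap ^ 4 F = H v + K u + g]. *)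
Lemma solution_identity i j k l :
  4%:R * slap (slap (slap (slap (F i j k l)))) =
  sym_HK sol_u sol_v i j k l + 4%:R * sol_g i j k l.
Proof.
rewrite /sym_HK /sol_v /sol_u /sol_g /contr_dddd /contr_ddee /contr_ddde /contr_eede
  /contr_dede /contr_eeee /sum4 !sum2 /slap /F /elastic_index /pair_index /sder /seta /=.
by case: (ord2P i) => ->; case: (ord2P j) => ->; case: (ord2P k) => ->;
  case: (ord2P l) => -> /=; ring.
Qed.

Lemma sol_g_elastic i j k l :
  [/\ sol_g i j k l = sol_g j i k l, sol_g i j k l = sol_g i j l k
    & sol_g i j k l = sol_g k l i j].
Proof. by rewrite /sol_g; split; ring. Qed.

Lemma sol_v_sym i j : sol_v i j = sol_v j i.
Proof. by rewrite /sol_v; ring. Qed.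

(** [K* g = 0], up to sign: in each term of [g] the contractions pair some
    gradient with a rotated gradient. *)
Lemma sol_g_div i : \sum_(j < 2) \sum_(k < 2) sder j * sol_g i j k k = 0.
Proof.
rewrite !sum2 /sol_g /sder /seta /=.
move: contr_eeee contr_dede => p q; case: (i == 0); ring.
Qed.

(** [H* g = 0], for the same reason. *)
Lemma sol_g_divdiv i j :
  \sum_(k < 2) \sum_(l < 2) sder k * (sder l * sol_g i j k l) = 0.
Proof.
rewrite !sum2 /sol_g /sder /seta /=.
by move: contr_eeee contr_dede => p q; case: (i == 0); case: (j == 0); ring.
Qed.

(** A generic vector field [u] and symmetric tensor [v], with independent
    components numbered 0 to 4, the symbol of [w = 4 (H v + K u)], and the
    symbols of [- K* w] and [H* w]. *)
Definition gen_u i : T := Z (if i == 0 then 0 else 1).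
Definition gen_v i j : T := Z (pair_index i j).+2.

Definition gen_w := sym_HK gen_u gen_v.
Definition gen_div i : T := \sum_(j < 2) \sum_(k < 2) sder j * gen_w i j k k.
Definition gen_divdiv i j : T :=
  \sum_(k < 2) \sum_(l < 2) sder k * (sder l * gen_w i j k l).

(** Different pairs [(u, v)] may have the same [H v + K u]. Replacing them by
    [2 u + grad (tr v)] and [2 v - (tr v) delta] fixes the trace of [v] to zero
    and leaves [H v + K u] unchanged up to the factor 2, see [gauge_HK]. *)
Definition gauge_u i : T := 2%:R * gen_u i + sder i * (gen_v 0 0 + gen_v 1 1).
Definition gauge_v i j : T := 2%:R * gen_v i j - (i == j)%:R * (gen_v 0 0 + gen_v 1 1).

Definition sum22 (G : 'I_2 -> 'I_2 -> T) : T := \sum_(a < 2) \sum_(b < 2) G a b.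

(** The third power of the Laplacian of the gauge-fixed [u] is a combination of
    derivatives of [K* w] and [H* w]. *)
Lemma gauge_u_elliptic i :
  4%:R * slap (slap (slap (gauge_u i))) =
  sder i * (sum22 (fun a b => sder a * (sder b * gen_divdiv a b))
            + 2%:R * sum22 (fun a b => seta a * (seta b * gen_divdiv a b)))
  + 8%:R * (seta i * (slap (\sum_(a < 2) seta a * gen_div a)
                      - sum22 (fun a b => sder a * (seta b * gen_divdiv a b)))).
Proof.
rewrite /slap /gauge_u /sum22 /gen_div /gen_divdiv /gen_w /sym_HK !sum2
  /gen_u /gen_v /pair_index /sder /seta /=.
by case: (ord2P i) => -> /=; ring.
Qed.

(** The same for the gauge-fixed [v] and the fourth power of the Laplacian. *)
Lemma gauge_v_elliptic i j :
  4%:R * slap (slap (slap (slap (gauge_v i j)))) =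
  sder i * (sder j * (sum22 (fun a b => sder a * (sder b * gen_divdiv a b))
            - 2%:R * sum22 (fun a b => seta a * (seta b * gen_divdiv a b))))
  - seta i * (seta j * (sum22 (fun a b => sder a * (sder b * gen_divdiv a b))
            - 2%:R * sum22 (fun a b => seta a * (seta b * gen_divdiv a b))))
  + 4%:R * (sder i * (seta j * (2%:R * sum22 (fun a b => sder a * (seta b * gen_divdiv a b))
                                - slap (\sum_(a < 2) seta a * gen_div a)))
            + seta i * (sder j * (2%:R * sum22 (fun a b => sder a * (seta b * gen_divdiv a b))
                                - slap (\sum_(a < 2) seta a * gen_div a)))).
Proof.
rewrite /slap /gauge_v /sum22 /gen_div /gen_divdiv /gen_w /sym_HK !sum2
  /gen_u /gen_v /pair_index /sder /seta /=.
by case: (ord2P i) => ->; case: (ord2P j) => -> /=; ring.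
Qed.

Lemma gauge_HK i j k l : 2%:R * gen_w i j k l = sym_HK gauge_u gauge_v i j k l.
Proof.
rewrite /gen_w /sym_HK /gauge_u /gauge_v.
move: (gen_v 0 0 + gen_v 1 1) => t; ring.
Qed.

End SymbolIdentities.

(** * Vanishing and decay under differential operators *)

Section SymbolAction.
Context {R : realType}.
Variable F : nat -> 'rV[R]_2 -> R.
Hypothesis sF : forall k, smooth (F k).
Notation D := (sder (@sX R) (@sY R)).
Notation E := (seta (@sX R) (@sY R)).
Notation lap := (slap (@sX R) (@sY R)).
Notation L := (sact F).
Implicit Types (p q : symbol R) (x : 'rV[R]_2).

Lemma partial_sactE i p : partial i (L p) = L (D i * p).
Proof.
apply/funext => x; case: (ord2P i) => ->; rewrite /sder /=.
  exact: partial0_sact.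
exact: partial1_sact.
Qed.

Lemma laplacian_sact p : laplacian (L p) = L (lap p).
Proof.
have E0 := partial_sactE 0 (sX * p); have E1 := partial_sactE 1 (sY * p).
have F0 := partial_sactE 0 p; have F1 := partial_sactE 1 p.
apply/funext => x; rewrite /laplacian F0 F1 /slap sactD.
by congr (_ + _); [exact: (congr1 (@^~ x) E0)|exact: (congr1 (@^~ x) E1)].
Qed.

Lemma sact_sum n (G : 'I_n -> symbol R) x :
  L (\sum_(i < n) G i) x = \sum_(i < n) L (G i) x.
Proof.
elim/big_rec2: _ => [|i u p _ <-]; first exact: sact0.
exact: sactD.
Qed.

(** Symbols that denote the zero function. *)
Definition null p := forall x, L p x = 0.

Lemma nullD p q : null p -> null q -> null (p + q).
Proof. by move=> hp hq x; rewrite sactD hp hq addr0. Qed.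

Lemma nullN p : null p -> null (- p).
Proof. by move=> hp x; rewrite sactN hp oppr0. Qed.

Lemma nullB p q : null p -> null q -> null (p - q).
Proof. by move=> hp hq; apply: nullD => //; exact: nullN. Qed.

Lemma null_nat n p : null p -> null (n%:R * p).
Proof. by move=> hp x; rewrite sact_nat hp mulr0. Qed.

Lemma null_sum n (G : 'I_n -> symbol R) :
  (forall i, null (G i)) -> null (\sum_(i < n) G i).
Proof. by move=> hG x; rewrite sact_sum big1 // => i _; exact: hG. Qed.

Lemma null_der i p : null p -> null (D i * p).
Proof.
move=> hp x; rewrite -partial_sactE.
have -> : L p = fun=> 0 by apply/funext => y; exact: hp.
by rewrite partial_cst.
Qed.

Lemma null_eta i p : null p -> null (E i * p).
Proof.
move=> hp; rewrite /seta; case: (i == 0); last exact: (null_der 0 hp).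
by rewrite mulNr; apply: nullN; exact: (null_der 1 hp).
Qed.

Lemma null_lap p : null p -> null (lap p).
Proof.
move=> hp; apply: nullD; first exact: (null_der 0 (null_der 0 hp)).
exact: (null_der 1 (null_der 1 hp)).
Qed.

(** All partial derivatives of order [n - m] of the function denoted by [p]
    decay: [p] has already absorbed [m] of [n] derivatives. *)
Definition decays n m p :=
  forall s : seq 'I_2, (size s + m)%N = n -> decaying (partials s (L p)).

Lemma decays_der n m i p : decays n m p -> decays n m.+1 (D i * p).
Proof.
move=> dp s sn; rewrite -partial_sactE -partials_rcons; apply: dp.
by rewrite size_rcons addSnnS.
Qed.

Lemma decaysD n m p q : decays n m p -> decays n m q -> decays n m (p + q).
Proof.
move=> dp dq s sn.
have -> : L (p + q) = fun x => 1 * L p x + L q x.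
  by apply/funext => x; rewrite sactD mul1r.
rewrite (partials_lin s 1 (smooth_sact sF p) (smooth_sact sF q)).
exact: decaying_lin (dp s sn) (dq s sn).
Qed.

Lemma decaysN n m p : decays n m p -> decays n m (- p).
Proof.
move=> dp s sn.
have -> : L (- p) = fun x => -1 * L p x.
  by apply/funext => x; rewrite sactN mulN1r.
rewrite (partialsZ s _ (smooth_sact sF p)); exact: decayingZ (dp s sn).
Qed.

Lemma decays_nat n m k p : decays n m p -> decays n m (k%:R * p).
Proof.
move=> dp s sn.
have -> : L (k%:R * p) = fun x => k%:R * L p x.
  by apply/funext => x; rewrite sact_nat.
rewrite (partialsZ s _ (smooth_sact sF p)); exact: decayingZ (dp s sn).
Qed.

Lemma decays_sum2 n m (G : 'I_2 -> symbol R) :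
  (forall i, decays n m (G i)) -> decays n m (\sum_(i < 2) G i).
Proof. by move=> dG; rewrite sum2; apply: decaysD. Qed.

Lemma decays_eta n m i p : decays n m p -> decays n m.+1 (E i * p).
Proof.
move=> dp; rewrite /seta; case: (i == 0); last exact: (decays_der 0 dp).
by rewrite mulNr; apply: decaysN; exact: (decays_der 1 dp).
Qed.

Lemma decays_sum4 n m (G : 'I_2 -> 'I_2 -> 'I_2 -> 'I_2 -> symbol R) :
  (forall a b c d, decays n m (G a b c d)) -> decays n m (sum4 G).
Proof. by move=> dG; do 4 (apply: decays_sum2 => ?). Qed.

Lemma decays_decaying n p : decays n n p -> decaying (L p).
Proof. by move=> /(_ [::]); apply. Qed.

Lemma sact_HK (su : 'I_2 -> symbol R) (sv : 'I_2 -> 'I_2 -> symbol R) i j k l x :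
  L (sym_HK sX sY su sv i j k l) x =
  2%:R * (partial i (partial j (L (sv k l))) x + partial k (partial l (L (sv i j))) x)
  + (k == l)%:R * (partial i (L (su j)) x + partial j (L (su i)) x)
  + (i == j)%:R * (partial l (L (su k)) x + partial k (L (su l)) x).
Proof. by rewrite /sym_HK !(sactD, sact_nat) !partial_sactE. Qed.

End SymbolAction.

(** * Existence of the decomposition *)

Section Existence.
Context {R : realType}.
Notation D := (sder (@sX R) (@sY R)).

(** Finitely many decaying functions share one constant. *)
Lemma uniform_decay (I : finType) (h : I -> 'rV[R]_2 -> R) :
  (forall i, decaying (h i)) ->
  exists2 C : R, 0 <= C & forall i x, `|h i x| <= C * (1 + enorm x)^-1.
Proof.
move=> /choice[C HC]; exists (\sum_i `|C i|) => [|i x]; first exact: sumr_ge0.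
apply: le_trans (HC i x) _; rewrite ler_wpM2r //.
  by rewrite invr_ge0 addr_ge0 // enorm_ge0.
rewrite (bigD1 i) //= (le_trans (ler_norm _)) // lerDl.
exact: sumr_ge0.
Qed.

(** The independent components of an elastic 2-tensor field, in the order of
    [elastic_index]. *)
Definition component (f : 'rV[R]_2 -> tensor4 R 2) (n : nat) : 'rV[R]_2 -> R :=
  match n with
  | 0%N => fun x => f x 0 0 0 0
  | 1%N => fun x => f x 0 0 0 1
  | 2%N => fun x => f x 0 0 1 1
  | 3%N => fun x => f x 0 1 0 1
  | 4%N => fun x => f x 0 1 1 1
  | _ => fun x => f x 1 1 1 1
  end.

Lemma elastic_component f x (i j k l : 'I_2) : elastic2 (f x) ->
  f x i j k l = component f (elastic_index i j k l) x.
Proof.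
move=> ef.
have E1 c d : f x 1 0 c d = f x 0 1 c d by have [] := ef 1 0 c d.
have E2 a b : f x a b 1 0 = f x a b 0 1 by have [] := ef a b 1 0.
have E3 : f x 0 1 0 0 = f x 0 0 0 1 by have [] := ef 0 1 0 0.
have E4 : f x 1 1 0 0 = f x 0 0 1 1 by have [] := ef 1 1 0 0.
have E5 : f x 1 1 0 1 = f x 0 1 1 1 by have [] := ef 1 1 0 1.
by case: (ord2P i) => ->; case: (ord2P j) => ->; case: (ord2P k) => ->;
  case: (ord2P l) => ->; rewrite ?(E1, E2, E3, E4, E5).
Qed.

Lemma elastic_decomposition_exists (f : 'rV[R]_2 -> tensor4 R 2) :
  schwartz_elastic2_field f ->
  exists g u v, elastic_decomposition f g u v.
Proof.
move=> [ef sf].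
have /choice[F HF] : forall n, exists Fn : 'rV[R]_2 -> R,
    [/\ smooth Fn, iter 4 laplacian Fn = component f n &
      forall s : seq 'I_2, size s = 7%N -> decaying (partials s Fn)].
  move=> n; apply: (@polyharmonic_potential R 3).
  by move: n => [|[|[|[|[|n]]]]]; exact: sf.
have sF n : smooth (F n) by have [] := HF n.
pose Z := @sZ R.
pose sv := sol_v sX sY Z; pose su := sol_u sX sY Z; pose sg := sol_g sX sY Z.
pose g x i j k l := sact F (sg i j k l) x.
pose u x : 'rV[R]_2 := \row_i sact F (su i) x.
pose v x : 'M[R]_2 := \matrix_(i, j) sact F (sv i j) x.
have uE i : (fun x => u x 0 i) = sact F (su i) by apply/funext => x; rewrite mxE.
have vE i j : (fun x => v x i j) = sact F (sv i j) by apply/funext => x; rewrite mxE.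
have gE i j k l : (fun x => g x i j k l) = sact F (sg i j k l) by [].
have sm p : smooth (sact F p) by exact: smooth_sact.
have dZ n : decays F 7 0 (Z n).
  move=> s; rewrite addn0 => sz.
  have -> : sact F (Z n) = F n by apply/funext => x; exact: sactZ.
  by have [_ _ H] := HF n; exact: H.
have d4 G : (forall a b c d, decays F 7 4 (G a b c d)) -> decays F 7 4 (sum4 G).
  exact: decays_sum4.
have d_eede : decays F 7 4 (contr_eede sX sY Z).
  apply: d4 => a b c d.
  by do 2 apply: decays_eta => //; apply: decays_der => //; apply: decays_eta.
have du i : decaying (sact F (su i)).
  apply: (decays_decaying (n := 7)); apply: decays_nat => //; apply: decays_eta => //.
  by apply: decaysD => //; [do 2 apply: (decays_der sF 0)|do 2 apply: (decays_der sF 1)].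
have dA : decays F 7 4 (contr_dddd sX sY Z).
  by apply: d4 => a b c d; do 4 apply: (decays_der sF); exact: dZ.
have dB : decays F 7 4 (contr_ddee sX sY Z).
  by apply: d4 => a b c d; do 2 apply: (decays_der sF); do 2 apply: (decays_eta sF); exact: dZ.
have dE : decays F 7 4 (contr_ddde sX sY Z - contr_eede sX sY Z).
  apply: (decaysD sF); last exact: (decaysN sF).
  by apply: d4 => a b c d; do 3 apply: (decays_der sF); apply: (decays_eta sF); exact: dZ.
have dv i j : decays F 7 6 (sv i j).
  apply: (decaysD sF).
    apply: (decaysD sF); first by do 2 apply: (decays_der sF).
    by apply: (decays_nat sF); do 2 apply: (decays_eta sF).
  apply: (decays_nat sF); apply: (decaysD sF).
    by apply: (decays_der sF); apply: (decays_eta sF).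
  by apply: (decays_eta sF); apply: (decays_der sF).
have dvk (t : 'I_2 * ('I_2 * 'I_2)) : decaying (sact F (D t.1 * sv t.2.1 t.2.2)).
  by apply: (decays_decaying (n := 7)); apply: (decays_der sF); exact: dv.
exists g, u, v; split; first split.
- split=> [x i j k l|i j k l]; last exact: sm.
  have [e1 e2 e3] := sol_g_elastic sX sY Z i j k l.
  by rewrite /g /sg -e1 -e2 -e3.
- by move=> i; rewrite uE; exact: sm.
- split=> [x i j|i j]; last by rewrite vE; exact: sm.
  by rewrite !mxE /sv sol_v_sym.
split.
- move=> x i j k l.
  have Z4 n : sact F (slap sX sY (slap sX sY (slap sX sY (slap sX sY (Z n))))) = component f n.
    have [_ <- _] := HF n.
    have -> : F n = sact F (Z n) by apply/funext => y; rewrite sactZ.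
    by rewrite /= !(laplacian_sact sF).
  rewrite (elastic_component i j k l (ef x)) -Z4.
  have := congr1 (fun p => sact F p x) (solution_identity sX sY Z i j k l).
  rewrite sactD !sact_nat (sact_HK sF) /Hop /Kop !vE !uE -/su -/sv -/sg -/(g x i j k l).
  move: (sact F _ x) (g x i j k l) => a b.
  move: (partial i (partial j _) x) (partial k (partial l _) x) => c1 c2.
  move: (partial i _ x) (partial j _ x) (partial l _ x) (partial k _ x) => c3 c4 c5 c6.
  move: ((k == l)%:R : R) ((i == j)%:R : R) => dkl dij key.
  transitivity (4^-1 * (4%:R * a)); first by field.
  by rewrite key; field.
- move=> x; apply/rowP => i; rewrite !mxE.
  transitivity (- sact F (\sum_(j < 2) \sum_(k < 2) D j * sg i j k k) x).
    congr (- _); rewrite sact_sum; apply: eq_bigr => j _.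
    rewrite sact_sum; apply: eq_bigr => k _.
    by rewrite -(partial_sactE sF).
  by rewrite /sg sol_g_div sact0 oppr0.
- move=> x; apply/matrixP => i j; rewrite !mxE.
  transitivity (sact F (\sum_(k < 2) \sum_(l < 2) D k * (D l * sg i j k l)) x).
    rewrite sact_sum; apply: eq_bigr => k _.
    rewrite sact_sum; apply: eq_bigr => l _.
    by rewrite -!(partial_sactE sF).
  by rewrite /sg sol_g_divdiv sact0.
- have [Cu Cu0 HCu] := uniform_decay du; have [Cv Cv0 HCv] := uniform_decay dvk.
  exists (Cu + Cv) => x i j k.
  have w0 : 0 <= (1 + enorm x)^-1 by rewrite invr_ge0 addr_ge0 // enorm_ge0.
  rewrite mxE vE (partial_sactE sF) mulrDl; split.
    by apply: le_trans (HCu i x) _; rewrite lerDl mulr_ge0.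
  by apply: le_trans (HCv (k, (i, j)) x) _; rewrite lerDr mulr_ge0.
Qed.

End Existence.

(** * Uniqueness of the decomposition *)

Section Uniqueness.
Context {R : realType}.
Notation D := (sder (@sX R) (@sY R)).
Notation lap := (slap (@sX R) (@sY R)).
Implicit Types (i j k l : 'I_2) (x : 'rV[R]_2).

Lemma partial_diff i (h h' : 'rV[R]_2 -> R) x : smooth h -> smooth h' ->
  partial i (fun y => -1 * h y + h' y) x = partial i h' x - partial i h x.
Proof.
move=> sh sh'; have /(congr1 (@^~ x)) := partials_lin [:: i] (-1) sh sh'.
by rewrite mulN1r addrC.
Qed.

Lemma partial2_diff i j (h h' : 'rV[R]_2 -> R) x : smooth h -> smooth h' ->
  partial i (partial j (fun y => -1 * h y + h' y)) x =
  partial i (partial j h') x - partial i (partial j h) x.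
Proof.
move=> sh sh'; have /(congr1 (@^~ x)) := partials_lin [:: i; j] (-1) sh sh'.
by rewrite mulN1r addrC.
Qed.

(** Two decompositions of the same field, and the differences [du] and [dv] of
    their potentials. *)
Section Difference.
Variables (f g g' : 'rV[R]_2 -> tensor4 R 2) (u u' : 'rV[R]_2 -> 'rV[R]_2).
Variables (v v' : 'rV[R]_2 -> 'M[R]_2).
Hypothesis dec : elastic_decomposition f g u v.
Hypothesis dec' : elastic_decomposition f g' u' v'.

Let du i : 'rV[R]_2 -> R := fun x => -1 * u' x 0 i + u x 0 i.
Let dv i j : 'rV[R]_2 -> R := fun x => -1 * v' x i j + v x i j.

Let su i : smooth (fun x => u x 0 i). Proof. by have [[_ H _] _] := dec; exact: H. Qed.
Let su' i : smooth (fun x => u' x 0 i). Proof. by have [[_ H _] _] := dec'; exact: H. Qed.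
Let sv i j : smooth (fun x => v x i j).
Proof. by have [[_ _ [_ H]] _] := dec; exact: H. Qed.
Let sv' i j : smooth (fun x => v' x i j).
Proof. by have [[_ _ [_ H]] _] := dec'; exact: H. Qed.
Let sg i j k l : smooth (fun x => g x i j k l).
Proof. by have [[[_ H] _ _] _] := dec; exact: H. Qed.
Let sg' i j k l : smooth (fun x => g' x i j k l).
Proof. by have [[[_ H] _ _] _] := dec'; exact: H. Qed.
Let sdu i : smooth (du i). Proof. exact: smooth_lin (su' i) (su i). Qed.
Let sdv i j : smooth (dv i j). Proof. exact: smooth_lin (sv' i j) (sv i j). Qed.

(** The unknowns of the symbol calculus: the independent components of [du] and
    [dv]. *)
Let F (n : nat) : 'rV[R]_2 -> R :=
  match n with
  | 0%N => du 0 | 1%N => du 1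
  | 2%N => dv 0 0 | 3%N => dv 0 1 | _ => dv 1 1
  end.

Let sF n : smooth (F n).
Proof. by move: n => [|[|[|[|n]]]]; [exact: sdu|exact: sdu|exact: sdv|exact: sdv|exact: sdv]. Qed.

Notation L := (sact F).
Notation Z := (@sZ R).

Let L_u i : L (gen_u Z i) = du i.
Proof. by apply/funext => x; rewrite sactZ; case: (ord2P i) => ->. Qed.

Let L_v i j : L (gen_v Z i j) = dv i j.
Proof.
apply/funext => x; rewrite sactZ.
case: (ord2P i) => ->; case: (ord2P j) => -> //.
have [[_ _ [e _]] _] := dec; have [[_ _ [e' _]] _] := dec'.
by rewrite /= /dv (e x 0 1) (e' x 0 1).
Qed.

(** As both decompositions add up to [f], the difference of the [H + K] parts is
    minus the difference of the [g] parts, and so it is annihilated by [K*] and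
    [H*]. *)
Let L_w i j k l : L (gen_w sX sY Z i j k l) =
  (fun x => 4%:R * (-1 * g x i j k l + g' x i j k l)).
Proof.
apply/funext => x; rewrite /gen_w (sact_HK sF) !L_u !L_v.
have [[_ _ _] [E _ _ _]] := dec; have [[_ _ _] [E' _ _ _]] := dec'.
move: (E x i j k l) (E' x i j k l); rewrite /Hop /Kop.
rewrite (partial2_diff i j x (sv' k l) (sv k l)) (partial2_diff k l x (sv' i j) (sv i j)).
rewrite (partial_diff i x (su' j) (su j)) (partial_diff j x (su' i) (su i)).
rewrite (partial_diff l x (su' k) (su k)) (partial_diff k x (su' l) (su l)).
move: ((k == l)%:R : R) ((i == j)%:R : R) (f x i j k l) (g x i j k l) (g' x i j k l).
move: (partial i (partial j _) x) (partial k (partial l _) x)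
  (partial i (partial j _) x) (partial k (partial l _) x).
move: (partial i _ x) (partial j _ x) (partial l _ x) (partial k _ x)
  (partial i _ x) (partial j _ x) (partial l _ x) (partial k _ x).
move=> a1 a2 a3 a4 b1 b2 b3 b4 c1 c2 d1 d2 dkl dij fx gx gx' e e'.
have -> : gx = fx - (2^-1 * (d1 + d2) + (4^-1 * (b1 + b2) * dkl + 4^-1 * (b3 + b4) * dij)).
  by rewrite e; ring.
have -> : gx' = fx - (2^-1 * (c1 + c2) + (4^-1 * (a1 + a2) * dkl + 4^-1 * (a3 + a4) * dij)).
  by rewrite e'; ring.
by field.
Qed.

Let sgd i j k l : smooth (fun x => -1 * g x i j k l + g' x i j k l).
Proof. exact: smooth_lin (sg i j k l) (sg' i j k l). Qed.

Let Lw1 m i j k l x : L (D m * gen_w sX sY Z i j k l) x =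
  4%:R * (partial m (fun y => g' y i j k l) x - partial m (fun y => g y i j k l) x).
Proof.
rewrite -(partial_sactE sF) L_w (partialZ m _ (sgd i j k l)).
by rewrite (partial_diff m x (sg i j k l) (sg' i j k l)).
Qed.

Let Lw2 m n i j k l x : L (D m * (D n * gen_w sX sY Z i j k l)) x =
  4%:R * (partial m (partial n (fun y => g' y i j k l)) x
          - partial m (partial n (fun y => g y i j k l)) x).
Proof.
rewrite -!(partial_sactE sF) L_w (partialZ n _ (sgd i j k l)).
rewrite (partialZ m _ (smooth_partial n (sgd i j k l))).
by rewrite (partial2_diff m n x (sg i j k l) (sg' i j k l)).
Qed.

Let sum_scaled_diff (c : R) (A B : 'I_2 -> 'I_2 -> R) :
  \sum_(a < 2) \sum_(b < 2) A a b = 0 -> \sum_(a < 2) \sum_(b < 2) B a b = 0 ->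
  \sum_(a < 2) \sum_(b < 2) c * (A a b - B a b) = 0.
Proof.
rewrite !sum2 => hA hB.
transitivity (c * ((A 0 0 + A 0 1 + (A 1 0 + A 1 1)) - (B 0 0 + B 0 1 + (B 1 0 + B 1 1)))).
  by ring.
by rewrite hA hB subrr mulr0.
Qed.

Let null_div i : null F (gen_div sX sY Z i).
Proof.
have [_ [_ K0 _ _]] := dec; have [_ [_ K0' _ _]] := dec'.
move=> x; rewrite /gen_div (sact_sum F).
have -> : \sum_(j < 2) L (\sum_(k < 2) D j * gen_w sX sY Z i j k k) x =
    \sum_(j < 2) \sum_(k < 2) 4%:R *
      (partial j (fun y => g' y i j k k) x - partial j (fun y => g y i j k k) x).
  by apply: eq_bigr => j _; rewrite (sact_sum F); apply: eq_bigr => k _; exact: Lw1.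
apply: sum_scaled_diff; apply: oppr_inj; rewrite oppr0.
  by have /matrixP/(_ 0 i) := K0' x; rewrite mxE [RHS]mxE.
by have /matrixP/(_ 0 i) := K0 x; rewrite mxE [RHS]mxE.
Qed.

Let null_divdiv i j : null F (gen_divdiv sX sY Z i j).
Proof.
have [_ [_ _ H0 _]] := dec; have [_ [_ _ H0' _]] := dec'.
move=> x; rewrite /gen_divdiv (sact_sum F).
have -> : \sum_(k < 2) L (\sum_(l < 2) D k * (D l * gen_w sX sY Z i j k l)) x =
    \sum_(k < 2) \sum_(l < 2) 4%:R *
      (partial k (partial l (fun y => g' y i j k l)) x
       - partial k (partial l (fun y => g y i j k l)) x).
  by apply: eq_bigr => k _; rewrite (sact_sum F); apply: eq_bigr => l _; exact: Lw2.
apply: sum_scaled_diff.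
  by have /matrixP/(_ i j) := H0' x; rewrite mxE [RHS]mxE.
by have /matrixP/(_ i j) := H0 x; rewrite mxE [RHS]mxE.
Qed.

Let null4 p : null F (4%:R * p) -> null F p.
Proof.
move=> h x; apply/(@mulfI _ 4%:R); first by rewrite pnatr_eq0.
by rewrite mulr0 -sact_nat h.
Qed.

Let null_sum22 G : (forall a b, null F (G a b)) -> null F (sum22 G).
Proof. by move=> hG; do 2 (apply: null_sum => ?); exact: hG. Qed.

(** The right-hand sides of [gauge_u_elliptic] and [gauge_v_elliptic]
    vanish. *)
Let hdd := null_sum22 (fun a b => null_der sF a (null_der sF b (null_divdiv a b))).
Let hee := null_nat 2 (null_sum22 (fun a b => null_eta sF a (null_eta sF b (null_divdiv a b)))).
Let hde := null_sum22 (fun a b => null_der sF a (null_eta sF b (null_divdiv a b))).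
Let hlap := null_lap sF (null_sum (fun a : 'I_2 => null_eta sF a (null_div a))).

Let null_gauge_u i : null F (lap (lap (lap (gauge_u sX sY Z i)))).
Proof.
apply: null4; rewrite gauge_u_elliptic; apply: nullD.
  exact: (null_der sF i (nullD hdd hee)).
exact: (null_nat 8 (null_eta sF i (nullB hlap hde))).
Qed.

Let null_gauge_v i j : null F (lap (lap (lap (lap (gauge_v Z i j))))).
Proof.
apply: null4; rewrite (gauge_v_elliptic sX sY); apply: nullD.
  apply: nullB; first exact: (null_der sF i (null_der sF j (nullB hdd hee))).
  exact: (null_eta sF i (null_eta sF j (nullB hdd hee))).
have hM := nullB (null_nat 2 hde) hlap.
apply: null_nat; apply: nullD.
  exact: (null_der sF i (null_eta sF j hM)).
exact: (null_eta sF i (null_der sF j hM)).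
Qed.

Let decay_u i : decaying (du i).
Proof.
apply: decaying_lin.
  by have [_ [_ _ _ [C H]]] := dec'; exists C => x; have [h _] := H x i 0 0.
by have [_ [_ _ _ [C H]]] := dec; exists C => x; have [h _] := H x i 0 0.
Qed.

Let decay_v k i j : decaying (partial k (dv i j)).
Proof.
have -> : partial k (dv i j) = (fun x => -1 * partial k (fun y => v' y i j) x
    + partial k (fun y => v y i j) x).
  exact: (partials_lin [:: k] (-1) (sv' i j) (sv i j)).
apply: decaying_lin.
  by have [_ [_ _ _ [C H]]] := dec'; exists C => x; have [_ h] := H x i j k.
by have [_ [_ _ _ [C H]]] := dec; exists C => x; have [_ h] := H x i j k.
Qed.

(** The gauge-fixed [u] and the gradient of the gauge-fixed [v] are decaying
    and polyharmonic, hence zero by [polyharmonic_liouville]. *)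
Let gauge_u0 i : null F (gauge_u sX sY Z i).
Proof.
have [C HC] : decaying (L (gauge_u sX sY Z i)).
  have -> : L (gauge_u sX sY Z i) =
      (fun x => 2%:R * du i x + (partial i (dv 0 0) x + partial i (dv 1 1) x)).
    apply/funext => x; rewrite /gauge_u sactD sact_nat L_u (mulrDr (D i)) sactD.
    by rewrite -!(partial_sactE sF) !L_v.
  by apply: decaying_lin => //; apply: decayingD.
apply: (polyharmonic_liouville (m := 3) (smooth_sact sF _) _ HC) => y.
by rewrite /= !(laplacian_sact sF); exact: null_gauge_u.
Qed.

Let gauge_v0 k i j : null F (D k * gauge_v Z i j).
Proof.
have [C HC] : decaying (L (D k * gauge_v Z i j)).
  have -> : L (D k * gauge_v Z i j) =
      (fun x => 2%:R * partial k (dv i j) x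
        + - (i == j)%:R * (partial k (dv 0 0) x + partial k (dv 1 1) x)).
    apply/funext => x; rewrite /gauge_v mulrBr mulrCA [D k * ((i == j)%:R * _)]mulrCA.
    rewrite sactB !sact_nat (mulrDr (D k)) sactD -!(partial_sactE sF) !L_v.
    by rewrite mulNr.
  by apply: decayingD; apply: decayingZ => //; exact: decayingD.
apply: (polyharmonic_liouville (m := 4) (smooth_sact sF _) _ HC) => y.
rewrite /= !(laplacian_sact sF).
rewrite !slap_mull; exact: (null_der sF k (null_gauge_v i j)).
Qed.

Let g_unique x i j k l : g x i j k l = g' x i j k l.
Proof.
have : null F (2%:R * gen_w sX sY Z i j k l).
  rewrite gauge_HK; apply: nullD; last first.
    apply: null_nat; apply: nullD; exact: null_der.
  apply: nullD; last by apply: null_nat; apply: nullD; exact: null_der.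
  by apply: null_nat; apply: nullD; apply: null_der.
move=> /(_ x); rewrite sact_nat L_w => h.
have : 8 * (g' x i j k l - g x i j k l) = 0.
  by rewrite -h; ring.
by move/eqP; rewrite mulf_eq0 pnatr_eq0 /= subr_eq0 => /eqP.
Qed.

Lemma elastic_decomposition_unique x i j k l : g x i j k l = g' x i j k l /\
  Hop v x i j k l + Kop u x i j k l = Hop v' x i j k l + Kop u' x i j k l.
Proof.
have [_ [E _ _ _]] := dec; have [_ [E' _ _ _]] := dec'.
split; first exact: g_unique.
by apply: (addIr (g x i j k l)); rewrite -E g_unique -E'.
Qed.

End Difference.
End Uniqueness.

Theorem theorem7 (R : realType) (f : 'rV[R]_2 -> tensor4 R 2)
    (hf : schwartz_elastic2_field f)
    (hf0 : forall i j k l : 'I_2, integral2 (fun x => f x i j k l) = 0%E) :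
  (exists (g : 'rV[R]_2 -> tensor4 R 2) (u : 'rV[R]_2 -> 'rV[R]_2)
          (v : 'rV[R]_2 -> 'M[R]_2), elastic_decomposition f g u v) /\
  (forall (g g' : 'rV[R]_2 -> tensor4 R 2) (u u' : 'rV[R]_2 -> 'rV[R]_2)
          (v v' : 'rV[R]_2 -> 'M[R]_2),
     elastic_decomposition f g u v -> elastic_decomposition f g' u' v' ->
     forall (x : 'rV[R]_2) (i j k l : 'I_2),
       g x i j k l = g' x i j k l /\
       Hop v x i j k l + Kop u x i j k l = Hop v' x i j k l + Kop u' x i j k l).
Proof.
split; first exact: elastic_decomposition_exists.
move=> g g' u u' v v' dec dec' x i j k l.
exact: (elastic_decomposition_unique dec dec').
Qed.
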